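(* For a (normal) class $\mathcal{P}$ of posets and a set $A$ (of parameters), $(\mathcal{P},A)$-$\mathsf{RcA}$ holds if and only if $\mathsf{IGH}(\mathcal{P},A)$ holds.
   Context: The background theory is $\mathsf{ZFC}$, $\mathsf V$ is the universe, and $\mathcal{L}_\in$ is the language of set theory. A class $\mathcal{P}$ of posets is identified with the $\mathcal{L}_\in$-formula defining it and is reinterpreted accordingly in other models. $\mathcal{P}$ is normal if $\{\mathbb{1}\}\in\mathcal{P}$ and $\mathcal{P}$ is closed under forcing equivalence. $\overline a\in A$ means that $\overline a$ is a finite tuple of elements of $A$. An inner model $\mathsf{W}_0$ of $\mathsf{W}$ is a ground of $\mathsf{W}$ if there are a poset $\mathbb{P}\in\mathsf{W}_0$ and a $(\mathsf{W}_0,\mathbb{P})$-generic $\mathbb{G}\in\mathsf{W}$ with $\mathsf{W}_0[\mathbb{G}]=\mathsf{W}$. Grounds are uniformly definable with parameters, so one can quantify over them in $\mathcal{L}_\in$. $(\mathcal{P},A)$-$\mathsf{RcA}$ (Recurrence Axiom) is the scheme: for any $\mathbb{P}\in\mathcal{P}$, any $\mathcal{L}_\in$-formula $\varphi(\overline{x})$ and $\overline{a}\in A$, if $\Vdash_{\mathbb{P}}\varphi(\check{\overline{a}})$, then there is a ground $M$ of $\mathsf{V}$ with $\overline{a}\in M$ and $M\models\varphi(\overline{a})$. $\mathsf{IGH}(\mathcal{P},A)$ (Inner Ground Hypothesis) is the scheme: for any $\mathcal{L}_\in$-formula $\varphi(\overline{x})$ and $\overline{a}\in A$, if some $\mathbb{P}\in\mathcal{P}$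 forces ''there is a ground $M$ with $\overline{a}\in M$ satisfying $\varphi(\overline{a})$'', then there is a ground $\mathsf{W}$ of $\mathsf{V}$ such that $\overline{a}\in\mathsf{W}$ and $\mathsf{W}\models\varphi(\overline{a})$. *)

(* Defs.v *)
From mathcomp Require Import all_boot.

Set Implicit Arguments.
Unset Strict Implicit.
Unset Printing Implicit Defensive.

(** A statement about the universe V of ZFC is rendered as a statement about
    an arbitrary model of ZFC: a type with a binary relation, the equality
    being that of Rocq.  The model need not be well-founded, so recursive
    notions (names, check names, evaluation, forcing) are not defined by
    recursion in Rocq on elements of the model: they are given inside the
    model, by means of sets of the model that satisfy the recursion clauses. *)

Record structure := MkStructure {
  carrier :> Type;
  elt : carrier -> carrier -> Prop
}.

Notation "x ∈ y" := (elt x y) (at level 70, no associativity).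

(** * The language of set theory *)

(** Formulas whose free variables are in [X]; in [FAll f], the variable [None]
    of [f] is the bound one.  [formula 'I_n] is thus the type of formulas in
    the variables x_0, ..., x_(n-1). *)
Inductive formula (X : Type) : Type :=
| FMem (x y : X)
| FEq (x y : X)
| FNot (f : formula X)
| FAnd (f g : formula X)
| FAll (f : formula (option X)).

Definition FEx (X : Type) (f : formula (option X)) : formula X := FNot (FAll (FNot f)).
Definition FImp (X : Type) (f g : formula X) : formula X := FNot (FAnd f (FNot g)).

Definition scons (X T : Type) (v : T) (e : X -> T) (o : option X) : T :=
  if o is Some x then e x else v.

Fixpoint sat (M : structure) (X : Type) (f : formula X) : (X -> M) -> Prop :=
  match f return (X -> M) -> Prop with
  | FMem x y => fun e => e x ∈ e y
  | FEq x y => fun e => e x = e y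
  | FNot g => fun e => ~ sat g e
  | FAnd g h => fun e => sat g e /\ sat h e
  | FAll g => fun e => forall v : M, sat g (scons v e)
  end.

Fixpoint frename (X Y : Type) (rho : X -> Y) (f : formula X) : formula Y :=
  match f return (X -> Y) -> formula Y with
  | FMem x y => fun rho => FMem (rho x) (rho y)
  | FEq x y => fun rho => FEq (rho x) (rho y)
  | FNot g => fun rho => FNot (frename rho g)
  | FAnd g h => fun rho => FAnd (frename rho g) (frename rho h)
  | FAll g => fun rho => FAll (frename (omap rho) g)
  end rho.

(** Classes are definable with parameters. *)
Definition definable (M : structure) (K : M -> Prop) : Prop :=
  exists n (f : formula (option 'I_n)) (e : 'I_n -> M),
    forall x, K x <-> sat f (scons x e).

(** The substructure on a class. *)
Definition sub (M : structure) (W : M -> Prop) : structure :=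
  @MkStructure {x : M | W x} (fun x y => sval x ∈ sval y).

(** The tuple [a] belongs to W, and W satisfies f(a). *)
Definition holds_in (M : structure) (W : M -> Prop) n (f : formula 'I_n)
    (a : 'I_n -> M) : Prop :=
  exists b : 'I_n -> sub W, (forall i, sval (b i) = a i) /\ sat f b.

(** * ZFC *)

Record ZFC (M : structure) : Prop := {
  zfc_extensionality : forall x y : M, (forall z, z ∈ x <-> z ∈ y) -> x = y;
  zfc_foundation : forall x : M, (exists y, y ∈ x) ->
    exists y, y ∈ x /\ forall z, z ∈ y -> ~ z ∈ x;
  zfc_pairing : forall x y : M, exists z, forall w, w ∈ z <-> w = x \/ w = y;
  zfc_union : forall x : M, exists y, forall z,
    z ∈ y <-> exists w, w ∈ x /\ z ∈ w;
  zfc_power : forall x : M, exists y, forall z,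
    z ∈ y <-> forall w, w ∈ z -> w ∈ x;
  zfc_infinity : exists w : M,
    (exists z, z ∈ w /\ forall u, ~ u ∈ z) /\
    (forall x, x ∈ w -> exists y, y ∈ w /\ forall u, u ∈ y <-> u ∈ x \/ u = x);
  zfc_choice : forall x : M,
    (forall y, y ∈ x -> exists z, z ∈ y) ->
    (forall y z u, y ∈ x -> z ∈ x -> u ∈ y -> u ∈ z -> y = z) ->
    exists c, forall y, y ∈ x -> exists! z, z ∈ y /\ z ∈ c;
  zfc_separation : forall n (f : formula (option 'I_n)) (e : 'I_n -> M) (x : M),
    exists y, forall z, z ∈ y <-> z ∈ x /\ sat f (scons z e);
  zfc_replacement : forall n (f : formula (option (option 'I_n)))
      (e : 'I_n -> M) (x : M),
    (forall u v w, u ∈ x -> sat f (scons v (scons u e)) ->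
       sat f (scons w (scons u e)) -> v = w) ->
    exists y, forall v,
      v ∈ y <-> exists u, u ∈ x /\ sat f (scons v (scons u e))
}.

Section SetTheory.
Variable M : structure.
Implicit Types x y z u v w : M.

(** z = {{x}, {x, y}} *)
Definition opair z x y : Prop :=
  forall w, w ∈ z <->
    (forall u, u ∈ w <-> u = x) \/ (forall u, u ∈ w <-> u = x \/ u = y).

(** The pair of [x] and [y] is an element of [r]. *)
Definition app (r x y : M) : Prop := exists z, opair z x y /\ z ∈ r.

Definition function_on (f d : M) : Prop := forall x, x ∈ d -> exists! y, app f x y.

Definition transitive_set x : Prop := forall y z, y ∈ x -> z ∈ y -> z ∈ x.

Definition ordinal x : Prop :=
  transitive_set x /\ forall y, y ∈ x -> transitive_set y.

(** * Posets *)

(** [X] is the pair (C, L), where L is a partial order on C with greatest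
    element [one]. *)
Record poset (X C L one : M) : Prop := {
  poset_pair : opair X C L;
  poset_graph : forall z, z ∈ L -> exists p q, [/\ p ∈ C, q ∈ C & opair z p q];
  poset_refl : forall p, p ∈ C -> app L p p;
  poset_antisym : forall p q, app L p q -> app L q p -> p = q;
  poset_trans : forall p q r, app L p q -> app L q r -> app L p r;
  poset_one : one ∈ C;
  poset_greatest : forall p, p ∈ C -> app L p one
}.

Definition is_poset X : Prop := exists C L one, poset X C L one.

Definition trivial_poset X : Prop :=
  exists C L one, poset X C L one /\ forall p, p ∈ C -> p = one.

Definition compatible (C L p q : M) : Prop :=
  exists r, [/\ r ∈ C, app L r p & app L r q].

Definition dense_embedding (C L C' L' i : M) : Prop :=
  [/\ function_on i C,
      forall p p', p ∈ C -> app i p p' -> p' ∈ C',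
      forall p q p' q', p ∈ C -> q ∈ C -> app i p p' -> app i q q' ->
        app L p q -> app L' p' q',
      forall p q p' q', p ∈ C -> q ∈ C -> app i p p' -> app i q q' ->
        compatible C' L' p' q' -> compatible C L p q
    & forall r, r ∈ C' -> exists p p', [/\ p ∈ C, app i p p' & app L' p' r]].

(** Both posets embed densely into a third one; equivalently, their Boolean
    completions are isomorphic. *)
Definition forcing_equivalent (X Y : M) : Prop :=
  exists C1 L1 one1 C2 L2 one2 Z C L one i j,
    [/\ poset X C1 L1 one1, poset Y C2 L2 one2, poset Z C L one,
        dense_embedding C1 L1 C L i & dense_embedding C2 L2 C L j].

Definition normal (P : M -> Prop) : Prop :=
  (exists X, trivial_poset X /\ P X) /\
  (forall X Y, P X -> forcing_equivalent X Y -> P Y).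

(** * Names *)

(** [t] is a name for a poset with underlying set [C]: hereditarily a set of
    pairs (name, condition). *)
Definition is_name (C t : M) : Prop :=
  exists T, t ∈ T /\ forall s, s ∈ T -> forall z, z ∈ s ->
    exists u p, [/\ u ∈ T, p ∈ C & opair z u p].

(** [T] contains the first components of the pairs in its elements. *)
Definition name_closed (T : M) : Prop :=
  forall s u p, s ∈ T -> app s u p -> u ∈ T.

(** [t] is the check name {(check y, one) : y ∈ x} of [x]. *)
Definition check_name (one x t : M) : Prop :=
  exists T f, [/\ x ∈ T, transitive_set T, function_on f T, app f x t &
    forall y s, y ∈ T -> app f y s -> forall z, z ∈ s <->
      exists v u, [/\ v ∈ y, app f v u & opair z u one]].

(** [x] is the value {val(u) : (u, p) ∈ t for some p ∈ G} of the name [t]. *)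
Definition name_value (G t x : M) : Prop :=
  exists T f, [/\ t ∈ T, name_closed T, function_on f T, app f t x &
    forall s y, s ∈ T -> app f s y -> forall z, z ∈ y <->
      exists u p, [/\ p ∈ G, app s u p & app f u z]].

(** * The forcing relation *)

Section Forcing.
Variables (C L : M).

Definition dense_below (p : M) (D : M -> Prop) : Prop :=
  forall q, app L q p -> exists r, app L r q /\ D r.

(** Recursion clauses for p ⊩ s ⊆ t and p ⊩ s = t, in terms of R r u v for
    r ⊩ u = v, with u and v in the domains of s and t. *)
Definition forces_sub_step (R : M -> M -> M -> Prop) (p s t : M) : Prop :=
  forall u a q, app s u a -> app L q p -> app L q a ->
    dense_below q (fun r => exists v b, [/\ app t v b, app L r b & R r u v]).

Definition forces_eq_step (R : M -> M -> M -> Prop) (p s t : M) : Prop :=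
  forces_sub_step R p s t /\ forces_sub_step (fun r u v => R r v u) p t s.

(** The triple (p, (s, t)) is an element of [F]. *)
Definition in_table (F p s t : M) : Prop := exists y, opair y s t /\ app F p y.

Definition forces_eq (p s t : M) : Prop :=
  exists T F, [/\ s ∈ T, t ∈ T, name_closed T, in_table F p s t &
    forall q u v, q ∈ C -> u ∈ T -> v ∈ T ->
      (in_table F q u v <-> forces_eq_step (in_table F) q u v)].

Definition forces_mem (p s t : M) : Prop :=
  dense_below p (fun q => exists u a, [/\ app t u a, app L q a & forces_eq q s u]).

Fixpoint forces (X : Type) (f : formula X) : (X -> M) -> M -> Prop :=
  match f return (X -> M) -> M -> Prop with
  | FMem x y => fun e p => forces_mem p (e x) (e y)
  | FEq x y => fun e p => forces_eq p (e x) (e y)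
  | FNot g => fun e p => forall q, app L q p -> ~ forces g e q
  | FAnd g h => fun e p => forces g e p /\ forces h e p
  | FAll g => fun e p => forall t, is_name C t -> forces g (scons t e) p
  end.

End Forcing.

(** Every condition of the poset [X] forces f(check a). *)
Definition forced (X : M) n (f : formula 'I_n) (a : 'I_n -> M) : Prop :=
  exists C L one (t : 'I_n -> M),
    [/\ poset X C L one, forall i, check_name one (a i) (t i)
      & forall p, p ∈ C -> forces C L f t p].

(** * Grounds *)

Record inner_model (W : M -> Prop) : Prop := {
  inner_definable : definable W;
  inner_transitive : forall x y, W x -> y ∈ x -> W y;
  inner_ordinals : forall x, ordinal x -> W x;
  inner_ZFC : ZFC (sub W)
}.

(** [G] is a (W, (C, L))-generic filter. *)
Record generic (W : M -> Prop) (C L G : M) : Prop := {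
  generic_sub : forall p, p ∈ G -> p ∈ C;
  generic_nonempty : exists p, p ∈ G;
  generic_up : forall p q, p ∈ G -> app L p q -> q ∈ G;
  generic_directed : forall p q, p ∈ G -> q ∈ G ->
    exists r, [/\ r ∈ G, app L r p & app L r q];
  generic_dense : forall D, W D ->
    (forall p, p ∈ D -> p ∈ C) ->
    (forall p, p ∈ C -> exists q, q ∈ D /\ app L q p) ->
    exists p, p ∈ D /\ p ∈ G
}.

Definition ground (W : M -> Prop) : Prop :=
  inner_model W /\
  exists X C L one G,
    [/\ W X, poset X C L one, generic W C L G &
        forall x, exists t, [/\ W t, is_name C t & name_value G t x]].

End SetTheory.

(** * Quantification over grounds inside the language *)

(** The class W_r defined by [gamma] from the parameter [r]; the variable
    [None] of [gamma] is the element and [Some tt] is the parameter. *)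
Definition class_of (gamma : formula (option unit)) (M : structure) (r : M) :
    M -> Prop :=
  fun x => sat gamma (scons x (fun _ => r)).

(** [gamma] is a uniform definition of the grounds with parameters: in every
    model of ZFC the classes W_r are exactly the grounds.  Such a formula
    exists by the theorem of Laver and Woodin in the uniform version of Fuchs,
    Hamkins and Reitz. *)
Definition uniformly_defines_grounds (gamma : formula (option unit)) : Prop :=
  forall M : structure, ZFC M ->
    (forall r : M, ground (class_of gamma r)) /\
    (forall W : M -> Prop, ground W ->
       exists r : M, forall x, W x <-> class_of gamma r x).

(** The formula "x ∈ W_r". *)
Definition in_class (gamma : formula (option unit)) (X : Type) (x r : X) : formula X :=
  frename (scons x (fun _ : unit => r)) gamma.

(** The relativization of [f] to W_r. *)
Fixpoint relativize (gamma : formula (option unit)) (X : Type) (r : X) (f : formula X) :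
    formula X :=
  match f return X -> formula X with
  | FMem x y => fun _ => FMem x y
  | FEq x y => fun _ => FEq x y
  | FNot g => fun r => FNot (relativize gamma r g)
  | FAnd g h => fun r => FAnd (relativize gamma r g) (relativize gamma r h)
  | FAll g => fun r =>
      FAll (FImp (in_class gamma None (Some r)) (relativize gamma (Some r) g))
  end r.

(** The formula "there is a ground W_r with x_0, ..., x_(n-1) ∈ W_r and
    W_r ⊨ f(x_0, ..., x_(n-1))"; the variable [None] stands for r. *)
Definition in_some_ground (gamma : formula (option unit)) n (f : formula 'I_n) :
    formula 'I_n :=
  FEx (foldr (@FAnd _) (relativize gamma None (frename Some f))
         [seq in_class gamma (Some i) None | i <- enum 'I_n]).

(** * The two axiom schemes *)

Definition RcA (V : structure) (P : V -> Prop) (A : V) : Prop :=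
  forall X : V, P X ->
  forall n (f : formula 'I_n) (a : 'I_n -> V), (forall i, a i ∈ A) ->
    forced X f a -> exists W : V -> Prop, ground W /\ holds_in W f a.

Definition IGH (gamma : formula (option unit)) (V : structure) (P : V -> Prop)
    (A : V) : Prop :=
  forall n (f : formula 'I_n) (a : 'I_n -> V), (forall i, a i ∈ A) ->
    (exists X : V, P X /\ forced X (in_some_ground gamma f) a) ->
    exists W : V -> Prop, ground W /\ holds_in W f a.

(* Main.v *)
Require Import Defs.
From mathcomp Require Import all_boot.
From Stdlib Require Import Classical ClassicalEpsilon FunctionalExtensionality
  PropExtensionality.

Set Implicit Arguments.
Unset Strict Implicit.
Unset Printing Implicit Defensive.

(** That [IGH] implies [RcA] rests on the fact that every universe is a ground of
    itself: if a poset forces f(a), then it forces that some ground satisfies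
    f(a), and the Inner Ground Hypothesis brings such a ground to V. Conversely,
    the Recurrence Axiom, applied to the formula saying that some ground
    satisfies f(a), gives a ground W of V in which this formula holds; a ground
    of W is a ground of V, as two generic extensions can be made in one step.

    Grounds are recognized by a formula that is only known to be right in models
    of ZFC. The first direction therefore needs an actual model of what is
    forced. If a condition q forced f(a) but also that no ground satisfies it,
    take a countable class D of the model that is closed under definable
    witnesses ([elementary_hull]) and a filter that contains q and meets all
    dense classes definable from elements of D ([descent_generic]). The names in
    D, modulo being forced equal by a condition of the filter, form a structure
    ([quotient_extension]) in which truth is what the filter forces ([truth]) and
    in which ZFC holds ([extension_ZFC]); that structure is a ground of itself by
    the trivial forcing ([ground_all]), a contradiction. This is
    [forced_in_some_ground].

    For the second direction ([ground_trans]), let W = M[G] and V = W[H]. The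
    conditions of the iteration are the pairs (p, q) of M where p forces that q
    is in the second poset, ordered through what p forces about down-sets, and
    the pairs with p in G and the value of q in H form a generic filter
    ([iteration_generic]). To see that every set is the value of a name for the
    iteration, no names are translated: the class of values is a model of ZFC
    that contains M and the generic filter, hence G and H; evaluating names
    inside that model shows that it contains W, and then V ([iteration_values]).
    The truth lemma and the verification of ZFC are those of the first direction,
    with D the whole ground model: both cases are covered by one notion of a
    structure obeying the forcing relation ([extension]).

    Because models need not be well-founded, all recursions (check names, values
    of names, the forcing relation of equalities, ranks) are carried out inside
    the model, from one recursion theorem for definable steps ([recursion]). The
    definability that separation and replacement ask for is proved by matching
    the logical form of the predicates ([defin] and its closure lemmas). *)

(** * Formulas and definability with parameters *)

Lemma sat_frename (M : structure) (X Y : Type) (rho : X -> Y) (f : formula X)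
    (e : Y -> M) :
  sat (frename rho f) e <-> sat f (fun x => e (rho x)).
Proof.
elim: f Y rho e => {X} [X x y|X x y|X g IH|X g IHg h IHh|X g IH] Y rho e //=.
- by rewrite IH.
- by rewrite IHg IHh.
- split=> H v; move/(_ v): H; rewrite IH.
  all: by congr (sat _ _); apply: functional_extensionality; case.
Qed.

Section Definability.
Variables (M : structure) (D : M -> Prop).

Definition with_params n (v : nat -> M) (e : 'I_n -> M) (s : nat + 'I_n) : M :=
  match s with inl k => v k | inr i => e i end.

(** A relation between finitely many elements of [M] is presented as a
    predicate on sequences, its arguments being [v 0], [v 1], ...; in this form
    binding a variable is a shift, and the closure lemmas below can be applied
    by unification to any predicate written with the logical connectives. *)
Definition defin (K : (nat -> M) -> Prop) : Prop :=
  exists n (f : formula (nat + 'I_n)) (e : 'I_n -> M),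
    (forall i, D (e i)) /\ forall v, K v <-> sat f (with_params v e).

Definition term (t : (nat -> M) -> M) : Prop :=
  (exists k, forall v, t v = v k) \/ (exists c, D c /\ forall v, t v = c).

Lemma defin_ext K K' : (forall v, K v <-> K' v) -> defin K' -> defin K.
Proof.
move=> E [n [f [e [De H]]]]; exists n, f, e; split=> // v.
by rewrite E H.
Qed.

Lemma term_var k : term (fun v => v k).
Proof. by left; exists k. Qed.

Lemma term_cst c : D c -> term (fun=> c).
Proof. by right; exists c. Qed.

Lemma term_shift t : term t -> term (fun v => t (fun k => v k.+1)).
Proof.
case=> [[k E]|[c [Dc E]]]; first by left; exists k.+1 => v; rewrite E.
by right; exists c.
Qed.

Lemma defin_atom (F : forall X, X -> X -> formula X) (r : M -> M -> Prop) t u :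
  (forall X (x y : X) (e : X -> M), sat (F X x y) e <-> r (e x) (e y)) ->
  term t -> term u -> defin (fun v => r (t v) (u v)).
Proof.
move=> HF [[k Ek]|[c [Dc Ec]]] [[l El]|[d [Dd Ed]]].
- exists 0, (F _ (inl k) (inl l)), (fun i : 'I_0 => False_rect M (notF (ltn_ord i))).
  by split=> [[]//|v]; rewrite HF Ek El.
- exists 1, (F _ (inl k) (inr ord0)), (fun=> d).
  by split=> // v; rewrite HF Ek Ed.
- exists 1, (F _ (inr ord0) (inl l)), (fun=> c).
  by split=> // v; rewrite HF Ec El.
- exists 2, (F _ (inr ord0) (inr (@Ordinal 2 1 isT))),
    (fun i : 'I_2 => if i == 0 :> nat then c else d).
  by split=> [i|v]; [case: ifP | rewrite HF Ec Ed].
Qed.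

Lemma defin_mem t u : term t -> term u -> defin (fun v => t v ∈ u v).
Proof. exact: (@defin_atom FMem). Qed.

Lemma defin_eq t u : term t -> term u -> defin (fun v => t v = u v).
Proof. exact: (@defin_atom FEq). Qed.

Lemma defin_not K : defin K -> defin (fun v => ~ K v).
Proof.
move=> [n [f [e [De H]]]]; exists n, (FNot f), e; split=> // v /=.
by rewrite H.
Qed.

Lemma defin_and K K' : defin K -> defin K' -> defin (fun v => K v /\ K' v).
Proof.
move=> [n [f [e [De H]]]] [n' [f' [e' [De' H']]]].
pose l (s : nat + 'I_n) : nat + 'I_(n + n') :=
  match s with inl k => inl k | inr i => inr (lshift n' i) end.
pose r (s : nat + 'I_n') : nat + 'I_(n + n') :=
  match s with inl k => inl k | inr i => inr (rshift n i) end.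
pose ee (i : 'I_(n + n')) := match split i with inl j => e j | inr j => e' j end.
have El j : ee (lshift n' j) = e j by rewrite /ee (unsplitK (inl j)).
have Er j : ee (rshift n j) = e' j by rewrite /ee (unsplitK (inr j)).
exists (n + n'), (FAnd (frename l f) (frename r f')), ee.
split=> [i|v] /=; first by rewrite /ee; case: split.
rewrite H H' !sat_frename.
have -> : (fun x => with_params v ee (l x)) = with_params v e.
  by apply: functional_extensionality; case=> //= j.
by have -> : (fun x => with_params v ee (r x)) = with_params v e'
  by apply: functional_extensionality; case=> //= j.
Qed.

Lemma defin_all (K : (nat -> M) -> M -> Prop) :
  defin (fun v => K (fun k => v k.+1) (v 0)) -> defin (fun v => forall x, K v x).
Proof.
move=> [n [f [e [De H]]]].
pose rho (s : nat + 'I_n) : option (nat + 'I_n) :=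
  match s with
  | inl 0 => None | inl k.+1 => Some (inl k) | inr i => Some (inr i)
  end.
exists n, (FAll (frename rho f)), e; split=> // v /=.
have E x : K v x <-> sat (frename rho f) (scons x (with_params v e)).
  rewrite sat_frename; set e' := fun s => _.
  have -> : e' = with_params (fun k => if k is k'.+1 then v k' else x) e.
    by apply: functional_extensionality; case=> [[]|].
  by rewrite -H.
by split=> HK x; apply/E/HK.
Qed.

Lemma defin_or K K' : defin K -> defin K' -> defin (fun v => K v \/ K' v).
Proof.
move=> dK dK'; apply: (@defin_ext _ (fun v => ~ (~ K v /\ ~ K' v))); last first.
  by apply/defin_not/defin_and; apply: defin_not.
by move=> v; split; [tauto | case: (classic (K v)) => ?; tauto].
Qed.

Lemma defin_imp K K' : defin K -> defin K' -> defin (fun v => K v -> K' v).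
Proof.
move=> dK dK'; apply: (@defin_ext _ (fun v => ~ K v \/ K' v)); last first.
  by apply/defin_or => //; apply: defin_not.
by move=> v; case: (classic (K v)) => ?; tauto.
Qed.

Lemma defin_iff K K' : defin K -> defin K' -> defin (fun v => K v <-> K' v).
Proof. by move=> dK dK'; apply: defin_and; apply: defin_imp. Qed.

Lemma defin_ex (K : (nat -> M) -> M -> Prop) :
  defin (fun v => K (fun k => v k.+1) (v 0)) -> defin (fun v => exists x, K v x).
Proof.
move=> dK; apply: (@defin_ext _ (fun v => ~ forall x, ~ K v x)).
  by move=> v; split=> [[x Kx] /(_ x)//|H]; apply: NNPP => H'; apply: H => x Kx;
    apply: H'; exists x.
by apply/defin_not/(@defin_all (fun v x => ~ K v x))/defin_not.
Qed.

Lemma defin_and3 K1 K2 K3 : defin K1 -> defin K2 -> defin K3 ->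
  defin (fun v => [/\ K1 v, K2 v & K3 v]).
Proof.
move=> d1 d2 d3; apply: (@defin_ext _ (fun v => K1 v /\ K2 v /\ K3 v)).
  by move=> v; split; [case | case=> ? []].
by do ![apply: defin_and => //].
Qed.

Lemma defin_and4 K1 K2 K3 K4 : defin K1 -> defin K2 -> defin K3 -> defin K4 ->
  defin (fun v => [/\ K1 v, K2 v, K3 v & K4 v]).
Proof.
move=> d1 d2 d3 d4.
apply: (@defin_ext _ (fun v => K1 v /\ K2 v /\ K3 v /\ K4 v)).
  by move=> v; split; [case | case=> ? [? []]].
by do ![apply: defin_and => //].
Qed.

Lemma defin_and5 K1 K2 K3 K4 K5 :
  defin K1 -> defin K2 -> defin K3 -> defin K4 -> defin K5 ->
  defin (fun v => [/\ K1 v, K2 v, K3 v, K4 v & K5 v]).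
Proof.
move=> d1 d2 d3 d4 d5.
apply: (@defin_ext _ (fun v => K1 v /\ K2 v /\ K3 v /\ K4 v /\ K5 v)).
  by move=> v; split; [case | case=> ? [? [? []]]].
by do ![apply: defin_and => //].
Qed.

Lemma defin_unique (K : (nat -> M) -> M -> Prop) :
  defin (fun v => K (fun k => v k.+1) (v 0)) ->
  defin (fun v => K (fun k => v k.+2) (v 0)) ->
  defin (fun v => exists! x, K v x).
Proof.
move=> d1 d2; apply: (@defin_ex (fun v x => K v x /\ forall y, K v y -> x = y)).
apply: defin_and => //.
apply: (@defin_all (fun v y => K (fun k => v k.+1) y -> v 0 = y)).
by apply: defin_imp => //; apply: defin_eq; apply: term_var.
Qed.

Lemma defin_sat X (f : formula X) (t : X -> (nat -> M) -> M) :
  (forall x, term (t x)) -> defin (fun v => sat f (fun x => t x v)).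
Proof.
elim: f t => {X} [X x y|X x y|X g IH|X g IHg h IHh|X g IH] t Ht /=.
- exact: defin_mem.
- exact: defin_eq.
- exact/defin_not/IH.
- by apply: defin_and; [apply: IHg | apply: IHh].
- apply: (@defin_all (fun v a => sat g (scons a (fun x => t x v)))).
  pose t' (o : option X) (v : nat -> M) : M :=
    if o is Some x then t x (fun k => v k.+1) else v 0.
  apply: (@defin_ext _ (fun v => sat g (fun o => t' o v))).
    move=> v; suff -> : (fun o => t' o v) = scons (v 0) (fun x => t x (fun k => v k.+1)) by [].
    by apply: functional_extensionality; case.
  apply: IH => -[x|]; last exact: term_var.
  exact: term_shift.
Qed.

(** Relations of small arity, to be substituted by terms. *)
Definition defin1 (K : M -> Prop) := defin (fun v => K (v 0)).
Definition defin2 (K : M -> M -> Prop) := defin (fun v => K (v 0) (v 1)).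
Definition defin3 (K : M -> M -> M -> Prop) := defin (fun v => K (v 0) (v 1) (v 2)).

Lemma defin_subst K (t : nat -> (nat -> M) -> M) : defin K ->
  (forall k, term (t k)) -> defin (fun v => K (fun k => t k v)).
Proof.
move=> [n [f [e [De H]]]] Ht.
pose t' (s : nat + 'I_n) v := match s with inl k => t k v | inr i => e i end.
apply: (@defin_ext _ (fun v => sat f (fun x => t' x v))).
  move=> v; rewrite H.
  suff -> : with_params (t^~ v) e = t'^~ v by [].
  by apply: functional_extensionality; case.
by apply: defin_sat => -[k|i]; [apply: Ht | apply: (term_cst (De i))].
Qed.

Lemma defin_app1 K t : defin1 K -> term t -> defin (fun v => K (t v)).
Proof. by move=> dK Ht; apply: (@defin_subst _ (fun=> t) dK). Qed.

Lemma defin_app2 K t u : defin2 K -> term t -> term u ->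
  defin (fun v => K (t v) (u v)).
Proof.
move=> dK Ht Hu.
by apply: (@defin_subst _ (fun k => if k is 0 then t else u) dK); case.
Qed.

Lemma defin_app3 K t u w : defin3 K -> term t -> term u -> term w ->
  defin (fun v => K (t v) (u v) (w v)).
Proof.
move=> dK Ht Hu Hw.
by apply: (@defin_subst _
  (fun k => match k with 0 => t | 1 => u | _ => w end) dK) => -[|[]].
Qed.

End Definability.

Lemma defin_weaken (M : structure) (D : M -> Prop) K :
  defin D K -> defin (fun=> True) K.
Proof. by move=> [n [f [e [_ H]]]]; exists n, f, e. Qed.

Create HintDb defin discriminated.
#[global] Hint Constants Opaque : defin.

Ltac term_tac := repeat (
  cbv beta; first
  [ apply: term_cst; solve [assumption | exact I | trivial]
  | apply: term_var
  | assumption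
  | refine (@term_shift _ _ _ _) ]).

#[global] Hint Extern 0 (term _ _) => solve [term_tac] : defin.

(* The choice of a lemma is by the head symbol only: unification alone would
   unfold the defined predicates. *)
Ltac definability_step := cbv beta; lazymatch goal with
  | |- term _ _ => solve [term_tac]
  | |- defin _ (fun v => ~ _) => apply: defin_not
  | |- defin _ (fun v => _ /\ _) => apply: defin_and
  | |- defin _ (fun v => _ \/ _) => apply: defin_or
  | |- defin _ (fun v => _ <-> _) => apply: defin_iff
  | |- defin _ (fun v => and3 _ _ _) => apply: defin_and3
  | |- defin _ (fun v => and4 _ _ _ _) => apply: defin_and4
  | |- defin _ (fun v => and5 _ _ _ _ _) => apply: defin_and5
  | |- defin _ (fun v => @ex _ (@unique _ _)) => apply: defin_unique
  | |- defin _ (fun v => @ex _ _) => apply: defin_ex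
  | |- defin _ (fun v => @elt _ _ _) => apply: defin_mem
  | |- defin _ (fun v => @eq _ _ _) => apply: defin_eq
  | |- defin _ (fun v => forall x, _) => first [apply: defin_imp | apply: defin_all]
  | |- _ => first
    [ assumption
    | match goal with
      | dK : defin _ (fun v => ?K (v 0)) |- _ => apply: (@defin_app1 _ _ K _ dK)
      | dK : defin _ (fun v => ?K (v 0) (v 1)) |- _ => apply: (@defin_app2 _ _ K _ _ dK)
      | dK : defin _ (fun v => ?K (v 0) (v 1) (v 2)) |- _ =>
          apply: (@defin_app3 _ _ K _ _ _ dK)
      end
    | progress auto 2 with defin nocore ]
  end.

Ltac definability := repeat definability_step.

(** * Set theory inside a model *)

Section BasicDefinability.
Variables (M : structure) (D : M -> Prop).
Implicit Types t u r x y z : (nat -> M) -> M.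

Lemma defin_opair z x y : term D z -> term D x -> term D y ->
  defin D (fun v => opair (z v) (x v) (y v)).
Proof. by move=> *; rewrite /opair; definability. Qed.
#[local] Hint Resolve defin_opair : defin.

Lemma defin_app r x y : term D r -> term D x -> term D y ->
  defin D (fun v => app (r v) (x v) (y v)).
Proof. by move=> *; rewrite /app; definability. Qed.
#[local] Hint Resolve defin_app : defin.

Lemma defin_function_on f x : term D f -> term D x ->
  defin D (fun v => function_on (f v) (x v)).
Proof. by move=> *; rewrite /function_on; definability. Qed.
#[local] Hint Resolve defin_function_on : defin.

Lemma defin_transitive_set x : term D x -> defin D (fun v => transitive_set (x v)).
Proof. by move=> *; rewrite /transitive_set; definability. Qed.
#[local] Hint Resolve defin_transitive_set : defin.

Lemma defin_name_closed x : term D x -> defin D (fun v => name_closed (x v)).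
Proof. by move=> *; rewrite /name_closed; definability. Qed.
#[local] Hint Resolve defin_name_closed : defin.

Lemma defin_is_name x y : term D x -> term D y ->
  defin D (fun v => is_name (x v) (y v)).
Proof. by move=> *; rewrite /is_name; definability. Qed.

Lemma defin_name_value x y z : term D x -> term D y -> term D z ->
  defin D (fun v => name_value (x v) (y v) (z v)).
Proof. by move=> *; rewrite /name_value; definability. Qed.

Lemma defin_in_table x y z t : term D x -> term D y -> term D z -> term D t ->
  defin D (fun v => in_table (x v) (y v) (z v) (t v)).
Proof. by move=> *; rewrite /in_table; definability. Qed.

End BasicDefinability.

#[global] Hint Resolve defin_opair defin_app defin_function_on
  defin_transitive_set defin_name_closed defin_is_name defin_name_value
  defin_in_table : defin.

(** The scheme is stated for formulas in finitely many variables; a definition by a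
    sequence depends on its argument only, so every other variable can be
    identified with it. *)
Lemma separation_from_scheme (M : structure) :
  (forall n (f : formula (option 'I_n)) (e : 'I_n -> M) (x : M),
    exists y, forall z, z ∈ y <-> z ∈ x /\ sat f (scons z e)) ->
  forall D (K : M -> Prop) x, defin D (fun v => K (v 0)) ->
    exists y, forall z, z ∈ y <-> z ∈ x /\ K z.
Proof.
move=> scheme D K x [n [f [e [_ H]]]].
pose rho (s : nat + 'I_n) := match s with inl _ => None | inr i => Some i end.
have [y Hy] := scheme n (frename rho f) e x.
exists y => z; rewrite Hy sat_frename (H (fun=> z)).
suff -> : (fun s => scons z e (rho s)) = with_params (fun=> z) e by [].
by apply: functional_extensionality; case.
Qed.

Section SetTheory.
Variables (M : structure) (hM : ZFC M).
Implicit Types x y z a b c u w f g : M.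

Lemma separation D (K : M -> Prop) x : defin D (fun v => K (v 0)) ->
  exists y, forall z, z ∈ y <-> z ∈ x /\ K z.
Proof. exact/separation_from_scheme/zfc_separation. Qed.

Lemma replacement D (K : M -> M -> Prop) x : defin D (fun v => K (v 0) (v 1)) ->
  (forall u v w, u ∈ x -> K u v -> K u w -> v = w) ->
  exists y, forall v, v ∈ y <-> exists u, u ∈ x /\ K u v.
Proof.
move=> [n [f [e [_ H]]]] funK.
pose rho (s : nat + 'I_n) :=
  match s with inl 0 => Some None | inl _ => None | inr i => Some (Some i) end.
have E u v : sat (frename rho f) (scons v (scons u e)) <-> K u v.
  rewrite sat_frename (H (fun k => if k is 0 then u else v)).
  set e1 := fun s => _; set e2 := with_params _ _; suff -> : e1 = e2 by [].
  by apply: functional_extensionality; case=> [[]|].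
have [|y Hy] := zfc_replacement hM (f := frename rho f) (e := e) (x := x).
  by move=> u v w ux /E Kv /E; apply: funK Kv.
by exists y => v; rewrite Hy; split=> -[u [ux /E Kuv]]; exists u.
Qed.

Lemma extensionality x y : (forall z, z ∈ x <-> z ∈ y) -> x = y.
Proof. exact: zfc_extensionality. Qed.

(** ** Pairs and unions *)

Definition upair x y : M :=
  proj1_sig (constructive_indefinite_description _ (zfc_pairing hM x y)).

Lemma in_upair x y w : w ∈ upair x y <-> w = x \/ w = y.
Proof. by rewrite /upair; case: constructive_indefinite_description. Qed.

Definition kpair x y : M := upair (upair x x) (upair x y).

Lemma opair_kpairE z x y : opair z x y <-> z = kpair x y.
Proof.
have E1 w : (forall u, u ∈ w <-> u = x) <-> w = upair x x.
  split=> [H|-> u]; last by rewrite in_upair; tauto.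
  by apply: extensionality => u; rewrite H in_upair; tauto.
have E2 w : (forall u, u ∈ w <-> u = x \/ u = y) <-> w = upair x y.
  split=> [H|-> u]; last by rewrite in_upair.
  by apply: extensionality => u; rewrite H in_upair.
split=> [H|-> w]; last by rewrite in_upair E1 E2.
by apply: extensionality => w; rewrite H in_upair E1 E2.
Qed.

Lemma opair_kpair x y : opair (kpair x y) x y.
Proof. exact/opair_kpairE. Qed.

Lemma upair_inj x y z : upair x y = upair x z -> y = z.
Proof.
move=> E; have: y ∈ upair x z by rewrite -E in_upair; right.
have: z ∈ upair x y by rewrite E in_upair; right.
by rewrite !in_upair => -[] -> [] //.
Qed.

Lemma kpair_inj x y x' y' : kpair x y = kpair x' y' -> x = x' /\ y = y'.
Proof.
move=> E.
have Ex : x = x'.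
  have: upair x' x' ∈ kpair x y by rewrite E in_upair; left.
  rewrite in_upair => -[] E'.
    have: x ∈ upair x' x' by rewrite E' in_upair; left.
    by rewrite in_upair => -[].
  have: x ∈ upair x' x' by rewrite E' in_upair; left.
  by rewrite in_upair => -[].
split=> //; rewrite -{}Ex in E.
exact/upair_inj/upair_inj/E.
Qed.

Lemma app_kpairE r x y : app r x y <-> kpair x y ∈ r.
Proof.
split=> [[z [/opair_kpairE -> //]]|H].
by exists (kpair x y); split=> //; apply: opair_kpair.
Qed.

Lemma opair_inj z x y x' y' : opair z x y -> opair z x' y' -> x = x' /\ y = y'.
Proof. by move=> /opair_kpairE -> /opair_kpairE /kpair_inj. Qed.

Definition bigunion x : M :=
  proj1_sig (constructive_indefinite_description _ (zfc_union hM x)).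

Lemma in_bigunion x z : z ∈ bigunion x <-> exists w, w ∈ x /\ z ∈ w.
Proof. by rewrite /bigunion; case: constructive_indefinite_description. Qed.

Definition union x y := bigunion (upair x y).

Lemma in_union x y z : z ∈ union x y <-> z ∈ x \/ z ∈ y.
Proof.
rewrite in_bigunion; split=> [[w [/in_upair[]->]]|[] ?]; try tauto.
  by exists x; rewrite in_upair; tauto.
by exists y; rewrite in_upair; tauto.
Qed.

Definition power x : M :=
  proj1_sig (constructive_indefinite_description _ (zfc_power hM x)).

Lemma in_power x z : z ∈ power x <-> forall w, w ∈ z -> w ∈ x.
Proof. by rewrite /power; case: constructive_indefinite_description. Qed.

Definition adjoin x y := union x (upair y y).

Lemma in_adjoin x y z : z ∈ adjoin x y <-> z ∈ x \/ z = y.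
Proof. by rewrite in_union in_upair; tauto. Qed.

Lemma ex_empty : exists x, forall y, ~ y ∈ x.
Proof. by have [w [[z [_ Hz]] _]] := zfc_infinity hM; exists z. Qed.

Lemma product a b : exists c, forall z, z ∈ c <->
  exists x y, [/\ x ∈ a, y ∈ b & z = kpair x y].
Proof.
have [|c Hc] := @separation (fun=> True)
  (fun z => exists x y, [/\ x ∈ a, y ∈ b & opair z x y]) (power (power (union a b))).
  by definability.
exists c => z; rewrite Hc; split=> [[_ [x [y [xa yb /opair_kpairE]]]]|[x [y [xa yb ->]]]].
  by exists x, y.
split; last by exists x, y; split=> //; apply: opair_kpair.
rewrite in_power => w; rewrite in_upair in_power => -[] -> u;
  by rewrite in_upair in_union => -[] ->; tauto.
Qed.

Lemma relation_separation D (K : M -> M -> Prop) a b :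
  defin D (fun v => K (v 0) (v 1)) ->
  exists r, (forall z, z ∈ r -> exists x y, [/\ x ∈ a, y ∈ b & opair z x y]) /\
    forall x y, app r x y <-> [/\ x ∈ a, y ∈ b & K x y].
Proof.
move=> dK; have [c Hc] := product a b.
have [|r Hr] := @separation D (fun z => exists x y, opair z x y /\ K x y) c.
  by definability.
exists r; split=> [z|x y].
  by rewrite Hr Hc => -[[x [y [xa yb ->]]] _]; exists x, y; split=> //; apply: opair_kpair.
rewrite app_kpairE Hr Hc; split.
  case=> [[x1 [y1 [xa yb /kpair_inj[-> ->]]]] [x2 [y2 [/opair_kpairE/kpair_inj[<- <-] Kxy]]]].
  by split.
by case=> xa yb Kxy; split; [exists x, y|exists x, y; split=> //; apply: opair_kpair].
Qed.

(** ** Transitive closures and induction *)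

Lemma no_cycle2 x y : x ∈ y -> y ∈ x -> False.
Proof.
move=> xy yx; have [|z [/in_upair[]-> H]] := zfc_foundation hM (x := upair x y).
- by exists x; rewrite in_upair; left.
- by apply: (H y) => //; rewrite in_upair; right.
- by apply: (H x) => //; rewrite in_upair; left.
Qed.

Let succ_of x y := forall u, u ∈ y <-> u ∈ x \/ u = x.

Lemma succ_of_inj x x' y : succ_of x y -> succ_of x' y -> x = x'.
Proof.
move=> H H'.
have /H' [xx'|//] : x ∈ y by apply/H; right.
have /H [x'x|//] : x' ∈ y by apply/H'; right.
by case: (no_cycle2 xx' x'x).
Qed.

Lemma ex_succ x : exists y, succ_of x y.
Proof. by exists (adjoin x x) => u; rewrite in_adjoin. Qed.

Let omega_spec (W : M) :=
  [/\ (exists z, z ∈ W /\ forall u, ~ u ∈ z),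
      (forall x y, x ∈ W -> succ_of x y -> y ∈ W)
    & forall D (K : M -> Prop), defin D (fun v => K (v 0)) ->
      (forall z, (forall u, ~ u ∈ z) -> K z) ->
      (forall x y, x ∈ W -> succ_of x y -> K x -> K y) ->
      forall x, x ∈ W -> K x].

(** Infinity only gives some inductive set; the elements common to all inductive
    sets form one on which induction holds by construction. *)
Lemma ex_omega : exists W, omega_spec W.
Proof.
have [w [[z0 [z0w Hz0]] Hs]] := zfc_infinity hM.
pose inductive i := (forall z, (forall u, ~ u ∈ z) -> z ∈ i) /\
  (forall x y, x ∈ i -> succ_of x y -> y ∈ i).
have iw : inductive w.
  split=> [z Hz|x y xw Hy].
    suff -> : z = z0 by [].
    by apply: extensionality => u; split=> H; [case: (Hz _ H)|case: (Hz0 _ H)].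
  have [y' [y'w H]] := Hs x xw; suff -> : y = y' by [].
  by apply: extensionality => u; rewrite Hy H.
have [|W HW] := @separation (fun=> True) (fun x => forall i, inductive i -> x ∈ i) w.
  by rewrite /inductive /succ_of; definability.
have iW : inductive W.
  split=> [z Hz|x y].
    by rewrite HW; split=> [|i [H _]]; [case: iw => H _|]; apply: H.
  rewrite !HW => -[xw H] sxy; split; first by case: iw => _; apply; eauto.
  by move=> i Hi; case: (Hi) => _; apply; [apply: H Hi|].
exists W; split; first by exists z0; split=> //; apply: iW.1.
  exact: iW.2.
move=> D K dK K0 KS x xW; have [I HI] := @separation D K W dK.
suff iI : inductive I by have /HI[] : x ∈ I by move: xW; rewrite HW => -[_]; apply.
split=> [z Hz|y y'].
  by rewrite HI; split; [apply: iW.1|apply: K0].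
by rewrite !HI => -[yW Ky] s; split; [apply: iW.2 s|apply: KS s Ky].
Qed.

(** The iterated unions of {x} are enumerated along omega: [stage g] says that
    [g] is a set of pairs (n, n-th iterate) closed under going back, so that
    recursion on omega reduces to an induction on [n]. *)
Lemma ex_transitive x : exists T, transitive_set T /\ x ∈ T.
Proof.
have [W [[z0 [z0W Hz0]] WS WI]] := ex_omega.
pose isU z z' := forall u, u ∈ z <-> exists w, w ∈ z' /\ u ∈ w.
pose stage g := forall n z, app g n z ->
  ((forall u, ~ u ∈ n) /\ (forall u, u ∈ z <-> u = x)) \/
  exists n' z', [/\ succ_of n' n, app g n' z' & isU z z'].
pose A n z := exists g, stage g /\ app g n z.
have dA : defin (fun=> True) (fun v => A (v 0) (v 1)).
  by rewrite /A /stage /succ_of /isU; definability.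
have exA n : n ∈ W -> exists z, A n z.
  apply: (WI (fun=> True) (fun n => exists z, A n z)) => [|z Hz|m n' _ s [z [g [Hg gmz]]]].
  - by definability.
  - exists (upair x x), (upair (kpair z (upair x x)) (kpair z (upair x x))).
    split; last by rewrite app_kpairE in_upair; left.
    move=> k z'; rewrite app_kpairE in_upair => -[] /kpair_inj [-> ->]; left;
      by split=> // u; rewrite in_upair; tauto.
  - exists (bigunion z), (adjoin g (kpair n' (bigunion z))).
    split; last by rewrite app_kpairE in_adjoin; right.
    move=> k y; rewrite app_kpairE in_adjoin => -[|/kpair_inj[-> ->]].
      rewrite -app_kpairE => /Hg [|[k' [z' [s' gk' Hz']]]]; first by left.
      right; exists k', z'; split=> //; move: gk'; rewrite !app_kpairE in_adjoin; tauto.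
    right; exists m, z; split=> //; first by move: gmz; rewrite !app_kpairE in_adjoin; tauto.
    by move=> u; rewrite in_bigunion.
have sE m n z : succ_of m n -> A n z -> exists z', A m z' /\ isU z z'.
  move=> s [g [Hg gnz]]; case: (Hg _ _ gnz) => [[Hn _]|].
    by case: (Hn m); apply/s; right.
  case=> m' [z' [s' gm Hz]]; exists z'; split=> //.
  by exists g; split=> //; rewrite (succ_of_inj s s').
have unA n : n ∈ W -> forall z z', A n z -> A n z' -> z = z'.
  apply: (WI (fun=> True) (fun n => forall z z', A n z -> A n z' -> z = z')).
  - by definability.
  - move=> n' Hn' z z' [g [Hg gz]] [g' [Hg' gz']].
    have E h y : stage h -> app h n' y -> forall u, u ∈ y <-> u = x.
      move=> Hh /Hh [[] //|[m [? [s _ _]]]]; case: (Hn' m); apply/s; by right.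
    by apply: extensionality => u; rewrite (E g) // (E g').
  - move=> m n' _ s IH z z' /(sE _ _ _ s) [y [Ay Hy]] /(sE _ _ _ s) [y' [Ay' Hy']].
    apply: extensionality => u; rewrite Hy Hy'.
    by rewrite (IH _ _ Ay Ay').
have [|Z HZ] := @replacement (fun=> True) A W dA.
  by move=> n z z' /unA; apply.
exists (bigunion Z); split.
  move=> y u; rewrite !in_bigunion => -[z [/HZ [n [nW Anz]] yz]] uy.
  have [n' s] := ex_succ n; have n'W := WS _ _ nW s.
  have [z' Az'] := exA _ n'W; exists z'; split; first by apply/HZ; exists n'.
  have [z2 [Az2 ->]] := sE _ _ _ s Az'; exists y; split=> //.
  by rewrite (unA _ nW _ _ Az2 Anz).
have [z Az] := exA _ z0W; rewrite in_bigunion; exists z; split.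
  by apply/HZ; exists z0.
case: Az => g [Hg /Hg [[_ ->]//|[m [? [s _ _]]]]].
by case: (Hz0 m); apply/s; right.
Qed.

(** Membership of [u] in the transitive closure of [x], which itself is never
    formed as a set. *)
Definition hereditary_in u x :=
  forall T, transitive_set T -> (forall y, y ∈ x -> y ∈ T) -> u ∈ T.

Lemma in_hereditary u x : u ∈ x -> hereditary_in u x.
Proof. by move=> ux T _; apply. Qed.

Lemma hereditary_trans u y x :
  hereditary_in u y -> hereditary_in y x -> hereditary_in u x.
Proof. by move=> uy yx T tT xT; apply: uy => // z; exact: tT (yx T tT xT). Qed.

Lemma hereditary_transitive T x u :
  transitive_set T -> x ∈ T -> hereditary_in u x -> u ∈ T.
Proof. by move=> tT xT; apply=> // y; exact: tT. Qed.

Lemma app_hereditary s u p : app s u p -> hereditary_in u s /\ hereditary_in p s.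
Proof.
rewrite app_kpairE => H.
have H1 : hereditary_in (upair u p) s.
  by apply: hereditary_trans (in_hereditary H); apply: in_hereditary; rewrite in_upair; right.
by split; apply: hereditary_trans H1; apply: in_hereditary; rewrite in_upair; tauto.
Qed.

End SetTheory.

Section HereditaryDefinability.
Variables (M : structure) (D : M -> Prop).
Lemma defin_hereditary_in (x y : (nat -> M) -> M) : term D x -> term D y ->
  defin D (fun v => hereditary_in (x v) (y v)).
Proof. by move=> *; rewrite /hereditary_in; definability. Qed.
End HereditaryDefinability.
#[global] Hint Resolve defin_hereditary_in : defin.

Section Recursion.
Variables (M : structure) (hM : ZFC M).
Implicit Types x y z a b c u w f g T : M.

(** Foundation speaks of sets only; a class is brought under it by intersecting with
    a transitive set. Strengthening the property to all hereditary elements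
    makes a membership-minimal counterexample enough. *)
Lemma hereditary_induction D (K : M -> Prop) : defin D (fun v => K (v 0)) ->
  (forall x, (forall u, hereditary_in u x -> K u) -> K x) -> forall x, K x.
Proof.
move=> dK IH x0.
have [T [tT x0T]] := ex_transitive hM x0.
pose K' x := K x /\ forall u, hereditary_in u x -> K u.
have dK' : defin D (fun v => K' (v 0)) by rewrite /K'; definability.
have [|B HB] := @separation _ hM D (fun x => ~ K' x) T; first exact: defin_not.
have [T1 HT1] := @separation _ hM D K' T dK'.
apply: NNPP => nK.
have [|x [xB minx]] := zfc_foundation hM (x := B).
  by exists x0; apply/HB; split=> // -[].
have [xT nK'x] := (HB x).1 xB.
have xT1 y : y ∈ x -> y ∈ T1.
  move=> yx; have yT := tT _ _ xT yx; apply/HT1; split=> //.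
  by apply: NNPP => nK'y; apply: (minx _ yx); apply/HB.
have tT1 : transitive_set T1.
  move=> y z /HT1 [yT [Ky Hy]] zy; apply/HT1; split; first exact: tT zy.
  split; first exact/Hy/in_hereditary.
  by move=> u uz; apply/Hy/(hereditary_trans uz)/in_hereditary.
have Kx u : hereditary_in u x -> K u by move=> /(_ _ tT1 xT1) /HT1 [_ []].
by apply: nK'x; split=> //; apply: IH.
Qed.

Lemma class_minimal D (K : M -> Prop) : defin D (fun v => K (v 0)) ->
  (exists x, K x) -> exists x, K x /\ forall u, hereditary_in u x -> ~ K u.
Proof.
move=> dK [x Kx]; apply: NNPP => H; suff: ~ K x by [].
move: {Kx} x; apply: (@hereditary_induction D (fun x => ~ K x)).
  by definability.
by move=> x IH Kx; apply: H; exists x.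
Qed.

Lemma hereditary_irrefl x : ~ hereditary_in x x.
Proof.
apply: (@hereditary_induction (fun=> True) (fun x => ~ hereditary_in x x)) x => [|x IH H].
  by definability.
exact: (IH x H H).
Qed.

(** Recursion along the hereditary membership relation: [Step f x y] determines
    the value [y] at [x] from the values of the function [f] at the sets in the
    transitive closure of [x]. *)
Section RecursionTheorem.
Variables (D : M -> Prop) (Step : M -> M -> M -> Prop).
Hypothesis dStep : defin D (fun v => Step (v 0) (v 1) (v 2)).
Hypothesis exStep : forall f x,
  (forall u, hereditary_in u x -> exists! y, app f u y) -> exists! y, Step f x y.
Hypothesis localStep : forall f g x y,
  (forall u z, hereditary_in u x -> (app f u z <-> app g u z)) ->
  Step f x y -> Step g x y.

Definition attempt f T := [/\ transitive_set T, function_on f T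
  & forall x y, x ∈ T -> app f x y -> Step f x y].

Definition rec_value x y := exists f T, [/\ attempt f T, x ∈ T & app f x y].

Lemma defin_rec_value : defin D (fun v => rec_value (v 0) (v 1)).
Proof. by rewrite /rec_value /attempt; definability. Qed.

Lemma rec_value_unique x y z : rec_value x y -> rec_value x z -> y = z.
Proof.
have dR := defin_rec_value; move: x y z.
apply: (@hereditary_induction D
  (fun x => forall y z, rec_value x y -> rec_value x z -> y = z)).
  by definability.
move=> x IH y z [f [T [[tT fT Sf] xT fxy]]] [g [T' [[tT' gT' Sg] xT' gxz]]].
have [|y0 [_ Hy0]] := @exStep g x.
  by move=> u ux; apply/gT'/(hereditary_transitive tT' xT' ux).
rewrite -(Hy0 z); last exact: Sg.
rewrite (Hy0 y) //; apply: (@localStep f); last exact: Sf.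
move=> u w ux; have uT := hereditary_transitive tT xT ux.
have uT' := hereditary_transitive tT' xT' ux.
split=> H.
  have [w' [gw' _]] := gT' _ uT'.
  by rewrite (IH u ux w w') //; [exists f, T | exists g, T'].
have [w' [fw' _]] := fT _ uT.
by rewrite (IH u ux w w') //; [exists g, T' | exists f, T].
Qed.

(** Attempts agree where both are defined, so their values form a functional class,
    and replacement collects them into one attempt. *)
Lemma attempt_on T : transitive_set T ->
  (forall u, u ∈ T -> exists y, rec_value u y) ->
  exists f, attempt f T /\ forall x y, app f x y <-> x ∈ T /\ rec_value x y.
Proof.
move=> tT exT; have dR := defin_rec_value.
have [||f Hf] := @replacement _ hM D
  (fun x z => exists y, rec_value x y /\ opair z x y) T.
- by definability.
- move=> x z z' _ [y [vy /(opair_kpairE hM) ->]] [y' [vy' /(opair_kpairE hM) ->]].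
  by rewrite (rec_value_unique vy vy').
have fE x y : app f x y <-> x ∈ T /\ rec_value x y.
  rewrite (app_kpairE hM) Hf; split=> [[x' [x'T [y' [v /(opair_kpairE hM) /kpair_inj [-> ->]]]]]|[xT v]] //.
  by exists x; split=> //; exists y; split=> //; apply: opair_kpair.
exists f; split=> //; split=> // [x xT|x y xT].
  have [y v] := exT _ xT; exists y; split; first by apply/fE.
  by move=> y' /fE [_]; apply: rec_value_unique.
move=> /fE [_ [g [T' [[tT' gT' Sg] xT' gxy]]]].
apply: (@localStep g); last exact: Sg.
move=> u z ux; have uT := hereditary_transitive tT xT ux.
have uT' := hereditary_transitive tT' xT' ux; rewrite fE.
split=> [guz|[_ v]]; first by split=> //; exists g, T'.
have [z' [guz' _]] := gT' _ uT'.
by rewrite (rec_value_unique v (z := z')) //; exists g, T'.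
Qed.

Lemma rec_value_total x : exists y, rec_value x y.
Proof.
have dR := defin_rec_value; move: x.
apply: (@hereditary_induction D (fun x => exists y, rec_value x y)).
  by definability.
move=> x IH; have [T [tT xT]] := ex_transitive hM x.
have [|T0 HT0] := @separation _ hM (fun=> True) (fun u => hereditary_in u x) T.
  by definability.
have xT0 u : hereditary_in u x -> u ∈ T0.
  by move=> ux; apply/HT0; split=> //; apply: hereditary_transitive ux.
have tT0 : transitive_set T0.
  move=> y z /HT0 [_ yx] zy; apply: xT0.
  exact: hereditary_trans (in_hereditary zy) yx.
have [|f [[_ fT0 Sf] fE]] := attempt_on tT0; first by move=> u /HT0 [_ /IH].
have [|y [Sy _]] := @exStep f x; first by move=> u /xT0 /fT0.
pose f' := adjoin hM f (kpair hM x y); pose T' := adjoin hM T0 x.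
have nx u : u ∈ T0 -> u <> x.
  by move=> /HT0 [_ ux] E; rewrite E in ux; case: (hereditary_irrefl ux).
have f'E u z : app f' u z <-> app f u z \/ u = x /\ z = y.
  rewrite !(app_kpairE hM) in_adjoin; split=> -[]; try tauto.
    by move=> /kpair_inj []; tauto.
  by case=> -> ->; right.
have loc u z : u ∈ T0 -> (app f u z <-> app f' u z).
  by move=> uT0; rewrite f'E; have := nx u uT0; tauto.
exists y, f', T'; split; last by rewrite f'E; right.
  split.
  - move=> u z; rewrite !in_adjoin => -[uT0 zu|->].
      by left; apply: tT0 zu.
    by move=> /in_hereditary /xT0; left.
  - move=> u; rewrite in_adjoin => -[uT0|->].
      have [z [fz Hz]] := fT0 _ uT0; exists z; split; first exact/loc.
      by move=> z' /(loc _ _ uT0); apply: Hz.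
    exists y; split; first by rewrite f'E; right.
    by move=> z; rewrite f'E => -[/fE [/nx]|[]].
  - move=> u z; rewrite in_adjoin => -[uT0|->].
      move=> /(loc _ _ uT0) /(Sf _ _ uT0); apply: localStep => w s wu.
      apply: loc; exact: hereditary_transitive wu.
    rewrite f'E => -[/fE [/nx]//|[_ ->]].
    by apply: localStep Sy => w s /xT0 /loc.
by rewrite in_adjoin; right.
Qed.

Lemma recursion T : transitive_set T ->
  exists f, attempt f T /\ forall x y, app f x y <-> x ∈ T /\ rec_value x y.
Proof. by move=> tT; apply: attempt_on => // u _; apply: rec_value_total. Qed.

Lemma rec_value_step x y : rec_value x y ->
  exists f, Step f x y /\
    forall u z, hereditary_in u x -> (app f u z <-> rec_value u z).
Proof.
move=> v; have [T [tT xT]] := ex_transitive hM x.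
have [f [[_ _ Sf] fE]] := recursion tT; exists f; split; first by apply/Sf/fE.
move=> u z ux; rewrite fE; split=> [[]//|]; split=> //.
exact: hereditary_transitive ux.
Qed.

End RecursionTheorem.

(** ** Ranks and collection *)

(** The recursion clause of the level V_a of the cumulative hierarchy, where a is
    the rank of [x]; levels take the place of ordinals. *)
Let level_step f x y :=
  forall z, z ∈ y <-> exists v w, [/\ v ∈ x, app f v w & forall u, u ∈ z -> u ∈ w].

Lemma level_step_def D : defin D (fun v => level_step (v 0) (v 1) (v 2)).
Proof. by rewrite /level_step; definability. Qed.

Lemma ex_level_step f x : (forall u, hereditary_in u x -> exists! y, app f u y) ->
  exists! y, level_step f x y.
Proof.
move=> fx.
have [||Y HY] := @replacement _ hM (fun=> True)
    (fun v p => exists w, app f v w /\ forall z, z ∈ p <-> forall u, u ∈ z -> u ∈ w) x.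
- by definability.
- move=> v p p' /in_hereditary /fx [w0 [_ Hw0]] [w [/Hw0 <- Hp]] [w' [/Hw0 <- Hp']].
  by apply: (extensionality hM) => z; rewrite Hp Hp'.
have E : level_step f x (bigunion hM Y).
  move=> z; rewrite in_bigunion.
  split=> [[p [/HY [v [vx [w [fvw Hp]]]] /Hp zp]]|[v [w [vx fvw zw]]]].
    by exists v, w.
  exists (power hM w); split; last by apply/in_power.
  by apply/HY; exists v; split=> //; exists w; split=> // s; rewrite in_power.
exists (bigunion hM Y); split=> // y Hy.
by apply: (extensionality hM) => z; rewrite E Hy.
Qed.

Lemma level_step_local f g x y :
  (forall u z, hereditary_in u x -> (app f u z <-> app g u z)) ->
  level_step f x y -> level_step g x y.
Proof.
move=> fg H z; rewrite H; split=> -[v [w [vx fvw zw]]]; exists v, w; split=> //;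
  by apply/(fg _ _ (in_hereditary vx)).
Qed.

Let level_of := rec_value level_step.

Lemma level_ofE x y : level_of x y ->
  forall z, z ∈ y <-> exists v w, [/\ v ∈ x, level_of v w & forall u, u ∈ z -> u ∈ w].
Proof.
move=> /(rec_value_step (@level_step_def (fun=> True)) ex_level_step level_step_local).
move=> [f [Hy fE]] z; rewrite Hy; split=> -[v [w [vx fvw zw]]]; exists v, w;
  by split=> //; apply/(fE _ _ (in_hereditary vx)).
Qed.

Lemma level_of_total x : exists y, level_of x y.
Proof. exact: (rec_value_total (@level_step_def (fun=> True)) ex_level_step level_step_local). Qed.

Lemma defin_level_of D : defin D (fun v => level_of (v 0) (v 1)).
Proof. exact/defin_rec_value/level_step_def. Qed.

Lemma sub_level x y u : level_of x y -> u ∈ x -> u ∈ y.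
Proof.
have dl := @defin_level_of (fun=> True); move: x y u.
apply: (@hereditary_induction (fun=> True)
  (fun x => forall y u, level_of x y -> u ∈ x -> u ∈ y)).
  by definability.
move=> x IH y u lx ux; apply/(level_ofE lx); have [w lu] := level_of_total u.
exists u, w; split=> // s; apply: IH lu; exact: in_hereditary.
Qed.

(** Levels are closed under subsets: if some subset of a lower level is missing from
    [y'], then all levels that make up [y'] lie below that lower level. *)
Lemma level_compare x x' y y' : level_of x y -> level_of x' y' ->
  (forall u, u ∈ y -> u ∈ y') \/ y' ∈ y.
Proof.
have dl := @defin_level_of (fun=> True); move: x y x' y'.
apply: (@hereditary_induction (fun=> True) (fun x => forall y x' y',
  level_of x y -> level_of x' y' -> (forall u, u ∈ y -> u ∈ y') \/ y' ∈ y)).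
  by definability.
move=> x IH y x' y' lx lx'.
case: (classic (forall u, u ∈ y -> u ∈ y')) => [|nsub]; first by left.
right; apply: NNPP => ny'; apply: nsub => u /(level_ofE lx) [z [lz [zx Hz sub_u]]].
apply/(level_ofE lx').
case: (classic (exists z' l, [/\ z' ∈ x', level_of z' l & forall s, s ∈ lz -> s ∈ l])).
  by move=> [z' [l [z'x' Hl sl]]]; exists z', l; split=> // s /sub_u /sl.
move=> nex; case: ny'; apply/(level_ofE lx); exists z, lz; split=> // s.
move=> /(level_ofE lx') [z' [l [z'x' Hl sl]]].
case: (IH z (in_hereditary zx) lz z' l Hz Hl) => [H|].
  by case: nex; exists z', l.
move=> /(level_ofE Hz) [t [lt [tz Ht lsub]]]; apply/(level_ofE Hz).
by exists t, lt; split=> // r /sl /lsub.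
Qed.

(** Scott's trick: the witnesses of least rank form a set. *)
Lemma collection D (K : M -> M -> Prop) a : defin D (fun v => K (v 0) (v 1)) ->
  exists b, forall x y, x ∈ a -> K x y -> exists y', y' ∈ b /\ K x y'.
Proof.
move=> dK0; have {dK0} dK := defin_weaken dK0; have dl := @defin_level_of (fun=> True).
pose L x l := (exists y, K x y /\ level_of y l) /\
  forall y l', K x y -> level_of y l' -> ~ l' ∈ l.
have dL : defin (fun=> True) (fun v => L (v 0) (v 1)) by rewrite /L; definability.
have [|B HB] := @replacement _ hM (fun=> True) L a dL.
  move=> x l l' _ [[y [Ky ly]] minl] [[y' [Ky' ly']] minl'].
  apply: (extensionality hM) => z; split.
    by case: (level_compare ly ly') => [H /H //|H]; case: (minl _ _ Ky' ly').
  by case: (level_compare ly' ly) => [H /H //|H]; case: (minl' _ _ Ky ly).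
exists (power hM (bigunion hM B)) => x y xa Kxy.
have [l0 ly] := level_of_total y.
have [||l [[y' [Ky' ly']] minl]] := @class_minimal (fun=> True)
  (fun l => exists y, K x y /\ level_of y l).
- by definability.
- by exists l0, y.
exists y'; split=> //; rewrite in_power => u uy'; rewrite in_bigunion.
exists l; split; last exact: sub_level uy'.
apply/HB; exists x; split=> //; split; first by exists y'.
by move=> z l' Kz lz /in_hereditary /minl; apply; exists z.
Qed.

End Recursion.

Section WellOrder.
Variables (M : structure) (hM : ZFC M).
Implicit Types x y z a b c u w f g S T A B F U : M.

(** The axiom of choice is about disjoint families; tagging every element with the
    set that it is taken from makes an arbitrary family disjoint. *)
Lemma choice_function S : exists c, forall A, (forall u, u ∈ A -> u ∈ S) ->
  (exists u, u ∈ A) -> exists! v, v ∈ A /\ app c A v.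
Proof.
pose graph A F := forall z, z ∈ F <-> exists v, v ∈ A /\ opair z A v.
have ex_graph A : exists F, graph A F.
  have [|F [HF1 HF2]] := @relation_separation _ hM (fun=> True) (fun x _ => x = A)
    (upair hM A A) A; first by definability.
  exists F => z; split=> [zF|[v [vA zAv]]].
    have [x [y [+ yA xy]]] := HF1 _ zF; rewrite in_upair => -[] E;
    by exists y; split=> //; rewrite -E.
  have /(app_kpairE hM) := (HF2 A v).2 (And3 (proj2 (in_upair hM A A A) (or_introl erefl)) vA erefl).
  by rewrite ((opair_kpairE hM z A v).1 zAv).
have graph_fun A F F' : graph A F -> graph A F' -> F = F'.
  by move=> H H'; apply: (extensionality hM) => z; rewrite H H'.
have [P HP] : exists P, forall A, A ∈ P <->
    (forall u, u ∈ A -> u ∈ S) /\ exists u, u ∈ A.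
  have [|P HP] := @separation _ hM (fun=> True) (fun A => exists u, u ∈ A) (power hM S).
    by definability.
  by exists P => A; rewrite HP in_power.
have [||X HX] := @replacement _ hM (fun=> True) graph P.
- by rewrite /graph; definability.
- by move=> A F F' _; apply: graph_fun.
have [||c Hc] := zfc_choice hM (x := X).
- move=> F /HX [A [/HP [_ [u uA]] HF]]; exists (kpair hM A u).
  by apply/HF; exists u; split=> //; apply: opair_kpair.
- move=> F F' z /HX [A [_ HF]] /HX [A' [_ HF']] /HF [v [_ zAv]] /HF' [v' [_ zAv']].
  have [E _] := opair_inj hM zAv zAv'; rewrite -E in HF'.
  exact: graph_fun HF'.
exists c => A AS neA; have [F HF] := ex_graph A.
have FX : F ∈ X by apply/HX; exists A; split=> //; apply/HP.
have [z [[/HF [v [vA zAv]] zc] uz]] := Hc _ FX.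
exists v; split; first by split=> //; exists z.
move=> v' [v'A [z' [zAv' z'c]]].
have Ez : z = z' by apply: uz; split=> //; apply/HF; exists v'.
by rewrite -Ez in zAv'; case: (opair_inj hM zAv zAv').
Qed.

(** [u] precedes [v] in the order whose initial segments form [T]. *)
Definition precedes T u v := exists A, [/\ A ∈ T, u ∈ A & ~ v ∈ A].

(** Zermelo's argument: iterating a choice of an element outside the set
    obtained so far yields a chain of subsets of [S], the initial segments of a
    well-order of [S]. *)
Lemma well_order S : exists T, forall B, (forall u, u ∈ B -> u ∈ S) ->
  (exists u, u ∈ B) -> exists v, v ∈ B /\
  forall u, u ∈ B -> ~ precedes T u v /\ (u = v \/ precedes T v u).
Proof.
have [c Hc] := choice_function S.
pose next A v := exists R, [/\ forall u, u ∈ R <-> u ∈ S /\ ~ u ∈ A, v ∈ R & app c R v].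
have nextP A v : next A v -> v ∈ S /\ ~ v ∈ A by move=> [R [HR /HR]].
have next_unique A v v' : next A v -> next A v' -> v = v'.
  move=> [R [HR vR cv]] [R' [HR' vR' cv']].
  have E : R = R' by apply: (extensionality hM) => u; rewrite HR HR'.
  rewrite -E in vR' cv'.
  have [|| w [_ Hw]] := Hc R; first by move=> u /HR [].
    by exists v.
  by rewrite -(Hw v) // (Hw v').
have ex_next A u : u ∈ S -> ~ u ∈ A -> exists v, next A v.
  move=> uS uA.
  have [|R HR] := @separation _ hM (fun=> True) (fun u => ~ u ∈ A) S.
    by definability.
  have [||v [[vR cv] _]] := Hc R; first by move=> w /HR [].
    by exists u; apply/HR.
  by exists v, R.
pose clo i :=
  (forall A v A', A ∈ i -> next A v -> (forall u, u ∈ A' <-> u ∈ A \/ u = v) -> A' ∈ i) /\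
  (forall F U, (forall A, A ∈ F -> A ∈ i) ->
     (forall u, u ∈ U <-> exists A, A ∈ F /\ u ∈ A) -> U ∈ i).
have dnext : defin (fun=> True) (fun v => next (v 0) (v 1)).
  by rewrite /next; definability.
have [|T HT] := @separation _ hM (fun=> True) (fun A => forall i, clo i -> A ∈ i) (power hM S).
  by rewrite /clo; definability.
have TS A u : A ∈ T -> u ∈ A -> u ∈ S by move=> /HT [/in_power H _]; apply: H.
have cloT : clo T.
  split=> [A v A' /HT [/in_power AS HA] nv EA'|F U FT EU].
    apply/HT; split=> [|i ci]; last by apply: ci.1 nv EA'; apply: HA.
    by apply/in_power => u /EA' [/AS//|->]; case: (nextP _ _ nv).
  apply/HT; split=> [|i ci].
    by apply/in_power => u /EU [A [/FT /TS]]; apply.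
  by apply: ci.2 EU => A /FT /HT [_]; apply.
have T_ind (K : M -> Prop) : defin (fun=> True) (fun v => K (v 0)) ->
    (forall A v A', A ∈ T -> next A v -> (forall u, u ∈ A' <-> u ∈ A \/ u = v) ->
       K A -> K A') ->
    (forall F U, (forall A, A ∈ F -> A ∈ T /\ K A) ->
       (forall u, u ∈ U <-> exists A, A ∈ F /\ u ∈ A) -> K U) ->
    forall A, A ∈ T -> K A.
  move=> dK KS KU A; have [i Hi] := @separation _ hM (fun=> True) K T dK.
  suff ci : clo i by move=> /HT [_ /(_ _ ci)] /Hi [].
  split=> [B v B' /Hi [BT KB] nv EB'|F U Fi EU]; apply/Hi; split.
  - exact: cloT.1 nv EB'.
  - exact: KS nv EB' KB.
  - by apply: cloT.2 EU => B /Fi /Hi [].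
  - by apply: KU EU => B /Fi /Hi.
pose incl A B := forall u, u ∈ A -> u ∈ B.
pose good A := forall B, B ∈ T -> incl B A -> ~ incl A B ->
  forall v, next B v -> v ∈ A.
pose after A B := incl A B /\ forall v, next A v -> v ∈ B.
have good_split A : good A -> forall B, B ∈ T -> incl B A \/ after A B.
  move=> gA; apply: T_ind.
  - by rewrite /after /incl; definability.
  - move=> B w B' BT nw EB' [BA|[AB Hv]]; last first.
      by right; split=> u H; apply/EB'; left; [apply: AB|apply: Hv].
    case: (classic (incl A B)) => AB; last first.
      by left=> u /EB' [/BA//|->]; apply: gA nw.
    have E : A = B by apply: (extensionality hM) => u; split; [apply: AB|apply: BA].
    right; split=> u H; apply/EB'; first by left; rewrite -E.
    by right; rewrite E in H; apply: next_unique nw.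
  - move=> F U HF EU; case: (classic (exists B, B ∈ F /\ after A B)).
      move=> [B [BF [AB Hv]]]; right; split=> u H; apply/EU; exists B; split=> //.
        exact: AB.
      exact: Hv.
    move=> nB; left=> u /EU [B [BF uB]].
    have [_ [H|H]] := HF _ BF; first exact: H.
    by case: nB; exists B.
have all_good : forall A, A ∈ T -> good A.
  apply: T_ind.
  - by rewrite /good /incl; definability.
  - move=> A v A' AT nv EA' gA B BT BA' A'B w nw.
    case: (good_split A gA B BT) => [BA|[AB /(_ _ nv) vB]]; last first.
      by case: A'B => u /EA' [/AB//|->].
    apply/EA'; case: (classic (incl A B)) => AB; last first.
      by left; apply: gA nw.
    have E : A = B by apply: (extensionality hM) => u; split; [apply: AB|apply: BA].
    by right; rewrite -E in nw; apply: next_unique nv.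
  - move=> F U HF EU B BT BU UB w nw.
    have [A [AF nAB]] : exists A, A ∈ F /\ ~ incl A B.
      apply: NNPP => H; apply: UB => u /EU [A [AF uA]].
      by apply: NNPP => uB; apply: H; exists A; split=> // /(_ _ uA).
    have [AT gA] := HF _ AF.
    case: (good_split A gA B BT) => [BA|[AB _]] //.
    by apply/EU; exists A; split=> //; apply: gA nw.
exists T => B BS [b bB].
have [|F HF] := @separation _ hM (fun=> True) (fun A => forall u, u ∈ A -> ~ u ∈ B) T.
  by definability.
pose A0 := bigunion hM F.
have A0T : A0 ∈ T by apply: cloT.2 (in_bigunion hM F) => A /HF [].
have A0B u : u ∈ A0 -> ~ u ∈ B by move=> /in_bigunion [A [/HF [_]]]; apply.
have [|v nv] := ex_next A0 b (BS _ bB); first by move=> /A0B.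
pose A1 := adjoin hM A0 v.
have EA1 u : u ∈ A1 <-> u ∈ A0 \/ u = v by rewrite in_adjoin.
have A1T : A1 ∈ T by apply: cloT.1 nv EA1.
have vB : v ∈ B.
  apply: NNPP => vB; have [_ []] := nextP _ _ nv; apply/in_bigunion.
  exists A1; split; last by apply/EA1; right.
  by apply/HF; split=> // u /EA1 [/A0B//|->].
exists v; split=> // u uB; split.
  move=> [A [AT uA vA]].
  case: (good_split A0 (all_good _ A0T) A AT) => [/(_ _ uA) /A0B //|[_ /(_ _ nv)]] //.
case: (classic (u = v)) => [|uv]; first by left.
right; exists A1; split=> //; first by apply/EA1; right.
by move=> /EA1 [/A0B|].
Qed.

End WellOrder.

(** * The forcing relation *)

Section ForcingDefinability.
Variables (M : structure) (D : M -> Prop).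

Lemma defin_forces_eq (C L p s t : (nat -> M) -> M) : term D C -> term D L ->
  term D p -> term D s -> term D t ->
  defin D (fun v => forces_eq (C v) (L v) (p v) (s v) (t v)).
Proof.
move=> *; rewrite /forces_eq /forces_eq_step /forces_sub_step /dense_below.
by definability.
Qed.
#[local] Hint Resolve defin_forces_eq : defin.

Lemma defin_forces_mem (C L p s t : (nat -> M) -> M) : term D C -> term D L ->
  term D p -> term D s -> term D t ->
  defin D (fun v => forces_mem (C v) (L v) (p v) (s v) (t v)).
Proof. by move=> *; rewrite /forces_mem /dense_below; definability. Qed.
#[local] Hint Resolve defin_forces_mem : defin.

Lemma defin_forces (C L : M) X (f : formula X) (t : X -> (nat -> M) -> M) p :
  D C -> D L -> (forall x, term D (t x)) -> term D p ->
  defin D (fun v => forces C L f (fun x => t x v) (p v)).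
Proof.
move=> DC DL; elim: f t p => {X} [X x y|X x y|X g IH|X g IHg h IHh|X g IH] t p Ht Hp /=.
- by have Hx := Ht x; have Hy := Ht y; definability.
- by have Hx := Ht x; have Hy := Ht y; definability.
- apply: (@defin_all _ _ (fun v q => app L q (p v) -> ~ forces C L g (fun x => t x v) q)).
  apply: defin_imp; first by definability.
  apply: defin_not; apply: (IH (fun x v => t x (fun k => v k.+1)) (fun v => v 0)).
    by move=> x; apply: term_shift.
  exact: term_var.
- by apply: defin_and; [apply: IHg | apply: IHh].
- apply: (@defin_all _ _ (fun v s => is_name C s ->
    forces C L g (scons s (fun x => t x v)) (p v))).
  apply: defin_imp; first by definability.
  pose t' (o : option X) (v : nat -> M) : M :=
    if o is Some x then t x (fun k => v k.+1) else v 0.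
  apply: (@defin_ext _ _ _ (fun v => forces C L g (fun o => t' o v) (p (fun k => v k.+1)))).
    move=> v; suff -> : (fun o => t' o v) = scons (v 0) (fun x => t x (fun k => v k.+1)) by [].
    by apply: functional_extensionality; case.
  apply: (IH t' (fun v => p (fun k => v k.+1))); last exact: term_shift.
  by case=> [x|]; [apply: term_shift|apply: term_var].
Qed.

End ForcingDefinability.
#[global] Hint Resolve defin_forces_eq defin_forces_mem : defin.

Section Forcing.
Variables (M : structure) (hM : ZFC M) (X C L one : M) (hP : poset X C L one).
Implicit Types p q r s t u a b T F : M.

Local Notation "p ⊑ q" := (app L p q) (at level 70, no associativity).
Local Notation feq := (forces_eq C L).
Local Notation fmem := (forces_mem C L).

Lemma le_field p q : p ⊑ q -> p ∈ C /\ q ∈ C.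
Proof.
move=> [z [zpq /(poset_graph hP) [p' [q' [p'C q'C zpq']]]]].
by have [-> ->] := opair_inj hM zpq zpq'.
Qed.

Lemma le_refl p : p ∈ C -> p ⊑ p.
Proof. exact: poset_refl hP p. Qed.

Lemma le_trans q p r : p ⊑ q -> q ⊑ r -> p ⊑ r.
Proof. exact: poset_trans hP _ _ _. Qed.

Lemma forces_eq_step_ext R R' p s t :
  (forall u a v b r, app s u a -> app t v b -> r ∈ C -> R r u v -> R' r u v) ->
  forces_eq_step L R p s t -> forces_eq_step L R' p s t.
Proof.
move=> RR' [H1 H2]; split=> u a q ua qp qa q' q'q.
  have [r [rq [v [b [vb rb Ruv]]]]] := H1 u a q ua qp qa q' q'q.
  exists r; split=> //; exists v, b; split=> //; apply: RR' ua vb _ Ruv.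
  by case: (le_field rq).
have [r [rq [v [b [vb rb Ruv]]]]] := H2 u a q ua qp qa q' q'q.
exists r; split=> //; exists v, b; split=> //; apply: RR' vb ua _ Ruv.
by case: (le_field rq).
Qed.

Definition is_table T F := forall q u v, q ∈ C -> u ∈ T -> v ∈ T ->
  (in_table F q u v <-> forces_eq_step L (in_table F) q u v).

(** The step determines a table on names from its values on their domains, so tables
    agree by induction, whatever the sets of names that they cover. *)
Lemma table_unique s : forall T F T' F' q t,
  name_closed T -> is_table T F -> name_closed T' -> is_table T' F' -> q ∈ C ->
  s ∈ T -> s ∈ T' -> t ∈ T -> t ∈ T' -> in_table F q s t -> in_table F' q s t.
Proof.
move: s; apply: (@hereditary_induction _ hM (fun=> True)).
  rewrite /is_table /forces_eq_step /forces_sub_step /dense_below.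
  by definability.
move=> s IH T F T' F' q t cT HT cT' HT' qC sT sT' tT tT' /(HT _ _ _ qC sT tT) H.
apply/(HT' _ _ _ qC sT' tT'); apply: forces_eq_step_ext H => u a v b r ua vb rC.
apply: (IH u _ T F T') => //; first by case: (app_hereditary hM ua).
- exact: (cT _ _ _ sT ua).
- exact: (cT' _ _ _ sT' ua).
- exact: (cT _ _ _ tT vb).
- exact: (cT' _ _ _ tT' vb).
Qed.

Lemma transitive_name_closed T : transitive_set T -> name_closed T.
Proof.
move=> tT s u p sT /(app_hereditary hM) [H _]; exact: hereditary_transitive H.
Qed.

(** The recursion can be made on the first name alone, the second ranging over a
    fixed set: the value at [s] is the set of the pairs (p, t) with p ⊩ s = t. *)
Lemma ex_table T : transitive_set T -> exists F, is_table T F.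
Proof.
move=> tT.
pose val f r u v := exists w, app f u w /\ app w r v.
pose Step f s y := forall z, z ∈ y <-> exists p t,
  [/\ p ∈ C, t ∈ T, opair z p t & forces_eq_step L (val f) p s t].
have dStep : defin (fun=> True) (fun v => Step (v 0) (v 1) (v 2)).
  rewrite /Step /forces_eq_step /forces_sub_step /dense_below /val.
  by definability.
have [||f [[_ fT Sf] fE]] := recursion hM dStep _ _ tT.
- move=> f s fs; have [P HP] := product hM C T.
  have [|y Hy] := @separation _ hM (fun=> True) (fun z => exists p t,
    [/\ p ∈ C, t ∈ T, opair z p t & forces_eq_step L (val f) p s t]) P.
    rewrite /forces_eq_step /forces_sub_step /dense_below /val.
    by definability.
  exists y; split=> [z|y' Sy'].
    rewrite Hy; split=> [[_ //]|[p [t [pC tT' zpt H]]]]; split; last by exists p, t.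
    by apply/HP; exists p, t; split=> //; apply/opair_kpairE.
  apply: (extensionality hM) => z; rewrite Hy Sy'; split=> [[_ //]|[p [t [pC tT' zpt H]]]].
  split; last by exists p, t.
  by apply/HP; exists p, t; split=> //; apply/opair_kpairE.
- move=> f g s y fg Sy z; rewrite Sy.
  split=> -[p [t [pC tT' zpt H]]]; exists p, t; split=> //;
    apply: forces_eq_step_ext H => u a v b r /(app_hereditary hM) [us _] _ _ [w [uw wrv]];
    exists w; split=> //; exact/(fg _ _ us).
have [P HP] := product hM T T.
have [|F [_ HF]] := @relation_separation _ hM (fun=> True) (fun p y => exists u t,
    opair y u t /\ val f p u t) C P.
  by rewrite /val; definability.
have tabE p u t : p ∈ C -> u ∈ T -> t ∈ T -> (in_table F p u t <-> val f p u t).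
  move=> pC uT tT'; split=> [[y [yut /HF [_ _ [u' [t' [yut' H]]]]]]|H].
    by have [-> ->] := opair_inj hM yut yut'.
  exists (kpair hM u t); split; first exact: opair_kpair.
  apply/HF; split=> //; first by apply/HP; exists u, t.
  by exists u, t; split=> //; apply: opair_kpair.
exists F => q u v qC uT vT; rewrite tabE //.
have [w [fuw uw]] := fT u uT.
have E : val f q u v <-> forces_eq_step L (val f) q u v.
  split=> [[w' [/uw <- [z [zqv /(Sf _ _ uT fuw)]]]]|H].
    by move=> [p [t [_ _ zpt H]]]; have [-> ->] := opair_inj hM zqv zpt.
  exists w; split=> //; exists (kpair hM q v); split; first exact: opair_kpair.
  by apply/(Sf _ _ uT fuw); exists q, v; split=> //; apply: opair_kpair.
rewrite E; split; apply: forces_eq_step_ext => u' a v' b r /(transitive_name_closed tT uT) u'T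
  /(transitive_name_closed tT vT) v'T rC; by rewrite tabE.
Qed.

(** Forcing an equality means that some table contains it. As tables exist and agree,
    this relation obeys the recursion that defines tables. *)
Lemma forces_eqE p s t : p ∈ C -> feq p s t <-> forces_eq_step L feq p s t.
Proof.
move=> pC; have [T [tT stT]] := ex_transitive hM (upair hM s t).
have sT : s ∈ T by apply: tT stT _; rewrite in_upair; left.
have tT' : t ∈ T by apply: tT stT _; rewrite in_upair; right.
have [F HF] := ex_table tT; have cT := transitive_name_closed tT.
have E q u v : q ∈ C -> u ∈ T -> v ∈ T -> (feq q u v <-> in_table F q u v).
  move=> qC uT vT; split=> [[T' [F' [uT' vT' cT' H HF']]]|H]; last by exists T, F.
  exact: (table_unique cT' HF' cT HF).
rewrite E // (HF _ _ _ pC sT tT').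
split; apply: forces_eq_step_ext => u a v b r /(cT _ _ _ sT) uT /(cT _ _ _ tT') vT rC;
  by rewrite E.
Qed.

Lemma forces_eq_mono q p s t : q ⊑ p -> feq p s t -> feq q s t.
Proof.
move=> qp; have [qC pC] := le_field qp; rewrite !forces_eqE // => -[H1 H2].
by split=> u a r ua rq ra; [apply: H1 ua _ ra|apply: H2 ua _ ra]; apply: le_trans qp.
Qed.

Lemma forces_eq_dense p s t : p ∈ C -> dense_below L p (fun q => feq q s t) ->
  feq p s t.
Proof.
move=> pC H; rewrite forces_eqE //; split=> u a q ua qp qa q' q'q.
  have [r [rq' Hr]] := H q' (le_trans q'q qp).
  have [rC _] := le_field rq'; have [H1 _] := (forces_eqE s t rC).1 Hr.
  have [|r' [r'r H']] := H1 u a r ua (le_refl rC) _ r (le_refl rC).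
    by apply: le_trans qa; apply: le_trans q'q.
  by exists r'; split=> //; apply: le_trans rq'.
have [r [rq' Hr]] := H q' (le_trans q'q qp).
have [rC _] := le_field rq'; have [_ H1] := (forces_eqE s t rC).1 Hr.
have [|r' [r'r H']] := H1 u a r ua (le_refl rC) _ r (le_refl rC).
  by apply: le_trans qa; apply: le_trans q'q.
by exists r'; split=> //; apply: le_trans rq'.
Qed.

Lemma forces_eqL p s t u a q : feq p s t -> app s u a -> q ⊑ p -> q ⊑ a ->
  exists r v b, [/\ r ⊑ q, app t v b, r ⊑ b & feq r u v].
Proof.
move=> + ua qp qa; have [qC pC] := le_field qp; rewrite forces_eqE // => -[H _].
by have [r [rq [v [b [vb rb H']]]]] := H u a q ua qp qa q (le_refl qC); exists r, v, b.
Qed.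

Lemma forces_eqR p s t v b q : feq p s t -> app t v b -> q ⊑ p -> q ⊑ b ->
  exists r u a, [/\ r ⊑ q, app s u a, r ⊑ a & feq r u v].
Proof.
move=> + vb qp qb; have [qC pC] := le_field qp; rewrite forces_eqE // => -[_ H].
by have [r [rq [u [a [ua ra H']]]]] := H v b q vb qp qb q (le_refl qC); exists r, u, a.
Qed.

Lemma forces_eq_intro p s t : p ∈ C ->
  (forall u a q, app s u a -> q ⊑ p -> q ⊑ a ->
     exists r v b, [/\ r ⊑ q, app t v b, r ⊑ b & feq r u v]) ->
  (forall v b q, app t v b -> q ⊑ p -> q ⊑ b ->
     exists r u a, [/\ r ⊑ q, app s u a, r ⊑ a & feq r u v]) ->
  feq p s t.
Proof.
move=> pC H1 H2; rewrite forces_eqE //; split=> u a q ua qp qa q' q'q.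
  have [r [v [b [rq' vb rb H]]]] := H1 u a q' ua (le_trans q'q qp) (le_trans q'q qa).
  by exists r; split=> //; exists v, b.
have [r [v [b [rq' vb rb H]]]] := H2 u a q' ua (le_trans q'q qp) (le_trans q'q qa).
by exists r; split=> //; exists v, b.
Qed.

Lemma forces_eq_refl s : forall p, p ∈ C -> feq p s s.
Proof.
move: s; apply: (@hereditary_induction _ hM (fun=> True)); first by definability.
move=> s IH p pC; apply: forces_eq_intro => // u a q ua qp qa;
  have [qC _] := le_field qp; exists q, u, a;
  by split=> //; [apply: le_refl|apply: IH; case: (app_hereditary hM ua)].
Qed.

Lemma forces_eq_sym s : forall p t, p ∈ C -> feq p s t -> feq p t s.
Proof.
move: s; apply: (@hereditary_induction _ hM (fun=> True)); first by definability.
move=> s IH p t pC H; apply: forces_eq_intro => // [v b q vb qp qb|u a q ua qp qa].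
  have [r [u [a [rq ua ra Hr]]]] := forces_eqR H vb qp qb.
  exists r, u, a; split=> //; apply: IH => //; first by case: (app_hereditary hM ua).
  by case: (le_field rq).
have [r [v [b [rq vb rb Hr]]]] := forces_eqL H ua qp qa.
exists r, v, b; split=> //; apply: IH => //; first by case: (app_hereditary hM ua).
by case: (le_field rq).
Qed.

Lemma forces_eq_trans s : forall p t t', p ∈ C -> feq p s t -> feq p t t' -> feq p s t'.
Proof.
move: s; apply: (@hereditary_induction _ hM (fun=> True)); first by definability.
move=> s IH p t t' pC H H'; apply: forces_eq_intro => // [u a q ua qp qa|w c q wc qp qc].
  have [r [v [b [rq vb rb Hr]]]] := forces_eqL H ua qp qa.
  have [r' [w [c [r'r wc r'c Hr']]]] := forces_eqL H' vb (le_trans rq qp) rb.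
  exists r', w, c; split=> //; first exact: le_trans rq.
  apply: (IH u _ r' v) => //; first by case: (app_hereditary hM ua).
    by case: (le_field r'r).
  exact: forces_eq_mono Hr.
have [r [v [b [rq vb rb Hr]]]] := forces_eqR H' wc qp qc.
have [r' [u [a [r'r ua r'a Hr']]]] := forces_eqR H vb (le_trans rq qp) rb.
exists r', u, a; split=> //; first exact: le_trans rq.
apply: (IH u _ r' v) => //; first by case: (app_hereditary hM ua).
  by case: (le_field r'r).
exact: forces_eq_mono Hr.
Qed.

Lemma forces_mem_mono q p s t : q ⊑ p -> fmem p s t -> fmem q s t.
Proof. by move=> qp H r rq; apply: H; apply: le_trans qp. Qed.

Lemma forces_mem_dense p s t : dense_below L p (fun q => fmem q s t) -> fmem p s t.
Proof.
move=> H q qp; have [r [rq Hr]] := H q qp; have [rC _] := le_field rq.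
have [r' [r'r H']] := Hr r (le_refl rC).
by exists r'; split=> //; apply: le_trans rq.
Qed.

Lemma forces_mem_app p s u a : p ⊑ a -> app s u a -> fmem p u s.
Proof.
move=> pa ua q qp; have [qC _] := le_field qp; exists q; split; first exact: le_refl.
by exists u, a; split=> //; [apply: le_trans pa|apply: forces_eq_refl].
Qed.

Lemma forces_mem_eql p s s' t : p ∈ C -> feq p s s' -> fmem p s t -> fmem p s' t.
Proof.
move=> pC E H q qp; have [r [rq [u [a [ua ra Hr]]]]] := H q qp.
have [rC _] := le_field rq; exists r; split=> //; exists u, a; split=> //.
apply: (forces_eq_trans rC _ Hr); apply: (forces_eq_sym rC).
by apply: forces_eq_mono E; apply: le_trans qp.
Qed.

Lemma forces_mem_eqr p s t t' : p ∈ C -> feq p t t' -> fmem p s t -> fmem p s t'.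
Proof.
move=> pC E H q qp; have [r [rq [u [a [ua ra Hr]]]]] := H q qp.
have [r' [v [b [r'r vb r'b Hr']]]] := forces_eqL E ua (le_trans rq qp) ra.
have [r'C _] := le_field r'r.
exists r'; split; first exact: le_trans rq; exists v, b; split=> //.
by apply: (forces_eq_trans r'C _ Hr'); apply: forces_eq_mono Hr.
Qed.

Lemma forces_mono Y (f : formula Y) e q p :
  q ⊑ p -> forces C L f e p -> forces C L f e q.
Proof.
elim: f e q p => {Y} [Y x y|Y x y|Y g IH|Y g IHg h IHh|Y g IH] e q p qp /=.
- exact: forces_mem_mono.
- exact: forces_eq_mono.
- by move=> H r rq; apply: H; apply: le_trans qp.
- by case=> /(IHg _ _ _ qp) ? /(IHh _ _ _ qp).
- by move=> H t /H; apply: IH.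
Qed.

Lemma forces_dense Y (f : formula Y) e p : p ∈ C ->
  dense_below L p (forces C L f e) -> forces C L f e p.
Proof.
elim: f e p => {Y} [Y x y|Y x y|Y g IH|Y g IHg h IHh|Y g IH] e p pC /=.
- exact: forces_mem_dense.
- exact: forces_eq_dense.
- move=> H q qp Hq; have [r [rq]] := H q qp; have [rC _] := le_field rq.
  by move=> /(_ r (le_refl rC)); apply; apply: forces_mono Hq.
- move=> H; split; [apply: IHg|apply: IHh] => // q qp;
    by have [r [rq [? ?]]] := H q qp; exists r.
- move=> H t nt; apply: IH => // q qp.
  by have [r [rq Hr]] := H q qp; exists r; split=> //; apply: Hr.
Qed.

(** By density: if every stronger condition had a further extension forcing [f], the
    condition itself would force it. *)
Lemma not_forces Y (f : formula Y) e p : p ∈ C -> ~ forces C L f e p ->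
  exists q, q ⊑ p /\ forces C L (FNot f) e q.
Proof.
move=> pC H; apply: NNPP => H'; apply: H; apply: forces_dense => // q qp.
apply: NNPP => H; apply: H'; exists q; split=> // r rq Hr.
by apply: H; exists r.
Qed.

End Forcing.

(** * Names and check names *)

Section Names.
Variables (M : structure) (hM : ZFC M).
Implicit Types x y z a b c u w f g s t T : M.

Lemma is_nameE C t : is_name C t <->
  forall z, z ∈ t -> exists u p, [/\ is_name C u, p ∈ C & opair z u p].
Proof.
split=> [[T [tT HT]] z zt|H].
  have [u [p [uT pC zup]]] := HT _ tT _ zt.
  by exists u, p; split=> //; exists T.
have [T [tT tTT]] := ex_transitive hM t.
have [|T' HT'] := @separation _ hM (fun=> True) (is_name C) T; first by definability.
exists (adjoin hM T' t); rewrite in_adjoin; split; first by right.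
move=> s; rewrite in_adjoin => sT z zs.
have [sT' Hs] : s ∈ T /\ forall z, z ∈ s -> exists u p, [/\ is_name C u, p ∈ C & opair z u p].
  case: sT => [/HT' [sT [U [sU HU]]]|->] //; split=> // z' /(HU _ sU) [u [p [uU pC zup]]].
  by exists u, p; split=> //; exists U.
have [u [p [nu pC zup]]] := Hs _ zs; exists u, p; split=> //.
rewrite in_adjoin; left; apply/HT'; split=> //.
have /(app_hereditary hM) [us _] : app s u p by exists z.
exact: hereditary_transitive us.
Qed.

Lemma is_name_app C t u p : is_name C t -> app t u p -> is_name C u /\ p ∈ C.
Proof.
move=> /is_nameE H [z [zup /H [u' [p' [nu' p'C zup']]]]].
by have [-> ->] := opair_inj hM zup zup'.
Qed.

Variable one : M.

Let check_step f x t :=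
  forall z, z ∈ t <-> exists v u, [/\ v ∈ x, app f v u & opair z u one].

Lemma check_step_def : defin (fun=> True) (fun v => check_step (v 0) (v 1) (v 2)).
Proof. by rewrite /check_step; definability. Qed.

Lemma ex_check_step f x : (forall u, hereditary_in u x -> exists! y, app f u y) ->
  exists! y, check_step f x y.
Proof.
move=> fx.
have [||t Ht] := @replacement _ hM (fun=> True)
  (fun v z => exists u, app f v u /\ opair z u one) x.
- by definability.
- move=> v z z' /in_hereditary /fx [u0 [_ Hu0]].
  move=> [u [/Hu0 <- /(opair_kpairE hM) ->]] [u' [/Hu0 <- /(opair_kpairE hM) ->]] //.
have E : check_step f x t.
  move=> z; rewrite Ht; split=> [[v [vx [u [fvu zu]]]]|[v [u [vx fvu zu]]]]; exists v.
    by exists u.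
  by split=> //; exists u.
exists t; split=> // t' Ht'.
by apply: (extensionality hM) => z; rewrite E Ht'.
Qed.

Lemma check_step_local f g x y :
  (forall u z, hereditary_in u x -> (app f u z <-> app g u z)) ->
  check_step f x y -> check_step g x y.
Proof.
move=> fg H z; rewrite H; split=> -[v [u [vx fvu zu]]]; exists v, u; split=> //;
  by apply/(fg _ _ (in_hereditary vx)).
Qed.

Lemma check_name_rec x t : check_name one x t <-> rec_value check_step x t.
Proof.
split=> [[T [f [xT tT fT fxt H]]]|[f [T [[tT fT H] xT fxt]]]].
  by exists f, T.
by exists T, f.
Qed.

Lemma check_name_total x : exists t, check_name one x t.
Proof.
have [t Ht] := rec_value_total hM check_step_def ex_check_step check_step_local x.
by exists t; apply/check_name_rec.
Qed.

Lemma check_name_unique x s t : check_name one x s -> check_name one x t -> s = t.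
Proof.
move=> /check_name_rec H /check_name_rec.
exact: (rec_value_unique hM check_step_def ex_check_step check_step_local) H.
Qed.

Lemma check_nameE x t : check_name one x t -> forall z, z ∈ t <->
  exists v u, [/\ v ∈ x, check_name one v u & opair z u one].
Proof.
move=> /check_name_rec.
move=> /(rec_value_step hM check_step_def ex_check_step check_step_local) [f [Ht Hf]] z.
rewrite Ht; split=> -[v [u [vx fvu zu]]]; exists v, u; split=> //.
  by apply/check_name_rec/(Hf _ _ (in_hereditary vx)).
by apply/(Hf _ _ (in_hereditary vx))/check_name_rec.
Qed.

Lemma check_name_app x t u p : check_name one x t ->
  app t u p <-> p = one /\ exists v, v ∈ x /\ check_name one v u.
Proof.
move=> Ht; split=> [[z [zup /(check_nameE Ht) [v [u' [vx Hu' zu']]]]]|[-> [v [vx Hu]]]].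
  by have [-> ->] := opair_inj hM zup zu'; split=> //; exists v.
exists (kpair hM u one); split; first exact: opair_kpair.
by apply/(check_nameE Ht); exists v, u; split=> //; apply: opair_kpair.
Qed.

Lemma check_is_name C : one ∈ C -> forall x t, check_name one x t -> is_name C t.
Proof.
move=> oneC; apply: (@hereditary_induction _ hM (fun=> True)).
  by rewrite /check_name; definability.
move=> x IH t Ht; apply/is_nameE => z /(check_nameE Ht) [v [u [vx Hu zu]]].
by exists u, one; split=> //; apply: IH Hu; apply: in_hereditary.
Qed.

End Names.

Section CheckDefinability.
Variables (M : structure) (D : M -> Prop).
Lemma defin_check_name (x y z : (nat -> M) -> M) : term D x -> term D y -> term D z ->
  defin D (fun v => check_name (x v) (y v) (z v)).
Proof. by move=> *; rewrite /check_name; definability. Qed.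

Lemma defin_precedes (x y z : (nat -> M) -> M) : term D x -> term D y -> term D z ->
  defin D (fun v => precedes (x v) (y v) (z v)).
Proof. by move=> *; rewrite /precedes; definability. Qed.

Variables (C L : M) (DC : D C) (DL : D L).

Lemma defin_forces_env X (f : formula X) e p : (forall x, D (e x)) -> term D p ->
  defin D (fun v => forces C L f e (p v)).
Proof.
move=> De Hp; apply: (@defin_forces _ _ C L _ f (fun x _ => e x)) => // x.
exact: term_cst.
Qed.

Lemma defin_forces_scons X (f : formula (option X)) y e p :
  (forall x, D (e x)) -> term D y -> term D p ->
  defin D (fun v => forces C L f (scons (y v) e) (p v)).
Proof.
move=> De Hy Hp; pose t (o : option X) v := if o is Some x then e x else y v.
apply: (@defin_ext _ _ _ (fun v => forces C L f (t^~ v) (p v))).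
  move=> v; suff -> : t^~ v = scons (y v) e by [].
  by apply: functional_extensionality; case.
by apply: defin_forces => // -[x|] //; apply: (term_cst (De x)).
Qed.

Lemma defin_forces_scons2 X (f : formula (option (option X))) x y e p :
  (forall x, D (e x)) -> term D x -> term D y -> term D p ->
  defin D (fun v => forces C L f (scons (y v) (scons (x v) e)) (p v)).
Proof.
move=> De Hx Hy Hp.
pose t (o : option (option X)) v :=
  match o with Some (Some i) => e i | Some None => x v | None => y v end.
apply: (@defin_ext _ _ _ (fun v => forces C L f (t^~ v) (p v))).
  move=> v; suff -> : t^~ v = scons (y v) (scons (x v) e) by [].
  by apply: functional_extensionality; case=> [[]|].
by apply: defin_forces => // -[[i|]|] //; apply: (term_cst (De i)).
Qed.

End CheckDefinability.
#[global] Hint Resolve defin_check_name defin_precedes : defin.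
#[global] Hint Extern 1 (defin _ (fun v => forces _ _ _ (scons _ (scons _ _)) _)) =>
  apply: defin_forces_scons2 => // : defin.

(** * Generic extensions *)

(** By the Tarski-Vaught test, [D] is then an elementary substructure. *)
Definition elementary (M : structure) (D : M -> Prop) : Prop :=
  forall K : M -> Prop, defin D (fun v => K (v 0)) ->
    (exists x, K x) -> exists x, D x /\ K x.

(** A filter that is generic over [D], given from outside the model. *)
Record generic_over (M : structure) (C L : M) (D G : M -> Prop) : Prop := {
  go_sub : forall p, G p -> p ∈ C /\ D p;
  go_up : forall p q, G p -> app L p q -> D q -> G q;
  go_directed : forall p q, G p -> G q -> exists r, [/\ G r, app L r p & app L r q];
  go_dense : forall K : M -> Prop, defin D (fun v => K (v 0)) ->
    (forall p, p ∈ C -> exists q, app L q p /\ K q) -> exists p, G p /\ K p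
}.

Definition name_in (M : structure) (C : M) (D : M -> Prop) (t : M) : Prop :=
  D t /\ is_name C t.

(** [N] consists of the values [val t] of the names in [D], as dictated by the
    forcing relation and the filter [G]. *)
Record extension (M : structure) (C L : M) (D G : M -> Prop) (N : structure)
    (val : M -> N) : Prop := {
  ext_surj : forall x, exists t, name_in C D t /\ x = val t;
  ext_eq : forall s t, name_in C D s -> name_in C D t ->
    val s = val t <-> exists p, G p /\ forces_eq C L p s t;
  ext_mem : forall s t, name_in C D s -> name_in C D t ->
    val s ∈ val t <-> exists p, G p /\ forces_mem C L p s t
}.

Section Extension.
Variables (M : structure) (hM : ZFC M) (X C L one : M) (hP : poset X C L one).
Variables (D G : M -> Prop) (DC : D C) (DL : D L) (D1 : D one).
Hypotheses (eD : elementary D) (gG : generic_over C L D G).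
Variables (N : structure) (val : M -> N) (hN : extension C L D G val).
Implicit Types p q r s t u a b T F : M.

Local Notation "p ⊑ q" := (app L p q) (at level 70, no associativity).
Local Notation feq := (forces_eq C L).
Local Notation fmem := (forces_mem C L).
Local Notation name := (name_in C D).

(** The conditions incompatible with [p], together with [K], form a dense class that
    is definable from [p]. *)
Lemma generic_dense_below K p : defin D (fun v => K (v 0)) -> G p ->
  dense_below L p K -> exists q, [/\ G q, q ⊑ p & K q].
Proof.
move=> dK Gp HK; have [pC Dp] := go_sub gG Gp.
have [||q [Gq Hq]] := go_dense gG (K := fun q =>
  (q ⊑ p /\ K q) \/ ~ exists r, r ⊑ q /\ r ⊑ p).
- by definability.
- move=> q qC; case: (classic (exists r, r ⊑ q /\ r ⊑ p)) => [[r [rq rp]]|H].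
    have [r' [r'r Kr']] := HK r rp; exists r'; split; first exact: (le_trans hP r'r).
    by left; split=> //; apply: (le_trans hP r'r).
  by exists q; split; [apply: (le_refl hP)|right].
case: Hq => [[qp Kq]|H]; first by exists q.
by have [r [_ rq rp]] := go_directed gG Gq Gp; case: H; exists r.
Qed.

Lemma ex_condition : exists p, G p.
Proof.
have [||p [Gp _]] := go_dense gG (K := fun p => p = p); first by definability.
  by move=> p pC; exists p; split=> //; apply: (le_refl hP).
by exists p.
Qed.

Lemma G_one : G one.
Proof.
have [p Gp] := ex_condition; have [pC _] := go_sub gG Gp.
exact: (go_up gG Gp (poset_greatest hP pC)).
Qed.

Lemma name_app t u a : name t -> D u -> app t u a -> name u.
Proof. by move=> [_ nt] Du /(is_name_app hM nt) []. Qed.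

Lemma mem_valE x t : name t ->
  x ∈ val t <-> exists u a, [/\ name u, G a, app t u a & x = val u].
Proof.
move=> nt; split; last first.
  move=> [u [a [nu Ga ua ->]]]; apply/(ext_mem hN) => //; exists a; split=> //.
  by apply: (forces_mem_app hM hP) ua; apply: (le_refl hP); case: (go_sub gG Ga).
have [s [ns ->]] := ext_surj hN x.
have [[Ds _] [Dt _]] := (ns, nt).
move=> /(ext_mem hN ns nt) [p [Gp /(generic_dense_below _ Gp)]].
case=> [|q [Gq _ [u0 [a0 H]]]]; first by definability.
have [_ Dq] := go_sub gG Gq.
have [||u [Du [a1 H1]]] := eD (K := fun u => exists a, [/\ app t u a, q ⊑ a & feq q s u]).
- by definability.
- by exists u0, a0.
have [||a [Da [ua qa su]]] := eD (K := fun a => [/\ app t u a, q ⊑ a & feq q s u]).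
- by definability.
- by exists a1.
have nu := name_app nt Du ua.
exists u, a; split=> //; first exact: (go_up gG Gq).
by apply/(ext_eq hN) => //; exists q.
Qed.

(** If no condition of the filter forced equality, the filter would contain one that
    refutes it by an explicit element of one of the names, found in [D] by
    elementarity. *)
Lemma val_ext s t : name s -> name t ->
  (forall u a, name u -> G a -> app s u a -> val u ∈ val t) ->
  (forall u a, name u -> G a -> app t u a -> val u ∈ val s) -> val s = val t.
Proof.
move=> ns nt Hst Hts; apply/(ext_eq hN ns nt); have [[Ds _] [Dt _]] := (ns, nt).
pose bad s t p := exists u a, [/\ app s u a, p ⊑ a &
  ~ exists v b r, [/\ app t v b, r ⊑ p, r ⊑ b & feq r u v]].
have dbad (s' t' : M) : D s' -> D t' -> defin D (fun v => bad s' t' (v 0)).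
  by move=> Ds' Dt'; rewrite /bad; definability.
have not_bad s' t' p : name s' -> name t' ->
    (forall u a, name u -> G a -> app s' u a -> val u ∈ val t') ->
    G p -> ~ bad s' t' p.
  move=> ns' nt' H Gp [u0 [a0 H0]]; have [[Ds' _] [Dt' _]] := (ns', nt').
  have [_ Dp] := go_sub gG Gp.
  have [||u [Du [a1 H1]]] := eD (K := fun u => exists a, [/\ app s' u a, p ⊑ a &
    ~ exists v b r, [/\ app t' v b, r ⊑ p, r ⊑ b & feq r u v]]).
  - by definability.
  - by exists u0, a0.
  have [||a [Da [ua pa nex]]] := eD (K := fun a => [/\ app s' u a, p ⊑ a &
    ~ exists v b r, [/\ app t' v b, r ⊑ p, r ⊑ b & feq r u v]]).
  - by definability.
  - by exists a1.
  have nu := name_app ns' Du ua; have Ga := go_up gG Gp pa Da.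
  have /(mem_valE _ nt') [v [b [nv Gb vb /(ext_eq hN nu nv) [r [Gr uv]]]]] := H u a nu Ga ua.
  have [r1 [Gr1 r1r r1b]] := go_directed gG Gr Gb.
  have [r2 [Gr2 r2r1 r2p]] := go_directed gG Gr1 Gp.
  apply: nex; exists v, b, r2; split=> //; first exact: (le_trans hP r2r1).
  by apply: (forces_eq_mono hM hP) uv; apply: (le_trans hP r2r1).
have [||p [Gp [Hp|[Hp|Hp]]]] := go_dense gG (K := fun p =>
  feq p s t \/ bad s t p \/ bad t s p).
- by apply: defin_or; [definability|apply: defin_or; apply: dbad].
- move=> p pC; apply: NNPP => H; apply: (H); exists p; split; first exact: (le_refl hP).
  left; apply: (forces_eq_intro hM hP) => // u a q ua qp qa.
    apply: NNPP => H'; apply: H; exists q; split=> //; right; left.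
    exists u, a; split=> // -[v [b [r [vb rq rb uv]]]].
    by apply: H'; exists r, v, b.
  apply: NNPP => H'; apply: H; exists q; split=> //; right; right.
  exists u, a; split=> // -[v [b [r [vb rq rb uv]]]].
  apply: H'; exists r, v, b; split=> //; apply: (forces_eq_sym hM hP) uv.
  by case: (le_field hM hP rq).
- by exists p.
- by case: (not_bad _ _ _ ns nt Hst Gp).
- by case: (not_bad _ _ _ nt ns Hts Gp).
Qed.

(** The filter decides every formula, as the conditions that decide it form a
    definable dense class; for a quantifier, the names that refute an instance
    are found in [D] by elementarity. *)
Theorem truth Y (f : formula Y) (e : Y -> M) : (forall y, name (e y)) ->
  sat f (fun y => val (e y)) <-> exists p, G p /\ forces C L f e p.
Proof.
elim: f e => {Y} [Y x y|Y x y|Y g IH|Y g IHg h IHh|Y g IH] e ne /=.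
- exact: (ext_mem hN).
- exact: (ext_eq hN).
- have De y : D (e y) by case: (ne y).
  rewrite IH //; split=> [H|[p [Gp Hp]] [q [Gq Hq]]]; last first.
    have [r [_ rp rq]] := go_directed gG Gp Gq.
    by case: (Hp r rp); apply: (forces_mono hM hP rq).
  have [||p [Gp [Hp|Hp]]] := go_dense gG (K := fun p =>
    forces C L g e p \/ forces C L (FNot g) e p).
  - by apply: defin_or; apply: defin_forces_env => //; apply: term_var.
  - move=> p pC; case: (classic (forces C L g e p)) => [Hp|/(not_forces hM hP pC) [q [qp Hq]]].
      by exists p; split; [apply: (le_refl hP)|left].
    by exists q; split=> //; right.
  - by case: H; exists p.
  - by exists p.
- rewrite IHg // IHh //; split=> [[[p [Gp Hp]] [q [Gq Hq]]]|[p [Gp [Hg Hh]]]].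
    have [r [Gr rp rq]] := go_directed gG Gp Gq; exists r; split=> //.
    by split; [apply: (forces_mono hM hP rp)|apply: (forces_mono hM hP rq)].
  by split; exists p.
- have De y : D (e y) by case: (ne y).
  have E t : scons (val t) (fun y => val (e y)) = fun o => val (scons t e o).
    by apply: functional_extensionality; case.
  split=> [H|[p [Gp Hp]] x]; last first.
    have [t [nt ->]] := ext_surj hN x; rewrite E IH; last by case.
    by exists p; split=> //; apply: Hp; case: nt.
  have [||p [Gp [Hp|[t0 Ht0]]]] := go_dense gG (K := fun p =>
    forces C L (FAll g) e p \/
    exists t, is_name C t /\ forces C L (FNot g) (scons t e) p).
  - apply: defin_or; first by apply: defin_forces_env => //; apply: term_var.
    apply: defin_ex; apply: defin_and; first by definability.
    by apply: defin_forces_scons => //; apply: term_var.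
  - move=> p pC; case: (classic (forces C L (FAll g) e p)) => [Hp|nHp].
      by exists p; split; [apply: (le_refl hP)|left].
    have [t [nt Ht]] : exists t, is_name C t /\ ~ forces C L g (scons t e) p.
      by apply: NNPP => H'; apply: nHp => t nt; apply: NNPP => Ht; apply: H'; exists t.
    have [q [qp Hq]] := not_forces hM hP pC Ht.
    by exists q; split=> //; right; exists t.
  - by exists p.
  have [_ Dp] := go_sub gG Gp.
  have [||t [Dt [nt Ht]]] := eD (K := fun t =>
    is_name C t /\ forces C L (FNot g) (scons t e) p).
  - apply: defin_and; first by definability.
    by apply: defin_forces_scons => //; [apply: term_var|apply: term_cst].
  - by exists t0.
  have ns o : name (scons t e o) by case: o.
  have := H (val t); rewrite E => /(IH _ ns) [q [Gq Hq]].
  have [r [_ rp rq]] := go_directed gG Gp Gq.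
  by case: (Ht r rp); apply: (forces_mono hM hP rq).
Qed.

End Extension.

(** * The axioms of ZFC in a generic extension *)

Section ExtensionZFC.
Variables (M : structure) (hM : ZFC M) (X C L one : M) (hP : poset X C L one).
Variables (D G : M -> Prop) (DC : D C) (DL : D L) (D1 : D one).
Hypotheses (eD : elementary D) (gG : generic_over C L D G).
Variables (N : structure) (val : M -> N) (hN : extension C L D G val).
Implicit Types p q r s t u a b T F : M.

Local Notation "p ⊑ q" := (app L p q) (at level 70, no associativity).
Local Notation feq := (forces_eq C L).
Local Notation fmem := (forces_mem C L).
Local Notation name := (name_in C D).
Let mem_val := mem_valE hM hP DC DL eD gG hN.
Let truth' := truth hM hP DC DL eD gG hN.
Let G1 : G one := G_one hP D1 gG.

Lemma val_mem u a s : name u -> name s -> G a -> app s u a -> val u ∈ val s.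
Proof. by move=> nu ns Ga us; apply/(mem_val _ ns); exists u, a. Qed.

Lemma ex_transitive_in s : D s -> exists T, [/\ D T, transitive_set T & s ∈ T].
Proof.
move=> Ds; have [||T [DT [tT sT]]] := eD (K := fun T => transitive_set T /\ s ∈ T).
- by definability.
- exact: ex_transitive.
- by exists T.
Qed.

(** Sets of the extension are mostly given by names that collect, for a definable
    relation [K], the pairs (u, p) with [u] in a set of names; elementarity puts
    such a name into [D]. *)
Lemma name_comprehension (K : M -> M -> Prop) S : defin D (fun v => K (v 0) (v 1)) ->
  D S -> exists t, [/\ name t,
    (forall z, z ∈ t -> exists u p, [/\ u ∈ S, p ∈ C & opair z u p]) &
    forall u p, app t u p <-> [/\ u ∈ S, p ∈ C & is_name C u /\ K u p]].
Proof.
move=> dK DS.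
have [|t0 [Ht0 Et0]] := @relation_separation _ hM D (fun u p => is_name C u /\ K u p) S C.
  by definability.
have [||t [Dt [Ht Et]]] := eD (K := fun t =>
    (forall z, z ∈ t -> exists u p, [/\ u ∈ S, p ∈ C & opair z u p]) /\
    forall u p, app t u p <-> [/\ u ∈ S, p ∈ C & is_name C u /\ K u p]).
- by definability.
- by exists t0.
exists t; split=> //; split=> //; apply/(is_nameE hM) => z zt.
have [u [p [uS pC zup]]] := Ht _ zt; exists u, p; split=> //.
by have /Et [_ _ []] : app t u p by exists z.
Qed.

Lemma mem_comprehension (K : M -> M -> Prop) S t : name t ->
  (forall u p, app t u p <-> [/\ u ∈ S, p ∈ C & is_name C u /\ K u p]) ->
  forall x, x ∈ val t <-> exists u p, [/\ name u, G p, u ∈ S, K u p & x = val u].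
Proof.
move=> nt Et x; rewrite mem_val //.
split=> [[u [p [nu Gp /Et [uS pC [_ Kup]] ->]]]|[u [p [[Du nu] Gp uS Kup ->]]]].
  by exists u, p.
exists u, p; split=> //; apply/Et; split=> //; by case: (go_sub gG Gp).
Qed.

Lemma app_in_transitive T s u a : transitive_set T -> s ∈ T -> app s u a -> u ∈ T.
Proof.
by move=> tT sT /(app_hereditary hM) [us _]; apply: hereditary_transitive us.
Qed.

Lemma choose_names Y (e : Y -> N) :
  exists e' : Y -> M, (forall i, name (e' i)) /\ e = fun i => val (e' i).
Proof.
pose c i := constructive_indefinite_description _ (ext_surj hN (e i)).
exists (fun i => proj1_sig (c i)).
by split=> [i|]; [|apply: functional_extensionality => i]; case: (proj2_sig (c i)).
Qed.

Lemma extension_extensionality (x y : N) : (forall z, z ∈ x <-> z ∈ y) -> x = y.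
Proof.
have [s [ns ->]] := ext_surj hN x; have [t [nt ->]] := ext_surj hN y => H.
apply: (val_ext hM hP DC DL eD gG hN ns nt) => u a nu Ga ua; apply/H.
  exact: val_mem ua.
exact: val_mem ua.
Qed.

(** A name that is minimal among those forced into [s] by some condition has a value
    without elements in [s]. The minimum is taken in the ground model, where definable
    classes have minimal elements; density transfers it to the filter. *)
Lemma extension_foundation (x : N) : (exists y, y ∈ x) ->
  exists y, y ∈ x /\ forall z, z ∈ y -> ~ z ∈ x.
Proof.
have [s [ns ->]] := ext_surj hN x; have [Ds _] := ns => -[y].
have [u0 [[Du0 nu0] ->]] := ext_surj hN y => /(ext_mem hN _ ns) [//|p [Gp Hp]].
have [||q [Gq qp [u1 H1]]] := generic_dense_below hP DL gG
  (K := fun q => exists u, [/\ is_name C u, fmem q u s &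
    forall w b r, app u w b -> r ⊑ q -> r ⊑ b -> ~ fmem r w s]) _ Gp.
- by definability.
- move=> q qp; have [qC pC] := le_field hM hP qp.
  have [||u [[nu [r [rq Hr]]] minu]] := class_minimal hM (D := fun=> True)
    (K := fun u => is_name C u /\ exists r, r ⊑ q /\ fmem r u s).
  - by definability.
  - exists u0; split=> //; exists q; split; first exact: (le_refl hP).
    exact: (forces_mem_mono hP qp).
  exists r; split=> //; exists u; split=> // w b r' wu r'r r'b Hw.
  have [wu' _] := app_hereditary hM wu; apply: (minu _ wu').
  split; first by case: (is_name_app hM nu wu).
  by exists r'; split=> //; apply: (le_trans hP r'r).
have [_ Dq] := go_sub gG Gq.
have [||u [Du [nu us Hu]]] := eD (K := fun u => [/\ is_name C u, fmem q u s &
    forall w b r, app u w b -> r ⊑ q -> r ⊑ b -> ~ fmem r w s]).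
- by definability.
- by exists u1.
exists (val u); split; first by apply/(ext_mem hN) => //; exists q.
move=> z /(mem_val _ (conj Du nu)) [w [b [nw Gb wu ->]]] /(ext_mem hN nw ns) [r [Gr Hr]].
have [r1 [Gr1 r1q r1b]] := go_directed gG Gq Gb.
have [r2 [_ r2r1 r2r]] := go_directed gG Gr1 Gr.
apply: (Hu w b r2 wu).
- exact: (le_trans hP r2r1).
- exact: (le_trans hP r2r1).
- exact: (forces_mem_mono hP r2r).
Qed.

Lemma extension_pairing (x y : N) : exists z, forall w, w ∈ z <-> w = x \/ w = y.
Proof.
have [s [[Ds ns] ->]] := ext_surj hN x; have [t [[Dt nt] ->]] := ext_surj hN y.
have [||S [DS HS]] := eD (K := fun S => forall w, w ∈ S <-> w = s \/ w = t).
- by definability.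
- by exists (upair hM s t) => w; rewrite in_upair.
have [|d [nd _ Ed]] := name_comprehension (K := fun u p => u = u) _ DS.
  by definability.
exists (val d) => w; rewrite (mem_comprehension nd Ed).
split=> [[u [p [_ _ /HS [] -> _ ->]]]|[] ->]; [by left|by right| |].
  by exists s, one; split=> //; apply/HS; left.
by exists t, one; split=> //; apply/HS; right.
Qed.

Lemma extension_union (x : N) : exists y, forall z, z ∈ y <-> exists w, w ∈ x /\ z ∈ w.
Proof.
have [s [ns ->]] := ext_surj hN x; have [Ds _] := ns.
have [T [DT tT sT]] := ex_transitive_in Ds.
have [|d [nd _ Ed]] := name_comprehension (K := fun v c => exists u a b,
  [/\ app s u a, app u v b, c ⊑ a & c ⊑ b]) _ DT.
  by definability.
exists (val d) => z; rewrite (mem_comprehension nd Ed); split; last first.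
  move=> [w [/(mem_val _ ns) [u [a [nu Ga ua ->]]] /(mem_val _ nu) [v [b [nv Gb vb ->]]]]].
  have [c [Gc ca cb]] := go_directed gG Ga Gb.
  exists v, c; split=> //; last by exists u, a, b.
  exact: app_in_transitive (app_in_transitive tT sT ua) vb.
move=> [v [c [nv Gc vT [u0 H0] ->]]].
have [[_ Dc] [Dv _]] := (go_sub gG Gc, nv).
have [||u [Du [a0 H1]]] := eD (K := fun u => exists a b,
  [/\ app s u a, app u v b, c ⊑ a & c ⊑ b]).
- by definability.
- by exists u0.
have [||a [Da [b0 H2]]] := eD (K := fun a => exists b,
  [/\ app s u a, app u v b, c ⊑ a & c ⊑ b]).
- by definability.
- by exists a0.
have [||b [Db [ua vb ca cb]]] := eD (K := fun b =>
  [/\ app s u a, app u v b, c ⊑ a & c ⊑ b]).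
- by definability.
- by exists b0.
have nu := name_app hM ns Du ua; exists (val u).
by split; [apply: val_mem ua|apply: val_mem vb] => //; apply: (go_up gG Gc).
Qed.

(** By the truth lemma, collecting the elements together with conditions that force
    the formula is enough. *)
Lemma extension_separation Y (f : formula (option Y)) (e : Y -> N) (x : N) :
  exists y, forall z, z ∈ y <-> z ∈ x /\ sat f (scons z e).
Proof.
have [s [ns ->]] := ext_surj hN x; have [Ds _] := ns.
have [e' [ne' Ee]] := choose_names e.
have De' i : D (e' i) by case: (ne' i).
have [T [DT tT sT]] := ex_transitive_in Ds.
have [|d [nd _ Ed]] := name_comprehension (K := fun u p =>
  fmem p u s /\ forces C L f (scons u e') p) _ DT.
  apply: defin_and; first by definability.
  by apply: defin_forces_scons => //; apply: term_var.
have E u : scons (val u) e = fun o => val (scons u e' o).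
  by rewrite Ee; apply: functional_extensionality; case.
have ns' u o : name u -> name (scons u e' o) by case: o => /=.
exists (val d) => z; rewrite (mem_comprehension nd Ed).
split=> [[u [p [nu Gp uT [us Hp] ->]]]|[/(mem_val _ ns) [u [a [nu Ga ua ->]]]]].
  split; first by apply/(ext_mem hN nu ns); exists p.
  by rewrite E; apply/truth' => [o|]; [apply: ns'|exists p].
rewrite E truth' => [[p [Gp Hp]]|o]; last exact: ns'.
have [r [Gr rp ra]] := go_directed gG Gp Ga.
exists u, r; split=> //; first exact: app_in_transitive ua.
split; first exact: (forces_mem_app hM hP ra ua).
exact: (forces_mono hM hP rp).
Qed.

Lemma extension_comprehension (K : N -> Prop) (x : N) : defin (fun=> True) (fun v => K (v 0)) ->
  exists y, forall z, z ∈ y <-> z ∈ x /\ K z.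
Proof.
by apply: separation_from_scheme => n; apply: extension_separation.
Qed.

(** Every subset of the value of [s] has a name among the sets of pairs (v, p) with
    [v] in the domain of [s], so the power set of the ground model bounds them. *)
Lemma extension_power (x : N) : exists y, forall z, z ∈ y <-> forall w, w ∈ z -> w ∈ x.
Proof.
suff [y Hy] : exists y : N, forall z, (forall w, w ∈ z -> w ∈ x) -> z ∈ y.
  have [|y' Hy'] := extension_comprehension (K := fun z : N => forall w, w ∈ z -> w ∈ x) y.
    by definability.
  by exists y' => z; rewrite Hy'; split=> [[]//|H]; split=> //; apply: Hy.
have [s [ns ->]] := ext_surj hN x; have [Ds _] := ns.
have [T [DT tT sT]] := ex_transitive_in Ds.
pose small u := forall z, z ∈ u -> exists v p, [/\ v ∈ T, p ∈ C & opair z v p].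
have [||W [DW HW]] := eD (K := fun W => forall u, small u -> u ∈ W).
- by rewrite /small; definability.
- have [P HP] := product hM T C; exists (power hM P) => u Hu.
  apply/in_power => z /Hu [v [p [vT pC /(opair_kpairE hM) E]]]; apply/HP; by exists v, p.
have [|d [nd _ Ed]] := name_comprehension (K := fun u p => u = u) _ DW.
  by definability.
exists (val d) => z; have [r [nr ->]] := ext_surj hN z => rs; have [Dr _] := nr.
have [|u [nu su Eu]] := name_comprehension (K := fun v p => fmem p v r) _ DT.
  by definability.
have -> : val r = val u.
  apply: extension_extensionality => w; rewrite (mem_comprehension nu Eu).
  split=> [wr|[v [p [nv Gp vT vr ->]]]]; last by apply/(ext_mem hN) => //; exists p.
  have /(mem_val _ ns) [v [a [nv Ga va Ew]]] := rs _ wr.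
  rewrite Ew in wr *; have /(ext_mem hN nv nr) [p [Gp vr]] := wr.
  by exists v, p; split=> //; apply: app_in_transitive va.
by apply/(mem_comprehension nd Ed); exists u, one; split=> //; apply: HW.
Qed.

(** ** Check names *)

Lemma ex_check_in c : D c -> exists t, [/\ D t, is_name C t & check_name one c t].
Proof.
move=> Dc; have [||t [Dt Ht]] := eD (K := fun t => check_name one c t).
- by definability.
- exact: check_name_total.
by exists t; split=> //; apply: (check_is_name hM (poset_one hP) Ht).
Qed.

Lemma mem_check c t (x : N) : D c -> D t -> check_name one c t -> x ∈ val t <->
  exists v u, [/\ v ∈ c, D v, D u, check_name one v u & x = val u].
Proof.
move=> Dc Dt Ht; have nt := conj Dt (check_is_name hM (poset_one hP) Ht).
rewrite (mem_val _ nt); split.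
  move=> [u [a [[Du nu] Ga /(check_name_app hM _ _ Ht) [_ [v0 [v0c Hu]]] ->]]].
  have [||v [Dv [vc Hv]]] := eD (K := fun v => v ∈ c /\ check_name one v u).
  - by definability.
  - by exists v0.
  by exists v, u; split.
move=> [v [u [vc Dv Du Hu ->]]]; exists u, one; split=> //.
  by split=> //; apply: (check_is_name hM (poset_one hP) Hu).
by apply/(check_name_app hM _ _ Ht); split=> //; exists v.
Qed.

Lemma extension_infinity : exists w : N,
  (exists z, z ∈ w /\ forall u : N, ~ u ∈ z) /\
  (forall x, x ∈ w -> exists y, y ∈ w /\ forall u : N, u ∈ y <-> u ∈ x \/ u = x).
Proof.
have [||w [Dw [H0 HS]]] := eD (K := fun w =>
  (exists z, z ∈ w /\ forall u, ~ u ∈ z) /\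
  (forall x, x ∈ w -> exists y, y ∈ w /\ forall u, u ∈ y <-> u ∈ x \/ u = x)).
- by definability.
- exact: zfc_infinity.
have [t [Dt nt Ht]] := ex_check_in Dw.
exists (val t); split.
  have [||z [Dz [zw Hz]]] := eD (K := fun z => z ∈ w /\ forall u, ~ u ∈ z) => //.
    by definability.
  have [u [Du nu Hu]] := ex_check_in Dz.
  exists (val u); split; first by apply/(mem_check _ Dw Dt Ht); exists z, u.
  by move=> x /(mem_check _ Dz Du Hu) [v [? [/Hz]]].
move=> x /(mem_check _ Dw Dt Ht) [v [u [vw Dv Du Hu ->]]].
have [||y [Dy [yw Hy]]] := eD (K := fun y =>
  y ∈ w /\ forall u, u ∈ y <-> u ∈ v \/ u = v).
- by definability.
- by have [y Hy] := HS _ vw; exists y.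
have [s [Ds ns Hs]] := ex_check_in Dy.
exists (val s); split; first by apply/(mem_check _ Dw Dt Ht); exists y, s.
move=> z; rewrite (mem_check _ Dy Ds Hs) (mem_check _ Dv Du Hu).
split=> [[v' [u' [/Hy [v'v|->] Dv' Du' Hu' ->]]]|[[v' [u' [v'v Dv' Du' Hu' ->]]]|->]].
- by left; exists v', u'.
- by right; congr val; apply: (check_name_unique hM Hu' Hu).
- by exists v', u'; split=> //; apply/Hy; left.
- by exists v, u; split=> //; apply/Hy; right.
Qed.

(** ** Replacement and choice *)

(** Collection in the ground model bounds the names of the images of all elements,
    for all conditions at once; separation then leaves the exact image. *)
Lemma extension_replacement n (f : formula (option (option 'I_n))) (e : 'I_n -> N) (x : N) :
  (forall u v w : N, u ∈ x -> sat f (scons v (scons u e)) ->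
     sat f (scons w (scons u e)) -> v = w) ->
  exists y, forall v : N, v ∈ y <-> exists u : N, u ∈ x /\ sat f (scons v (scons u e)).
Proof.
move=> fun_f.
suff [y Hy] : exists y, forall u v : N, u ∈ x -> sat f (scons v (scons u e)) -> v ∈ y.
  pose rho (o : option (option 'I_n)) : option (option (option 'I_n)) :=
    match o with
    | None => Some None | Some None => None | Some (Some i) => Some (Some (Some i))
    end.
  have [y' Hy'] := extension_separation
    (FEx (FAnd (FMem None (Some (Some None))) (frename rho f))) (scons x e) y.
  have E (v u : N) : sat (frename rho f) (scons u (scons v (scons x e))) <->
      sat f (scons v (scons u e)).
    rewrite sat_frename; set e1 := fun o => _.
    suff -> : e1 = scons v (scons u e) by [].
    by apply: functional_extensionality; case=> [[]|].
  exists y' => v; rewrite Hy' /=; split.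
    case=> _ H; apply: NNPP => H'; apply: H => u [/= ux /E Hv].
    by apply: H'; exists u.
  move=> [u [ux Hv]]; split; first exact: Hy Hv.
  by move=> H; apply: (H u); split=> //; apply/E.
have [s [ns Ex]] := ext_surj hN x; have [Ds _] := ns.
have [e' [ne' Ee]] := choose_names e.
have De' i : D (e' i) by case: (ne' i).
have [T [DT tT sT]] := ex_transitive_in Ds.
pose W u p v := is_name C v /\ forces C L f (scons v (scons u e')) p.
have [||B [DB HB]] := eD (K := fun B => forall u p, u ∈ T -> p ∈ C ->
    forall v, W u p v -> exists v', v' ∈ B /\ W u p v').
- by rewrite /W; definability; apply: defin_forces_scons2 => //; term_tac.
- have [P HP] := product hM T C.
  have [|B HB] := @collection _ hM D (fun z v => exists u p, opair z u p /\ W u p v) P.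
    by rewrite /W; definability; apply: defin_forces_scons2 => //; term_tac.
  exists B => u p uT pC v Wv.
  have [||v' [v'B [u' [p' [/(opair_kpairE hM)/kpair_inj [-> ->] Wv']]]]] := HB (kpair hM u p) v.
  - by apply/HP; exists u, p.
  - by exists u, p; split=> //; apply: opair_kpair.
  by exists v'.
have [|d [nd _ Ed]] := name_comprehension (K := fun u p => u = u) _ DB.
  by definability.
exists (val d) => z y; rewrite Ex => zs.
have /(mem_val _ ns) [u [a [nu Ga ua Ez]]] := zs.
have uT := app_in_transitive tT sT ua.
have [v [nv Ev]] := ext_surj hN y.
have E v' : scons (val v') (scons (val u) e) = fun o => val (scons v' (scons u e') o).
  by rewrite Ee; apply: functional_extensionality; case=> [[]|].
have ns' v' o : name v' -> name (scons v' (scons u e') o) by case: o => [[i|]|] /=.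
rewrite Ez Ev E => H; have /truth' [|p [Gp Hp]] := H; first by move=> o; apply: ns'.
have [[pC Dp] [Du _]] := (go_sub gG Gp, nu).
have [v1 Hv1] := HB u p uT pC v (conj nv.2 Hp).
have [||v' [Dv' [v'B [nv' Hv']]]] := eD (K := fun v => v ∈ B /\ W u p v).
- rewrite /W; definability; apply: defin_forces_scons => //; try by term_tac.
- by exists v1.
have -> : val v = val v'.
  apply: (fun_f z); first by rewrite Ex.
    by rewrite Ez E.
  by rewrite Ez E; apply/truth' => [o|]; [apply: ns'|exists p].
by apply/(mem_comprehension nd Ed); exists v', one.
Qed.

(** The sets of names come with well-orders in the ground model; although a
    given member of the family need not be a set of the ground model, its
    least element is decided by some condition. *)
Lemma extension_choice (x : N) :
  (forall y, y ∈ x -> exists z, z ∈ y) ->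
  (forall y z u : N, y ∈ x -> z ∈ x -> u ∈ y -> u ∈ z -> y = z) ->
  exists c, forall y, y ∈ x -> exists! z, z ∈ y /\ z ∈ c.
Proof.
have [s [ns ->]] := ext_surj hN x; have [Ds _] := ns => nonempty disjoint.
have [T [DT tT sT]] := ex_transitive_in Ds.
have [||O [DO HO]] := eD (K := fun O => forall B, (forall u, u ∈ B -> u ∈ T) ->
  (exists u, u ∈ B) -> exists v, v ∈ B /\
  forall u, u ∈ B -> ~ precedes O u v /\ (u = v \/ precedes O v u)).
- by definability.
- exact: well_order.
have total v v' : v ∈ T -> v' ∈ T -> v <> v' -> precedes O v v' \/ precedes O v' v.
  move=> vT v'T vv'; have [||w [/in_upair Hw HB]] := HO (upair hM v v').
  - by move=> u /in_upair [] ->.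
  - by exists v; apply/in_upair; left.
  have [_ Hv] := HB v ((in_upair hM _ _ _).2 (or_introl erefl)).
  have [_ Hv'] := HB v' ((in_upair hM _ _ _).2 (or_intror erefl)).
  by case: Hw Hv Hv' => -> [] Hv [] Hv'; try congruence; tauto.
pose least p v u := fmem p v u /\ forall v', v' ∈ T -> is_name C v' ->
  precedes O v' v -> forall r, r ⊑ p -> ~ fmem r v' u.
have dleast : defin D (fun v => least (v 0) (v 1) (v 2)).
  by rewrite /least; definability.
have [|d [nd _ Ed]] := name_comprehension (K := fun v p => exists u a,
  [/\ app s u a, p ⊑ a & least p v u]) _ DT.
  by definability.
exists (val d) => y ys; have /(mem_val _ ns) [u [a [nu Ga ua Ey]]] := ys.
have [Du _] := nu; have uT := app_in_transitive tT sT ua.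
have [z zy] := nonempty _ ys; move: zy; rewrite Ey => zu.
have [w [b [nw Gb wb Ez]]] := (mem_val z nu).1 zu.
have wT := app_in_transitive tT uT wb; have [Dw nw'] := nw.
rewrite {}Ez in zu; have [p0 [Gp0 Hp0]] := (ext_mem hN nw nu).1 zu.
have [||q [Gq qp [v0 [v0T [nv0 Hv0]]]]] := generic_dense_below hP DL gG
  (K := fun q => exists v, v ∈ T /\ is_name C v /\ least q v u) _ Gp0.
- by definability.
- move=> q qp; have [|B HB] := @separation _ hM (fun=> True)
    (fun v => is_name C v /\ exists r, r ⊑ q /\ fmem r v u) T.
    by definability.
  have [||v [/HB [vT [nv [r [rq Hr]]]] minv]] := HO B; first by move=> ? /HB [].
    exists w; apply/HB; split=> //; split=> //; exists q; split.
      by apply: (le_refl hP); case: (le_field hM hP qp).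
    exact: (forces_mem_mono hP qp).
  exists r; split=> //; exists v; do 3![split=> //] => v' v'T nv' v'v r' r'r Hr'.
  have [|+ _] := minv v'; last exact.
  apply/HB; split=> //; split=> //; exists r'; split=> //.
  exact: (le_trans hP r'r).
have [_ Dq] := go_sub gG Gq.
have [||v [Dv [vT [nv [vu minv]]]]] := eD (K := fun v => v ∈ T /\ is_name C v /\ least q v u).
- by definability.
- by exists v0.
have [c [Gc cq ca]] := go_directed gG Gq Ga.
exists (val v); split.
  split; first by apply/(ext_mem hN) => //; exists q.
  apply/(mem_comprehension nd Ed); exists v, c; split=> //.
  exists u, a; split=> //; split; first exact: (forces_mem_mono hP cq).
  by move=> v' v'T nv' v'v r rc; apply: minv v'v _ _ => //; apply: (le_trans hP rc).
move=> z' [z'u /(mem_comprehension nd Ed) [v' [q' [nv' Gq' v'T [u0 [a0 H0]] Ez']]]].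
have [[_ Dq'] [Dv' nv'']] := (go_sub gG Gq', nv').
have [||u' [Du' [a1 H1]]] := eD (K := fun u => exists a,
  [/\ app s u a, q' ⊑ a & least q' v' u]).
- by definability.
- by exists u0, a0.
have [||a' [Da' [u'a' q'a' [v'u' minv']]]] := eD (K := fun a =>
  [/\ app s u' a, q' ⊑ a & least q' v' u']).
- by definability.
- by exists a1.
have nu' := name_app hM ns Du' u'a'; have Ga' := go_up gG Gq' q'a' Da'.
have v'u'N : val v' ∈ val u' by apply/(ext_mem hN) => //; exists q'.
have Euu' : val u = val u'.
  apply: (disjoint _ _ (val v')) => //.
  - exact: val_mem ua.
  - exact: val_mem u'a'.
  - by rewrite -Ez'.
have [r0 [Gr0 Hr0]] := (ext_eq hN nu nu').1 Euu'.
have [r1 [Gr1 r1q r1q']] := go_directed gG Gq Gq'.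
have [r [Gr rr1 rr0]] := go_directed gG Gr1 Gr0.
have [rC _] := go_sub gG Gr.
have rq := le_trans hP rr1 r1q; have rq' := le_trans hP rr1 r1q'.
have E := forces_eq_mono hM hP rr0 Hr0.
rewrite Ez'; congr val; apply: NNPP => vv'.
case: (total _ _ vT v'T vv') => [v_v'|v'_v].
  apply: (minv' v vT nv v_v' r rq').
  apply: (forces_mem_eqr hM hP rC E); exact: (forces_mem_mono hP rq).
apply: (minv v' v'T nv'' v'_v r rq).
apply: (forces_mem_eqr hM hP rC (forces_eq_sym hM hP rC E)).
exact: (forces_mem_mono hP rq').
Qed.

Theorem extension_ZFC : ZFC N.
Proof.
split.
- exact: extension_extensionality.
- exact: extension_foundation.
- exact: extension_pairing.
- exact: extension_union.
- exact: extension_power.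
- exact: extension_infinity.
- exact: extension_choice.
- by move=> n f e x; apply: extension_separation.
- by move=> n f e x; apply: extension_replacement.
Qed.

End ExtensionZFC.

(** * Isomorphic structures *)

Record isomorphism (S S' : structure) (k : S -> S') : Prop := {
  iso_inj : injective k;
  iso_surj : forall y, exists x, y = k x;
  iso_elt : forall x y, x ∈ y <-> k x ∈ k y
}.

Section Isomorphism.
Variables (S S' : structure) (k : S -> S') (ik : isomorphism k).

Lemma sat_iso X (f : formula X) (e : X -> S) : sat f e <-> sat f (fun x => k (e x)).
Proof.
elim: f e => {X} [X x y|X x y|X g IH|X g IHg h IHh|X g IH] e /=.
- exact: iso_elt.
- by split=> [->|/(iso_inj ik)].
- by rewrite IH.
- by rewrite IHg IHh.
- have E v : (fun o => k (scons v e o)) = scons (k v) (fun x => k (e x)).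
    by apply: functional_extensionality; case.
  split=> H v; last by apply/IH; rewrite E.
  by have [u ->] := iso_surj ik v; rewrite -E; apply/IH.
Qed.

Lemma iso_class (y : S') (K : S -> Prop) : (forall x, K x <-> k x ∈ y) ->
  exists x, forall z, z ∈ x <-> K z.
Proof.
have [x ->] := iso_surj ik y => H; exists x => z.
by rewrite H (iso_elt ik).
Qed.

Lemma ZFC_iso : ZFC S' -> ZFC S.
Proof.
have kE := iso_elt ik; have kS := iso_surj ik; have kI := iso_inj ik.
have scE X (v : S) (e : X -> S) :
    (fun o => k (scons v e o)) = scons (k v) (fun x => k (e x)).
  by apply: functional_extensionality; case.
case=> ext found pairing uni pow [w [[z0 [z0w Hz0]] Hw]] choice sep repl; split.
- move=> x y H; apply/kI/ext => z; have [u ->] := kS z.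
  by rewrite -!kE.
- move=> x [y yx]; have [|z [zx Hz]] := found (k x); first by exists (k y); apply/kE.
  have [u Eu] := kS z; rewrite {}Eu in zx Hz.
  by exists u; split=> [|v /kE /Hz]; rewrite kE.
- move=> x y; have [z Hz] := pairing (k x) (k y).
  apply: (iso_class (y := z)) => u; rewrite Hz.
  by split=> -[H|H]; [left; rewrite H|right; rewrite H|left; apply: kI|right; apply: kI].
- move=> x; have [z Hz] := uni (k x); apply: (iso_class (y := z)) => u; rewrite Hz.
  split=> [[v [/kE ? /kE ?]]|[v]]; first by exists (k v).
  by have [v' ->] := kS v => -[/kE ? /kE ?]; exists v'.
- move=> x; have [z Hz] := pow (k x); apply: (iso_class (y := z)) => u; rewrite Hz.
  split=> [H v|H v /kE /H /kE //]; have [v' ->] := kS v.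
  by rewrite -!kE; apply: H.
- have [w' Ew] := kS w; have [z' Ez] := kS z0; rewrite {}Ew {}Ez in z0w Hz0 Hw.
  exists w'; split; first by exists z'; split=> [|u /kE /Hz0 //]; apply/kE.
  move=> x /kE /Hw [y]; have [y' ->] := kS y => -[/kE yw Hy].
  exists y'; split=> // u; rewrite !kE Hy.
  by split=> -[H|H]; [left|right; apply: kI|left|right; rewrite H].
- move=> x ne disj; have [||c] := choice (k x).
  + move=> y; have [y' ->] := kS y => /kE /ne [z zy].
    by exists (k z); apply/kE.
  + move=> y z u; have [y' ->] := kS y; have [z' ->] := kS z; have [u' ->] := kS u.
    by move=> /kE yx /kE zx /kE uy /kE uz; rewrite (disj _ _ _ yx zx uy uz).
  have [c' ->] := kS c => Hc; exists c' => y /kE /Hc [z].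
  have [z' ->] := kS z => -[[/kE zy /kE zc] uz]; exists z'; split=> // v [/kE vy /kE vc].
  by apply/kI/uz.
- move=> n f e x; have [y Hy] := sep n f (fun i => k (e i)) (k x).
  by apply: (iso_class (y := y)) => z; rewrite Hy -kE -scE -sat_iso.
- move=> n f e x fun_f.
  have E u v : sat f (scons v (scons u e)) <->
      sat f (scons (k v) (scons (k u) (fun i => k (e i)))).
    by rewrite -!scE -sat_iso.
  have [|y Hy] := repl n f (fun i => k (e i)) (k x).
    move=> u v w'; have [u' ->] := kS u; have [v' ->] := kS v; have [w1 ->] := kS w'.
    by rewrite -!E -kE => ux Hv Hw1; rewrite (fun_f _ _ _ ux Hv Hw1).
  apply: (iso_class (y := y)) => v; rewrite Hy; split=> -[u [ux H]].
    by exists (k u); rewrite -kE -E.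
  by move: ux H; have [u' ->] := kS u; rewrite -kE -E; exists u'.
Qed.

End Isomorphism.

(** * Values of names *)

Section NameValues.
Variables (M : structure) (hM : ZFC M).
Implicit Types x y z a b c u w f g s t T G : M.

Lemma name_value_unique G t x y : name_value G t x -> name_value G t y -> x = y.
Proof.
move: t x y; apply: (@hereditary_induction _ hM (fun=> True)); first by definability.
move=> t IH x y [T [f [tT cT fT ftx Hf]]] [T' [f' [tT' cT' fT' ftx' Hf']]].
apply: (extensionality hM) => z; rewrite (Hf _ _ tT ftx) (Hf' _ _ tT' ftx').
split=> -[u [p [pG up uz]]]; exists u, p; split=> //;
  have [uT uT'] := (cT _ _ _ tT up, cT' _ _ _ tT' up);
  have [ut _] := app_hereditary hM up.
  have [z' [fz' _]] := fT' _ uT'.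
  by rewrite (IH u ut z z') //; [exists T, f|exists T', f'].
have [z' [fz' _]] := fT _ uT.
by rewrite (IH u ut z z') //; [exists T', f'|exists T, f].
Qed.

Lemma name_valueE G t x : name_value G t x ->
  forall z, z ∈ x <-> exists u p, [/\ p ∈ G, app t u p & name_value G u z].
Proof.
move=> [T [f [tT cT fT ftx Hf]]] z; rewrite (Hf _ _ tT ftx).
split=> -[u [p [pG up uz]]]; exists u, p; split=> //; have uT := cT _ _ _ tT up.
  by exists T, f.
have [z' [fz' _]] := fT _ uT.
by rewrite (name_value_unique uz (y := z')) //; exists T, f.
Qed.

Let value_step G f s y :=
  forall z, z ∈ y <-> exists u p, [/\ p ∈ G, app s u p & app f u z].

Lemma name_value_total G t : exists x, name_value G t x.
Proof.
have dS : defin (fun=> True) (fun v => value_step G (v 0) (v 1) (v 2)).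
  by rewrite /value_step; definability.
have [T [tT sT]] := ex_transitive hM t.
have [||f [[_ fT Hf] _]] := recursion hM dS _ _ tT.
- move=> f s fs.
  have [T0 [tT0 sT0]] := ex_transitive hM s.
  have [||y Hy] := @replacement _ hM (fun=> True)
    (fun u z => (exists p, p ∈ G /\ app s u p) /\ app f u z) T0.
  + by definability.
  + move=> u z z' _ [[p [_ up]] uz] [_ uz']; have [us _] := app_hereditary hM up.
    by have [z1 [_ Hz1]] := fs _ us; rewrite -(Hz1 z) // -(Hz1 z').
  have E z : z ∈ y <-> exists u p, [/\ p ∈ G, app s u p & app f u z].
    rewrite Hy; split=> [[u [_ [[p [pG up]] uz]]]|[u [p [pG up uz]]]].
      by exists u, p.
    exists u; split; last by split=> //; exists p.
    have [us _] := app_hereditary hM up; exact: hereditary_transitive us.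
  exists y; split=> // y' Hy'.
  by apply: (extensionality hM) => z; rewrite E Hy'.
- move=> f g s y fg H z; rewrite H; split=> -[u [p [pG up uz]]]; exists u, p;
    have [us _] := app_hereditary hM up; split=> //; exact/fg.
have [x [ftx _]] := fT _ sT; exists x, T, f; split=> //.
exact: transitive_name_closed.
Qed.

Lemma name_value_intro G t x :
  (forall z, z ∈ x <-> exists u p, [/\ p ∈ G, app t u p & name_value G u z]) ->
  name_value G t x.
Proof.
move=> H; have [y Hy] := name_value_total G t.
suff -> : x = y by [].
by apply: (extensionality hM) => z; rewrite H (name_valueE Hy).
Qed.

Lemma check_value one G : one ∈ G -> forall x t, check_name one x t -> name_value G t x.
Proof.
move=> oneG; apply: (@hereditary_induction _ hM (fun=> True)); first by definability.
move=> x IH t Ht; apply: name_value_intro => z; split=> [zx|].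
  have [u Hu] := check_name_total hM one z; exists u, one; split=> //.
    by apply/(check_name_app hM _ _ Ht); split=> //; exists z.
  by apply: IH Hu; apply: in_hereditary.
move=> [u [p [_ /(check_name_app hM _ _ Ht) [_ [v [vx Hv]]] uz]]].
have uv : name_value G u v by apply: IH Hv; apply: in_hereditary.
by rewrite (name_value_unique uz uv).
Qed.

End NameValues.

(** * A countable elementary class and a generic filter over it *)

Section Countable.

Fixpoint code (X : Type) (f : formula X) : (X -> nat) -> GenTree.tree nat :=
  match f with
  | FMem x y => fun c => GenTree.Node 0 [:: GenTree.Leaf (c x); GenTree.Leaf (c y)]
  | FEq x y => fun c => GenTree.Node 1 [:: GenTree.Leaf (c x); GenTree.Leaf (c y)]
  | FNot g => fun c => GenTree.Node 2 [:: code g c]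
  | FAnd g h => fun c => GenTree.Node 3 [:: code g c; code h c]
  | FAll g => fun c => GenTree.Node 4
      [:: code g (fun o => if o is Some x then (c x).+1 else 0)]
  end.

(** Formulas are countable: a bound variable takes the code zero and shifts the
    others, which keeps the coding of variables injective. *)
Lemma code_inj X (f g : formula X) (c : X -> nat) : injective c ->
  code f c = code g c -> f = g.
Proof.
elim: f g c => {X} [X x y|X x y|X f IH|X f1 IH1 f2 IH2|X f IH] [x' y'|x' y'|g|g1 g2|g] c ci //=.
- by case=> /ci -> /ci ->.
- by case=> /ci -> /ci ->.
- by case=> /(IH _ _ ci) ->.
- by case=> /(IH1 _ _ ci) -> /(IH2 _ _ ci) ->.
- case=> E; congr FAll; apply: IH E.
  by move=> [x|] [y|] //= [/ci ->].
Qed.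

Definition decode (n : nat) : formula nat :=
  epsilon (inhabits (FEq 0 0)) (fun f => pickle (code f id) = n).

Lemma decodeK f : decode (pickle (code f id)) = f.
Proof.
have := epsilon_spec (inhabits (FEq 0 0)) (fun g => pickle (code g id) = pickle (code f id))
  (ex_intro _ f erefl).
by move=> /(pcan_inj pickleK) E; apply: (@code_inj _ _ _ id) E.
Qed.

Variables (M : structure) (base : nat -> M).

Definition class_in (f : formula nat) (l : seq M) (x : M) : Prop :=
  sat f (nth (base 0) (x :: l)).

(** A Skolem hull of the parameters [base], countable because its elements are
    indexed by trees: a node is a formula and the children are its parameters. *)
Fixpoint hull (t : GenTree.tree nat) : M :=
  match t with
  | GenTree.Leaf k => base k
  | GenTree.Node n ts => epsilon (inhabits (base 0)) (class_in (decode n) (map hull ts))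
  end.

Definition in_hull (x : M) : Prop := exists t, x = hull t.

Lemma hull_seq l : (forall x, List.In x l -> in_hull x) -> exists ts, l = map hull ts.
Proof.
elim: l => [|x l IH] H; first by exists [::].
have [|ts ->] := IH; first by move=> y yl; apply: H; right.
have [|t ->] := H x; first by left.
by exists (t :: ts).
Qed.

Lemma hull_class K : defin in_hull (fun v => K (v 0)) ->
  exists n ts, forall x, K x <-> class_in (decode n) (map hull ts) x.
Proof.
move=> [n [f [e [De H]]]].
pose rho (s : nat + 'I_n) : nat := match s with inl _ => 0 | inr i => i.+1 end.
have [|ts Ets] := @hull_seq (map e (enum 'I_n)).
  by elim: (enum 'I_n) => [|i l IH] //= x [<-//|/IH].
exists (pickle (code (frename rho f) id)), ts => x.
rewrite -Ets /class_in decodeK sat_frename (H (fun=> x)).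
set e1 := with_params _ _; set e2 := fun s => _; suff -> : e1 = e2 by [].
apply: functional_extensionality; case=> [k|i] //.
by rewrite /e2 /= (nth_map i) ?nth_ord_enum // size_enum_ord.
Qed.

Lemma elementary_hull : elementary in_hull.
Proof.
move=> K /hull_class [n [ts HK]] [x /HK Kx].
exists (hull (GenTree.Node n ts)); split; first by exists (GenTree.Node n ts).
by apply/HK; apply: (epsilon_spec (inhabits (base 0))); exists x.
Qed.

Definition nth_class (k : nat) : M -> Prop :=
  if unpickle k is Some (n, ts) then class_in (decode n) (map hull ts) else fun=> False.

Lemma nth_class_surj K : defin in_hull (fun v => K (v 0)) ->
  exists k, forall x, K x <-> nth_class k x.
Proof.
move=> /hull_class [n [ts H]]; exists (pickle (n, ts)) => x.
by rewrite /nth_class pickleK.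
Qed.

Hypothesis hM : ZFC M.
Variables (X C L one p0 : M) (hP : poset X C L one) (p0C : p0 ∈ C).
Hypotheses (DL : in_hull L) (Dp0 : in_hull p0).

Definition improves (k : nat) (p r : M) : Prop :=
  [/\ in_hull r, app L r p & nth_class k r].

(** A descending sequence of conditions of the hull that enters, one after the
    other, all classes definable over the hull that it can enter. *)
Fixpoint descent (k : nat) : M :=
  if k is k'.+1 then
    match excluded_middle_informative (exists r, improves k' (descent k') r) with
    | left _ => epsilon (inhabits p0) (improves k' (descent k'))
    | right _ => descent k'
    end
  else p0.

Lemma descentP k : [/\ descent k ∈ C, in_hull (descent k) &
  app L (descent k.+1) (descent k)].
Proof.
have step j : descent j ∈ C -> in_hull (descent j) ->
    in_hull (descent j.+1) /\ app L (descent j.+1) (descent j).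
  move=> jC Dj /=.
  case: (excluded_middle_informative (exists r, improves j (descent j) r)) => [ex|_].
    by have [] := epsilon_spec (inhabits p0) (improves _ _) ex.
  by split=> //; apply: (le_refl hP).
have [kC Dk] : descent k ∈ C /\ in_hull (descent k).
  elim: k => [|k [kC Dk]] //; have [? /(le_field hM hP) []] := step k kC Dk.
  by [].
by have [] := step k kC Dk.
Qed.

Lemma descent_le j k : j <= k -> app L (descent k) (descent j).
Proof.
move=> /subnKC <-; elim: (k - j) => [|i IH].
  by rewrite addn0; apply: (le_refl hP); case: (descentP j).
by rewrite addnS; apply: (le_trans hP) IH; case: (descentP (j + i)).
Qed.

Definition descent_filter (p : M) : Prop := in_hull p /\ exists k, app L (descent k) p.

Lemma descent_generic : generic_over C L in_hull descent_filter.
Proof.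
split.
- by move=> p [Dp [k /(le_field hM hP) [_ pC]]].
- by move=> p q [_ [k kp]] pq Dq; split=> //; exists k; apply: (le_trans hP kp).
- move=> p q [Dp [j jp]] [Dq [k kq]]; exists (descent (maxn j k)).
  have [mC Dm _] := descentP (maxn j k); split.
  + by split=> //; exists (maxn j k); apply: (le_refl hP).
  + by apply: (le_trans hP _ jp); apply: descent_le; apply: leq_maxl.
  + by apply: (le_trans hP _ kq); apply: descent_le; apply: leq_maxr.
- move=> K dK dense; have [k Hk] := nth_class_surj dK.
  have [kC Dk _] := descentP k; have [r0 [r0k Kr0]] := dense _ kC.
  have [||r [Dr [rk Kr]]] := elementary_hull (K := fun r => app L r (descent k) /\ K r).
  + by definability.
  + by exists r0.
  have ex : exists r, improves k (descent k) r.
    by exists r; split=> //; apply/Hk.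
  exists (descent k.+1); have [sC Ds _] := descentP k.+1.
  split; first by split=> //; exists k.+1; apply: (le_refl hP).
  rewrite /=; case: (excluded_middle_informative (exists r, improves k (descent k) r)) => // ex'.
  by have [_ _ /Hk] := epsilon_spec (inhabits p0) (improves _ _) ex'.
Qed.

End Countable.

(** * The extension as a quotient of the names *)

Section Quotient.
Variables (M : structure) (hM : ZFC M) (X C L one : M) (hP : poset X C L one).
Variables (D G : M -> Prop).
Hypotheses (eD : elementary D) (gG : generic_over C L D G).
Local Notation name := (name_in C D).

Definition name_class (t s : M) : Prop := name s /\ exists p, G p /\ forces_eq C L p s t.

Definition quotient : structure := @MkStructure
  {c : M -> Prop | exists t, name t /\ c = name_class t}
  (fun c d => exists s t, [/\ name s, name t, sval c = name_class s,
     sval d = name_class t & exists p, G p /\ forces_mem C L p s t]).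

Lemma ex_name : exists t, name t.
Proof.
have [||t [Dt Ht]] := eD (K := fun t => forall u, ~ u ∈ t); first by definability.
  exact: ex_empty.
by exists t; split=> //; apply/(is_nameE hM) => z /Ht.
Qed.

Definition some_name (t : M) : M :=
  match excluded_middle_informative (name t) with
  | left _ => t
  | right _ => proj1_sig (constructive_indefinite_description _ ex_name)
  end.

Lemma some_nameP t : name (some_name t).
Proof.
rewrite /some_name; case: excluded_middle_informative => // _.
by case: constructive_indefinite_description.
Qed.

Definition quotient_val (t : M) : quotient :=
  exist _ (name_class (some_name t)) (ex_intro _ _ (conj (some_nameP t) erefl)).

Lemma quotient_valE t : name t -> sval (quotient_val t) = name_class t.
Proof. by move=> nt /=; rewrite /some_name; case: excluded_middle_informative. Qed.

Lemma name_class_eq s t : name s -> name t ->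
  name_class s = name_class t <-> exists p, G p /\ forces_eq C L p s t.
Proof.
move=> ns nt; split=> [E|[p [Gp st]]].
  have [p [Gp _]] : exists p, G p /\ p = p.
    apply: (go_dense gG (K := fun p => p = p)); first by definability.
    by move=> p pC; exists p; split=> //; apply: (le_refl hP).
  have : name_class s s.
    by split=> //; exists p; split=> //; apply: (forces_eq_refl hM hP); case: (go_sub gG Gp).
  by rewrite E => -[].
apply: functional_extensionality => u; apply: propositional_extensionality.
split=> -[nu [q [Gq Hq]]]; split=> //; have [r [Gr rp rq]] := go_directed gG Gp Gq;
  have [rC _] := go_sub gG Gr; exists r; split=> //.
  apply: (forces_eq_trans hM hP rC (forces_eq_mono hM hP rq Hq)).
  exact: (forces_eq_mono hM hP rp st).
apply: (forces_eq_trans hM hP rC (forces_eq_mono hM hP rq Hq)).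
exact/(forces_eq_sym hM hP rC)/(forces_eq_mono hM hP rp st).
Qed.

Lemma quotient_extension : extension C L D G quotient_val.
Proof.
have sig_eq (c d : quotient) : sval c = sval d -> c = d.
  case: c d => [c Hc] [d Hd] /= E; case: d / E Hd => Hd.
  by rewrite (proof_irrelevance _ Hc Hd).
split.
- move=> c; have [t [nt Et]] := proj2_sig c; exists t; split=> //.
  by apply: sig_eq; rewrite quotient_valE.
- move=> s t ns nt; rewrite -name_class_eq // -!quotient_valE //.
  by split=> [->|/sig_eq].
- move=> s t ns nt; split=> [[s' [t' [ns' nt']]]|H]; last first.
    by exists s, t; split=> //; apply: quotient_valE.
  rewrite !quotient_valE // => /(name_class_eq ns ns') [p [Gp Hp]].
  move=> /(name_class_eq nt nt') [q [Gq Hq]] [r [Gr Hr]].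
  have [r1 [Gr1 r1p r1q]] := go_directed gG Gp Gq.
  have [r2 [Gr2 r2r1 r2r]] := go_directed gG Gr1 Gr.
  have [rC _] := go_sub gG Gr2; exists r2; split=> //.
  have Es := forces_eq_mono hM hP (le_trans hP r2r1 r1p) Hp.
  have Et := forces_eq_mono hM hP (le_trans hP r2r1 r1q) Hq.
  apply: (forces_mem_eqr hM hP rC (forces_eq_sym hM hP rC Et)).
  apply: (forces_mem_eql hM hP rC (forces_eq_sym hM hP rC Es)).
  exact: (forces_mem_mono hP r2r).
Qed.

End Quotient.

(** * Satisfaction in grounds *)

Section InSomeGround.
Variables (gamma : formula (option unit)) (M : structure).

Lemma sat_in_class X (x r : X) (e : X -> M) :
  sat (in_class gamma x r) e <-> class_of gamma (e r) (e x).
Proof.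
rewrite sat_frename /class_of; set e1 := fun o => _; set e2 := scons _ _.
suff -> : e1 = e2 by [].
by apply: functional_extensionality; case.
Qed.

Lemma sub_val_inj (W : M -> Prop) (u v : sub W) : sval u = sval v -> u = v.
Proof.
case: u v => [u Wu] [v Wv] /= E; case: v / E Wv => Wv.
by rewrite (proof_irrelevance _ Wu Wv).
Qed.

(** The variable [r] of the parameter is kept apart from those of [f], since the
    parameter need not belong to the class that it defines. *)
Lemma sat_relativize (W : M -> Prop) Y X (f : formula Y) (rho : Y -> X) (r : X)
    (e : X -> M) (b : Y -> sub W) :
  (forall x, W x <-> class_of gamma (e r) x) -> (forall y, sval (b y) = e (rho y)) ->
  sat (relativize gamma r (frename rho f)) e <-> sat f b.
Proof.
elim: f X rho r e b => {Y} [Y x y|Y x y|Y g IH|Y g IHg h IHh|Y g IH] X rho r e b HW Hb /=.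
- by rewrite !Hb.
- by rewrite -!Hb; split=> [/sub_val_inj|->].
- by rewrite (IH _ _ _ _ b).
- by rewrite (IHg _ _ _ _ b) // (IHh _ _ _ _ b).
- have E (v : sub W) : sat (relativize gamma (Some r) (frename (omap rho) g)) (scons (sval v) e) <->
      sat g (scons v b).
    by apply: IH => //; case=> [y|] /=.
  split=> [H v|H x].
    apply/E; apply: NNPP => nH; apply: (H (sval v)); split=> //.
    by apply/sat_in_class => /=; apply/HW; case: v {nH}.
  move=> [/sat_in_class /= /HW Wx]; apply.
  exact: ((E (exist _ x Wx)).2 (H _)).
Qed.

Lemma sat_foldr X (I : eqType) (h : formula X) (g : I -> formula X) (l : seq I) e :
  sat (foldr (@FAnd _) h [seq g i | i <- l]) e <->
  sat h e /\ forall i, i \in l -> sat (g i) (e : X -> M).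
Proof.
elim: l => [|i l IH] /=; first by split=> [|[]].
rewrite IH; split=> [[Hi [Hh Hl]]|[Hh H]].
  by split=> // j; rewrite inE => /orP [/eqP -> //|/Hl].
by do 2?split=> //; [apply: H|move=> j jl; apply: H]; rewrite inE ?eqxx ?jl ?orbT.
Qed.

Lemma sat_in_some_ground n (f : formula 'I_n) (a : 'I_n -> M) :
  sat (in_some_ground gamma f) a <-> exists r, holds_in (class_of gamma r) f a.
Proof.
pose body := foldr (@FAnd _) (relativize gamma None (frename Some f))
  [seq in_class gamma (Some i) None | i <- enum 'I_n].
have E r : sat body (scons r a) <-> holds_in (class_of gamma r) f a.
  rewrite /body sat_foldr; split=> [[Hf Ha]|[b [Hb Hf]]].
    have Wa i : class_of gamma r (a i).
      by have /sat_in_class := Ha i (mem_enum _ i).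
    exists (fun i => exist _ (a i) (Wa i)); split=> //.
    by apply: (sat_relativize _ _ _).1 Hf.
  split; first by apply: (sat_relativize _ _ _).2 Hf.
  by move=> i _; apply/sat_in_class => /=; rewrite -Hb; case: (b i).
rewrite [sat _ _]/= -/body; split=> [H|[r /E Hr] H]; last exact: H Hr.
by apply: NNPP => H'; apply: H => r /E Hr; apply: H'; exists r.
Qed.

End InSomeGround.

Lemma holds_in_all (M : structure) n (f : formula 'I_n) (a : 'I_n -> M) :
  holds_in (fun=> True) f a <-> sat f a.
Proof.
have ik : isomorphism (fun x : sub (fun _ : M => True) => sval x : M).
  split=> [x y /sub_val_inj //|y|//]; by exists (exist _ y I).
split=> [[b [Hb /(sat_iso ik)]]|H].
  suff -> : (fun i => sval (b i)) = a by [].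
  exact: functional_extensionality.
by exists (fun i => exist _ (a i) I); split=> //; apply/(sat_iso ik).
Qed.

(** Under the trivial forcing every set is the value of its check name. *)
Lemma ground_all (M : structure) : ZFC M -> ground (fun _ : M => True).
Proof.
move=> hM; split.
  split=> //.
    exists 0, (FEq None None), (fun i : 'I_0 => False_rect M (notF (ltn_ord i))).
    by [].
  apply: (ZFC_iso (k := fun x : sub (fun _ : M => True) => sval x : M)) hM.
  split=> [x y /sub_val_inj //|y|//]; by exists (exist _ y I).
have [o _] := ex_empty hM.
pose C := upair hM o o; pose L := upair hM (kpair hM o o) (kpair hM o o).
have CE p : p ∈ C <-> p = o by rewrite in_upair; tauto.
have LE p q : app L p q <-> p = o /\ q = o.
  rewrite (app_kpairE hM) in_upair; split=> [[]/kpair_inj //|[-> ->]]; by left.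
have oC : o ∈ C by apply/CE.
exists (kpair hM C L), C, L, o, C; split=> //.
- split.
  + exact: opair_kpair.
  + move=> z; rewrite in_upair => H; exists o, o; split=> //; apply/opair_kpairE.
    by case: H.
  + by move=> p /CE ->; apply/LE.
  + by move=> p q /LE [-> ->].
  + by move=> p q r /LE [-> _] /LE [_ ->]; apply/LE.
  + by [].
  + by move=> p /CE ->; apply/LE.
- split=> //.
  + by exists o.
  + by move=> p q _ /LE [_ ->].
  + by move=> p q /CE -> /CE ->; exists o; split=> //; apply/LE.
  + by move=> E _ _ dense; have [q [qE /LE [Eq _]]] := dense _ oC; exists o; rewrite -{1}Eq.
- move=> x; have [t Ht] := check_name_total hM o x; exists t; split=> //.
    exact: (check_is_name hM oC Ht).
  exact: (check_value hM oC Ht).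
Qed.

(** * From the Inner Ground Hypothesis to the Recurrence Axiom *)

(** Otherwise some condition denies that a ground satisfies [f]. A generic extension
    of a countable elementary class by a filter through that condition satisfies
    [f] and has no ground satisfying it, but it is a model of ZFC and hence one
    of its own grounds. *)
Lemma forced_in_some_ground gamma (M : structure) (X : M) n (f : formula 'I_n) a :
  uniformly_defines_grounds gamma -> ZFC M ->
  forced X f a -> forced X (in_some_ground gamma f) a.
Proof.
move=> hgamma hM [C [L [one [t [hP Ht Hf]]]]].
exists C, L, one, t; split=> // p pC; apply: NNPP.
move=> /(not_forces hM hP pC) [q [qp Hq]].
have [qC _] := le_field hM hP qp.
pose params := [:: C; L; one; q] ++ map t (enum 'I_n).
pose D := in_hull (nth C params).
have D_base k : D (nth C params k) by exists (GenTree.Leaf k).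
have [DC DL D1 Dq] : [/\ D C, D L, D one & D q].
  by split; [apply: (D_base 0)|apply: (D_base 1)|apply: (D_base 2)|apply: (D_base 3)].
have Dt i : D (t i).
  have := D_base (4 + i); rewrite nth_cat /= addKn.
  by rewrite (nth_map i) ?size_enum_ord // nth_ord_enum.
have eD : elementary D := elementary_hull (base := nth C params).
have gG := descent_generic (base := nth C params) hM hP qC DL Dq.
set G := descent_filter _ _ _ in gG.
have Gq : G q by split=> //; exists 0; apply: (le_refl hP).
have hN := quotient_extension hM hP eD gG.
set N := quotient _ _ _ _ in hN; set val := @quotient_val _ _ _ _ _ _ _ in hN.
have nt i : name_in C D (t i) by split=> //; apply: check_is_name (Ht i) => //; case: hP.
have hN' : ZFC N := extension_ZFC hM hP DC DL D1 eD gG hN.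
have tr Y := truth hM hP DC DL eD gG hN (Y := Y).
have [_ /(_ _ (ground_all hN')) [r Hr]] := hgamma N hN'.
have : sat (in_some_ground gamma f) (fun i => val (t i)).
  apply/sat_in_some_ground; exists r.
  have -> : class_of gamma r = fun=> True.
    by apply: functional_extensionality => x; apply: propositional_extensionality; rewrite -Hr.
  by apply/holds_in_all/(tr _ _ _ nt); exists q; split=> //; apply: Hf.
move=> /(tr _ _ _ nt) [p' [Gp' Hp']].
have [s [_ sp' sq]] := go_directed gG Gp' Gq.
exact: (Hq s sq (forces_mono hM hP sp' Hp')).
Qed.

(** * Transitive classes *)

Lemma definable_defin (M : structure) (K : M -> Prop) :
  definable K -> defin (fun=> True) (fun v => K (v 0)).
Proof.
move=> [n [f [e H]]].
pose t (o : option 'I_n) (v : nat -> M) := if o is Some i then e i else v 0.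
apply: (@defin_ext _ _ _ (fun v => sat f (t^~ v))).
  move=> v; rewrite H; suff -> : t^~ v = scons (v 0) e by [].
  by apply: functional_extensionality; case.
by apply: defin_sat => -[i|]; [apply: (@term_cst _ _ (e i))|apply: term_var].
Qed.

Lemma defin_definable (M : structure) (D K : M -> Prop) :
  defin D (fun v => K (v 0)) -> definable K.
Proof.
move=> [n [f [e [_ H]]]].
pose rho (s : nat + 'I_n) := match s with inl _ => None | inr i => Some i end.
exists n, (frename rho f), e => x; rewrite sat_frename (H (fun=> x)).
suff -> : (fun s => scons x e (rho s)) = with_params (fun=> x) e by [].
by apply: functional_extensionality; case.
Qed.

Section Relativization.
Variables (V : structure) (W : V -> Prop).
Hypothesis dW : defin (fun=> True) (fun v => W (v 0)).

(** Only the quantifiers are relativized. The equivalence is restricted to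
    environments inside [W], since a formula may have infinitely many variables
    in its type and membership of them all in [W] need not be definable. *)
Lemma sat_sub_defin Y (f : formula Y) (t : Y -> (nat -> V) -> V) :
  (forall y, term (fun=> True) (t y)) ->
  exists K, defin (fun=> True) K /\ forall v (b : Y -> sub W),
    (forall y, sval (b y) = t y v) -> (K v <-> sat f b).
Proof.
elim: f t => {Y} [Y x y|Y x y|Y g IH|Y g IHg h IHh|Y g IH] t Ht.
- exists (fun v => t x v ∈ t y v); split; first exact: defin_mem.
  by move=> v b Hb /=; rewrite -!Hb.
- exists (fun v => t x v = t y v); split; first exact: defin_eq.
  by move=> v b Hb /=; rewrite -!Hb; split=> [/sub_val_inj|->].
- have [K [dK HK]] := IH t Ht; exists (fun v => ~ K v); split; first exact: defin_not.
  by move=> v b Hb /=; rewrite (HK v b).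
- have [K [dK HK]] := IHg t Ht; have [K' [dK' HK']] := IHh t Ht.
  exists (fun v => K v /\ K' v); split; first exact: defin_and.
  by move=> v b Hb /=; rewrite (HK v b) // (HK' v b).
- pose t' (o : option Y) (v : nat -> V) : V :=
    if o is Some y then t y (fun k => v k.+1) else v 0.
  have [|K [dK HK]] := IH t'.
    by case=> [y|]; [apply: term_shift|apply: term_var].
  exists (fun v => forall x, W x -> K (fun k => if k is k'.+1 then v k' else x)); split.
    apply: (@defin_all _ _ (fun v x => W x -> K (fun k => if k is k'.+1 then v k' else x))).
    apply: defin_imp => //.
    suff E (v : nat -> V) : (fun k => if k is k'.+1 then v k'.+1 else v 0) = v.
      by apply: (defin_ext _ dK) => v; rewrite E.
    by apply: functional_extensionality; case.
  move=> v b Hb /=.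
  have E (x : sub W) : K (fun k => if k is k'.+1 then v k' else sval x) <-> sat g (scons x b).
    by apply: HK; case=> [y|] //=.
  by split=> [H x|H x Wx]; [apply/E/H; case: x|exact: ((E (exist _ x Wx)).2 (H _))].
Qed.

Lemma defin_sub3 (D : sub W -> Prop) (K : sub W -> sub W -> sub W -> Prop) :
  defin D (fun v => K (v 0) (v 1) (v 2)) ->
  defin (fun=> True) (fun v => exists x y z : sub W,
    [/\ sval x = v 0, sval y = v 1, sval z = v 2 & K x y z]).
Proof.
move=> [n [f [e [_ H]]]].
pose t (s : nat + 'I_n) (v : nat -> V) :=
  match s with inl k => v (minn k 2) | inr i => sval (e i) end.
have [|K' [dK' HK']] := @sat_sub_defin _ f t.
  by case=> [k|i]; [apply: term_var|apply: (@term_cst _ _ (sval (e i)))].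
apply: (@defin_ext _ _ _ (fun v => [/\ W (v 0), W (v 1), W (v 2) & K' v])); last first.
  by definability.
have E v (x y z : sub W) : sval x = v 0 -> sval y = v 1 -> sval z = v 2 ->
    (K' v <-> K x y z).
  move=> Ex Ey Ez; pose b k := match k with 0 => x | 1 => y | _ => z end.
  rewrite (H b); apply: HK' => -[[|[|k]]|i] //.
move=> v; split=> [[x [y [z [Ex Ey Ez Kxyz]]]]|[Wx Wy Wz K'v]].
  by split; rewrite -?Ex -?Ey -?Ez; [case: x {Ex Kxyz}|case: y {Ey Kxyz}|case: z {Ez Kxyz}|apply/(E v x y z)].
by exists (exist _ _ Wx), (exist _ _ Wy), (exist _ _ Wz); split=> //; apply/(E v).
Qed.

Lemma defin_sub1 (D : sub W -> Prop) (K : sub W -> Prop) :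
  defin D (fun v => K (v 0)) ->
  defin (fun=> True) (fun v => exists x : sub W, sval x = v 0 /\ K x).
Proof.
move=> dK; have := @defin_sub3 D (fun x _ _ => K x) dK.
move=> /(@defin_subst _ _ _ (fun _ v => v 0)) H.
apply: defin_ext (H _) => [v|k]; last exact: term_var.
by split=> [[x [Ex Kx]]|[x [_ [_ [Ex _ _ Kx]]]]]; [exists x, x, x|exists x].
Qed.

End Relativization.

Section Absoluteness.
Variables (V : structure) (hV : ZFC V) (W : V -> Prop).
Hypothesis tW : forall x y, W x -> y ∈ x -> W y.
Hypothesis hW : ZFC (sub W).
Implicit Types x y z r s t C L X G T f : sub W.

Lemma sub_in (x : sub W) : W (sval x).
Proof. by case: x. Qed.

Lemma sub_lift x (w : V) : w ∈ sval x -> exists w' : sub W, w = sval w' /\ w' ∈ x.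
Proof. by move=> wx; exists (exist _ w (tW (sub_in x) wx)). Qed.

Lemma upair_sub x y : sval (upair hW x y) = upair hV (sval x) (sval y).
Proof.
apply: (extensionality hV) => w; rewrite in_upair; split.
  by move=> /sub_lift [w' [-> /in_upair [] ->]]; [left|right].
have H1 : x ∈ upair hW x y by apply/in_upair; left.
have H2 : y ∈ upair hW x y by apply/in_upair; right.
by case=> ->.
Qed.

Lemma kpair_sub x y : sval (kpair hW x y) = kpair hV (sval x) (sval y).
Proof. by rewrite /kpair !upair_sub. Qed.

Lemma opair_sub z x y : opair z x y <-> opair (sval z) (sval x) (sval y).
Proof.
rewrite (opair_kpairE hW) (opair_kpairE hV) -kpair_sub.
by split=> [->|/sub_val_inj].
Qed.

Lemma app_sub r x y : app r x y <-> app (sval r) (sval x) (sval y).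
Proof. by rewrite (app_kpairE hW) (app_kpairE hV) -kpair_sub. Qed.

Lemma opair_lift z (x y : V) : opair (sval z) x y ->
  exists x' y' : sub W, [/\ x = sval x', y = sval y' & opair z x' y'].
Proof.
move=> /(opair_kpairE hV) E.
have Wp : W (upair hV x y).
  by apply: tW (sub_in z) _; rewrite E in_upair; right.
have Wx : W x by apply: tW Wp _; rewrite in_upair; left.
have Wy : W y by apply: tW Wp _; rewrite in_upair; right.
exists (exist _ x Wx), (exist _ y Wy); split=> //.
by apply/opair_sub/(opair_kpairE hV).
Qed.

Lemma app_lift r (x y : V) : app (sval r) x y ->
  exists x' y' : sub W, [/\ x = sval x', y = sval y' & app r x' y'].
Proof.
move=> [z [zxy /sub_lift [z' [Ez z'r]]]]; rewrite {}Ez in zxy.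
have [x' [y' [-> -> H]]] := opair_lift zxy.
by exists x', y'; split=> //; exists z'.
Qed.

Lemma poset_sub X C L one :
  poset X C L one <-> poset (sval X) (sval C) (sval L) (sval one).
Proof.
split=> -[H1 H2 H3 H4 H5 H6 H7]; split=> //.
- exact/opair_sub.
- move=> z /sub_lift [z' [-> /H2 [p [q [pC qC zpq]]]]].
  by exists (sval p), (sval q); split=> //; apply/opair_sub.
- by move=> p /sub_lift [p' [-> /H3 /app_sub]].
- move=> p q /app_lift [p' [q' [-> -> pq]]] /app_sub qp.
  by rewrite (H4 _ _ pq qp).
- move=> p q r /app_lift [p' [q' [-> -> pq]]] /app_lift [q1 [r' [/sub_val_inj <- -> qr]]].
  exact/app_sub/(H5 _ _ _ pq qr).
- by move=> p /sub_lift [p' [-> /H7 /app_sub]].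
- exact/opair_sub.
- move=> z zL; have [p [q [pC qC /opair_lift [p' [q' [Ep Eq zpq]]]]]] := H2 _ zL.
  by exists p', q'; rewrite Ep in pC; rewrite Eq in qC.
- by move=> p pC; apply/app_sub/H3.
- by move=> p q /app_sub pq /app_sub qp; apply: sub_val_inj; apply: H4.
- by move=> p q r /app_sub pq /app_sub qr; apply/app_sub; apply: H5 qr.
- by move=> p pC; apply/app_sub/H7.
Qed.

Lemma is_name_up C t : is_name C t -> is_name (sval C) (sval t).
Proof.
move=> [T [tT HT]]; exists (sval T); split=> // s /sub_lift [s' [-> sT]] z.
move=> /sub_lift [z' [-> zs]]; have [u [p [uT pC zup]]] := HT _ sT _ zs.
by exists (sval u), (sval p); split=> //; apply/opair_sub.
Qed.

(** A witness for being a name need not belong to [W]; the recursive characterization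
    of names makes an induction possible instead. *)
Lemma is_name_down : defin (fun=> True) (fun v => W (v 0)) ->
  forall C t, is_name (sval C) (sval t) -> is_name C t.
Proof.
move=> dW C t.
pose Nm (x : V) := exists t : sub W, sval t = x /\ is_name C t.
have dn : defin (fun=> True) (fun v : nat -> V => Nm (v 0)).
  by apply: (@defin_sub1 _ _ dW (fun=> True)); definability.
pose K (x : V) := W x -> is_name (sval C) x -> Nm x.
have IK : forall x : V, K x.
  apply: (@hereditary_induction _ hV (fun=> True)).
    by rewrite /K; definability.
  move=> x IH Wx nx; exists (exist _ x Wx); split=> //.
  apply/(is_nameE hW) => z zx; have [u [p [nu pC zup]]] := (is_nameE hV _ _).1 nx (sval z) zx.
  have [u' [p' [Eu Ep zup']]] := opair_lift zup.
  have ux : hereditary_in u x.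
    have /(app_hereditary hV) [] // : app x u p by exists (sval z).
  have Wu : W u by rewrite Eu; apply: sub_in.
  have [u1 [Eu1 nu1]] := IH u ux Wu nu.
  exists u', p'; split=> //; last by rewrite Ep in pC.
  by rewrite -(sub_val_inj (etrans Eu1 Eu)).
move=> nt; have [t' [/sub_val_inj -> //]] := IK (sval t) (sub_in t) nt.
Qed.

Lemma function_on_up f T : function_on f T -> function_on (sval f) (sval T).
Proof.
move=> H x /sub_lift [x' [-> xT]]; have [y [fxy Hy]] := H _ xT.
exists (sval y); split; first exact/app_sub.
by move=> y' /app_lift [x1 [y1 [/sub_val_inj <- -> /Hy ->]]].
Qed.

Lemma name_value_up G t x : name_value G t x -> name_value (sval G) (sval t) (sval x).
Proof.
move=> [T [f [tT cT fT ftx Hf]]]; exists (sval T), (sval f); split=> //.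
- move=> s u p /sub_lift [s' [-> sT]] /app_lift [u' [p' [-> _ up]]].
  exact: (cT _ _ _ sT up).
- exact: function_on_up.
- exact/app_sub.
- move=> s y /sub_lift [s' [-> sT]] /app_lift [s1 [y' [/sub_val_inj <- -> fsy]]] z.
  split=> [/sub_lift [z' [-> /(Hf _ _ sT fsy) [u [p [pG up fuz]]]]]|].
    by exists (sval u), (sval p); split=> //; apply/app_sub.
  move=> [u [p [pG /app_lift [u' [p' [Eu Ep up]]]]]].
  rewrite Eu => /app_lift [u1 [z' [/sub_val_inj <- -> fuz]]].
  by apply: (Hf _ _ sT fsy z').2; exists u', p'; split=> //; rewrite Ep in pG.
Qed.

(** The recursion that evaluates a name can be carried out inside the model, and
    its result is right because values are unique. *)
Lemma name_value_closed G t (x : V) : name_value (sval G) (sval t) x ->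
  exists x' : sub W, x = sval x' /\ name_value G t x'.
Proof.
move=> H; have [x' Hx'] := name_value_total hW G t; exists x'; split=> //.
exact: (name_value_unique hV H (name_value_up Hx')).
Qed.

Lemma check_name_up (one x t : sub W) : check_name one x t ->
  check_name (sval one) (sval x) (sval t).
Proof.
move=> [T [f [xT tT fT fxt Hf]]]; exists (sval T), (sval f); split=> //.
- by move=> y z /sub_lift [y' [-> yT]] /sub_lift [z' [-> zy]]; apply: tT zy.
- exact: function_on_up.
- exact/app_sub.
- move=> y s /sub_lift [y' [-> yT]] /app_lift [y1 [s' [/sub_val_inj <- -> fys]]] z.
  split=> [/sub_lift [z' [-> /(Hf _ _ yT fys) [v [u [vy fvu zu]]]]]|].
    by exists (sval v), (sval u); split=> //; [apply/app_sub|apply/opair_sub].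
  move=> [v [u [/sub_lift [v' [-> vy]] /app_lift [v1 [u' [/sub_val_inj <- -> fvu]]] zu]]].
  have Ez : z = sval (kpair hW u' one) by rewrite kpair_sub; apply/(opair_kpairE hV).
  rewrite Ez; apply: (Hf _ _ yT fys _).2; exists v', u'; split=> //.
  exact: opair_kpair.
Qed.

Lemma ordinal_down x : Defs.ordinal (sval x) -> Defs.ordinal x.
Proof.
move=> [Tx Ty]; split; first by move=> y z yx zy; apply: (Tx (sval y)).
by move=> y yx z w zy wz; apply: (Ty (sval y) yx (sval z)).
Qed.

End Absoluteness.

(** * Generic extensions of inner models *)

Lemma elementary_all (M : structure) : elementary (fun _ : M => True).
Proof. by move=> K _ [x Kx]; exists x. Qed.

Section InnerExtension.
Variables (V : structure) (hV : ZFC V) (W : V -> Prop).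
Hypothesis dW : defin (fun=> True) (fun v => W (v 0)).
Hypothesis tW : forall x y, W x -> y ∈ x -> W y.
Hypothesis hW : ZFC (sub W).
Variables (X C L one : sub W) (hP : poset X C L one).
Variables (G : V) (gG : generic W (sval C) (sval L) G).

Definition in_filter (p : sub W) : Prop := sval p ∈ G.

Definition value_class (x : V) : Prop :=
  exists t : sub W, is_name C t /\ name_value G (sval t) x.

Lemma inner_generic : generic_over C L (fun=> True) in_filter.
Proof.
split.
- by move=> p /(generic_sub gG).
- by move=> p q Gp /(app_sub hV tW hW) pq _; apply: (generic_up gG) Gp pq.
- move=> p q Gp Gq; have [r [Gr rp rq]] := generic_directed gG Gp Gq.
  have [r' [_ [Er _ _]]] := app_lift hV tW hW rp; rewrite Er in Gr rp rq.
  by exists r'; split=> //; apply/(app_sub hV tW hW).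
- move=> K dK dense; have [E HE] := @separation _ hW _ K C dK.
  have [|p pE|p [pE pG]] := generic_dense gG (sub_in E).
  + by move=> p /(sub_lift tW) [p' [-> /HE []]].
  + have [p' [-> pC]] := sub_lift tW pE.
    have [q [qp Kq]] := dense _ pC; exists (sval q); split.
      by apply/HE; split=> //; case: (le_field hW hP qp).
    exact/(app_sub hV tW hW).
  + by have [p' [Ep /HE [pC Kp]]] := sub_lift tW pE; exists p'; rewrite /in_filter -Ep.
Qed.

Let eD := @elementary_all (sub W).
Let Q := quotient C L (fun=> True) in_filter.
Let valQ : sub W -> Q := @quotient_val _ hW C L (fun=> True) in_filter eD.
Let hQ : extension C L (fun=> True) in_filter valQ := quotient_extension hW hP eD inner_generic.

Let mem_valQ (x : Q) t : is_name C t -> x ∈ valQ t <->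
  exists u a, [/\ is_name C u, in_filter a, app t u a & x = valQ u].
Proof.
move=> nt; rewrite (mem_valE hW hP I I eD inner_generic hQ) //.
by split=> -[u [a [H1 H2 H3 H4]]]; exists u, a; split=> //; case: H1.
Qed.

Let valQ_ext s t : is_name C s -> is_name C t ->
  (forall u a, is_name C u -> in_filter a -> app s u a -> valQ u ∈ valQ t) ->
  (forall u a, is_name C u -> in_filter a -> app t u a -> valQ u ∈ valQ s) ->
  valQ s = valQ t.
Proof.
move=> ns nt Hs Ht; apply: (val_ext hW hP I I eD inner_generic hQ) => // u a [_ nu].
  exact: Hs.
exact: Ht.
Qed.

Lemma value_in (t : sub W) (x : V) : name_value G (sval t) x -> is_name C t ->
  forall z, z ∈ x <-> exists u a : sub W,
    [/\ is_name C u, in_filter a, app t u a & name_value G (sval u) z].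
Proof.
move=> Hx nt z; rewrite (name_valueE hV Hx).
split=> [[u [p [pG /(app_lift hV tW hW) [u' [p' [Eu Ep up]]] Hu]]]|[u [a [_ Ga ua Hu]]]].
  rewrite Ep in pG; rewrite Eu in Hu; exists u', p'; split=> //.
  by case: (is_name_app hW nt up).
by exists (sval u), (sval a); split=> //; apply/(app_sub hV tW hW).
Qed.

(** By induction on names: the values of the domains determine both sides in the same
    way. The induction takes place in [V], where the classes of the ground model
    remain definable. *)
Lemma value_eq (s t : sub W) a b : is_name C s -> is_name C t ->
  name_value G (sval s) a -> name_value G (sval t) b -> (a = b <-> valQ s = valQ t).
Proof.
pose Nm (x : V) := exists t : sub W, sval t = x /\ is_name C t.
have dNm : defin (fun=> True) (fun v : nat -> V => Nm (v 0)).
  by apply: (@defin_sub1 _ _ dW (fun=> True)); definability.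
pose R (p s t : V) := exists p' s' t' : sub W,
  [/\ sval p' = p, sval s' = s, sval t' = t & forces_eq C L p' s' t'].
have dR : defin (fun=> True) (fun v : nat -> V => R (v 0) (v 1) (v 2)).
  by apply: (@defin_sub3 _ _ dW (fun=> True)); definability.
have RE (s1 t1 : sub W) : is_name C s1 -> is_name C t1 ->
    valQ s1 = valQ t1 <-> exists p, p ∈ G /\ R p (sval s1) (sval t1).
  move=> ns nt; rewrite (ext_eq hQ) //; split=> [[p [Gp Hp]]|].
    by exists (sval p); split=> //; exists p, s1, t1.
  move=> [p [pG [p' [s' [t' [Ep /sub_val_inj -> /sub_val_inj -> H]]]]]].
  by exists p'; rewrite /in_filter Ep.
pose K (x : V) := Nm x -> forall y, Nm y -> forall a b, name_value G x a ->
  name_value G y b -> (a = b <-> exists p, p ∈ G /\ R p x y).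
suff HK : forall x, K x.
  move=> ns nt Ha Hb; rewrite RE //; apply: HK Ha Hb; first by exists s.
  by exists t.
apply: (@hereditary_induction _ hV (fun=> True)); first by rewrite /K; definability.
move=> x IH [{}s [Es ns]] y [{}t [Et nt]] {}a {}b Ha Hb.
rewrite -Es -Et in IH Ha Hb *; rewrite -RE //.
have IH' (u v p : sub W) c d : is_name C u -> is_name C v -> app s u p ->
    name_value G (sval u) c -> name_value G (sval v) d -> (c = d <-> valQ u = valQ v).
  move=> nu nv us Hc Hd; rewrite RE //; apply: IH Hc Hd.
  - by have /(app_hereditary hV) [] := (app_sub hV tW hW _ _ _).1 us.
  - by exists u.
  - by exists v.
have ex_val (u : sub W) := name_value_total hV G (sval u).
split=> [E|E].
  rewrite {}E in Ha; apply: valQ_ext => // [u p nu Gp us|v p nv Gp vt].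
    have [c Hc] := ex_val u.
    have /(value_in Hb nt) [v [q [nv Gq vt Hv]]] : c ∈ b.
      by apply/(value_in Ha ns); exists u, p.
    by apply/mem_valQ => //; exists v, q; split=> //; apply/(IH' _ _ _ _ _ nu nv us Hc Hv).
  have [d Hd] := ex_val v.
  have /(value_in Ha ns) [u [q [nu Gq us Hu]]] : d ∈ b.
    by apply/(value_in Hb nt); exists v, p.
  apply/mem_valQ => //; exists u, q; split=> //; symmetry.
  by apply/(IH' _ _ _ _ _ nu nv us Hu Hd).
apply: (extensionality hV) => z; rewrite (value_in Ha ns) (value_in Hb nt).
split=> -[u [p [nu Gp up Hu]]].
  have : valQ u ∈ valQ t by rewrite -E; apply/mem_valQ => //; exists u, p.
  move=> /(mem_valQ _ nt) [v [q [nv Gq vt Ev]]]; exists v, q; split=> //.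
  have [d Hd] := ex_val v.
  by rewrite ((IH' _ _ _ _ _ nu nv up Hu Hd).2 Ev).
have : valQ u ∈ valQ s by rewrite E; apply/mem_valQ => //; exists u, p.
move=> /(mem_valQ _ ns) [v [q [nv Gq vs Ev]]]; exists v, q; split=> //.
have [d Hd] := ex_val v.
by rewrite -((IH' _ _ _ _ _ nv nu vs Hd Hu).2 (esym Ev)).
Qed.

(** The truth lemma and the axioms of ZFC were obtained for structures that obey
    the forcing relation; this makes them available for actual values of names. *)
Theorem inner_extension (U : V -> Prop) : (forall x, U x <-> value_class x) ->
  exists val : sub W -> sub U, extension C L (fun=> True) in_filter val /\
    forall t, is_name C t -> name_value G (sval t) (sval (val t)).
Proof.
move=> HU.
have [t0 [_ nt0]] := ex_name hW C eD.
have total t : exists u : sub U, is_name C t -> name_value G (sval t) (sval u).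
  have [x0 Hx0] := name_value_total hV G (sval t0).
  have [x Hx] := name_value_total hV G (sval t).
  case: (classic (is_name C t)) => [nt|nnt].
    have Ux : U x by apply/HU; exists t.
    by exists (exist _ x Ux).
  have Ux : U x0 by apply/HU; exists t0.
  by exists (exist _ x0 Ux) => /nnt.
pose val t := proj1_sig (constructive_indefinite_description _ (total t)).
have valP t : is_name C t -> name_value G (sval t) (sval (val t)).
  by rewrite /val; case: constructive_indefinite_description.
exists val; split=> //.
have valE s t : is_name C s -> is_name C t -> (val s = val t <-> valQ s = valQ t).
  move=> ns nt; rewrite -(value_eq ns nt (valP _ ns) (valP _ nt)).
  by split=> [->|/sub_val_inj].
split.
- move=> x; have /HU [t [nt Ht]] := sub_in x; exists t; split=> //.
  by apply: sub_val_inj; apply: (name_value_unique hV Ht); apply: valP.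
- by move=> s t [_ ns] [_ nt]; rewrite valE // (ext_eq hQ).
- move=> s t [_ ns] [_ nt]; rewrite -(ext_mem hQ) // mem_valQ //=.
  rewrite (value_in (valP _ nt) nt).
  split=> -[u [a [nu Ga ua Hu]]]; exists u, a; split=> //.
    by apply/(value_eq ns nu (valP _ ns) Hu).
  by rewrite ((value_eq ns nu (valP _ ns) (valP _ nu)).2 Hu); apply: valP.
Qed.

Lemma value_class_transitive x y : value_class x -> y ∈ x -> value_class y.
Proof. by move=> [t [nt Ht]] /(value_in Ht nt) [u [a [nu _ _ Hu]]]; exists u. Qed.

Lemma value_class_ZFC : ZFC (sub value_class).
Proof.
have [|val [hN _]] := @inner_extension value_class; first by [].
exact: (extension_ZFC hW hP I I I eD inner_generic hN).
Qed.

Let oneG : sval one ∈ G.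
Proof. exact: (G_one hP I inner_generic). Qed.

(** Every set of the ground model is the value of its check name. *)
Lemma ground_sub_values (x : sub W) : value_class (sval x).
Proof.
have [t Ht] := check_name_total hW one x; exists t.
split; first exact: (check_is_name hW (poset_one hP) Ht).
exact: (check_value hV oneG (check_name_up hV tW hW Ht)).
Qed.

(** The canonical name of the generic filter. *)
Lemma filter_in_values : value_class G.
Proof.
have [||t Ht] := @replacement _ hW (fun=> True)
  (fun p z => exists u, check_name one p u /\ opair z u p) C.
- by definability.
- move=> p z z' _ [u [Hu /(opair_kpairE hW) ->]] [u' [Hu' /(opair_kpairE hW) ->]].
  by rewrite (check_name_unique hW Hu Hu').
have in_t u p : app t u p <-> p ∈ C /\ check_name one p u.
  split=> [[z [zup /Ht [p' [pC [u' [Hu zup']]]]]]|[pC Hu]].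
    by have [-> ->] := opair_inj hW zup zup'.
  exists (kpair hW u p); split; first exact: opair_kpair.
  by apply/Ht; exists p; split=> //; exists u; split=> //; apply: opair_kpair.
have nt : is_name C t.
  apply/(is_nameE hW) => z /Ht [p [pC [u [Hu zup]]]]; exists u, p; split=> //.
  exact: (check_is_name hW (poset_one hP) Hu).
exists t; split=> //; apply: (name_value_intro hV) => z.
have value u p : check_name one p u -> name_value G (sval u) (sval p).
  by move=> Hu; apply: (check_value hV oneG (check_name_up hV tW hW Hu)).
split=> [zG|[u [p [pG /(app_lift hV tW hW) [u' [p' [Eu Ep /in_t [pC Hu]]]] Hz]]]].
  have [p [Ep pC]] := sub_lift tW (generic_sub gG zG); rewrite Ep in zG *.
  have [u Hu] := check_name_total hW one p.
  exists (sval u), (sval p); split=> //; last exact: value.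
  by apply/(app_sub hV tW hW)/in_t.
rewrite Eu in Hz; rewrite (name_value_unique hV Hz (value _ _ Hu)).
by rewrite -Ep.
Qed.

End InnerExtension.

(** * A ground of a ground is a ground *)

(** Down-sets turn any relation into a genuine partial order, without a passage to
    equivalence classes; [S] is added to have a greatest element. *)
Lemma downset_poset (M : structure) (hM : ZFC M) (S E : M) :
  exists R L, [/\ poset (kpair hM R L) R L S,
    forall d, d ∈ R <-> d = S \/
      exists z, z ∈ S /\ forall w, w ∈ d <-> w ∈ S /\ app E w z &
    forall d d', app L d d' <-> [/\ d ∈ R, d' ∈ R & forall w, w ∈ d -> w ∈ d']].
Proof.
have [|R HR] := @separation _ hM (fun=> True) (fun d => d = S \/
    exists z, z ∈ S /\ forall w, w ∈ d <-> w ∈ S /\ app E w z) (power hM S).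
  by definability.
have [|L [HL LE]] := @relation_separation _ hM (fun=> True)
    (fun d d' => forall w, w ∈ d -> w ∈ d') R R.
  by definability.
have RE d : d ∈ R <-> d = S \/ exists z, z ∈ S /\ forall w, w ∈ d <-> w ∈ S /\ app E w z.
  rewrite HR; split=> [[]//|H]; split=> //; apply/in_power => w.
  by case: H => [->|[z [_ Hz]]] // /Hz [].
have RS d : d ∈ R -> forall w, w ∈ d -> w ∈ S by move=> /HR [/in_power].
have SR : S ∈ R by apply/RE; left.
exists R, L; split=> //; split=> //.
- exact: opair_kpair.
- by move=> d dR; apply/LE.
- move=> d d' /LE [_ _ H] /LE [_ _ H'].
  by apply: (extensionality hM) => w; split; [apply: H|apply: H'].
- by move=> d1 d2 d3 /LE [d1R d2R H] /LE [_ d3R H']; apply/LE; split=> // w /H /H'.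
- by move=> d dR; apply/LE; split=> //; apply: RS.
Qed.

Section TwoStep.
Variables (V : structure) (hV : ZFC V) (M W : V -> Prop).
Hypotheses (dM : defin (fun=> True) (fun v => M (v 0)))
  (tM : forall x y, M x -> y ∈ x -> M y) (hM : ZFC (sub M)).
Hypotheses (tW : forall x y, W x -> y ∈ x -> W y) (hW : ZFC (sub W)).
Hypothesis MW : forall x, M x -> W x.
Variables (X C L one : sub M) (hP : poset X C L one).
Variables (G : sub W) (gG : generic M (sval C) (sval L) (sval G)).
Hypothesis cover_G : forall x, W x ->
  exists t, [/\ M t, is_name (sval C) t & name_value (sval G) t x].
Variables (XQ CQ LQ oneQ : sub W) (hQ : poset XQ CQ LQ oneQ).
Variables (H : V) (gH : generic W (sval CQ) (sval LQ) H).
Hypothesis cover_H : forall x, exists t, W t /\ name_value H t x.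

Let in_G := in_filter (W := M) (sval G).

(** A name in the ground model is evaluated in [W], which contains the filter and
    satisfies ZFC. *)
Lemma two_step_values x : W x <-> value_class C (sval G) x.
Proof.
split=> [Wx|[t [_ Ht]]].
  have [t [Mt nt Ht]] := cover_G Wx; exists (exist _ t Mt); split=> //.
  exact: (is_name_down hV tM hM dM).
have [x' [-> _]] := name_value_closed hV tW hW (t := exist _ _ (MW (sub_in t))) Ht.
exact: sub_in.
Qed.

(** [Frc x q p] stands for p ⊩ x ≤ q in the second poset, whose order has a name
    in the ground model; the iteration uses it through the properties listed,
    whatever formula expresses the order. *)
Lemma two_step_forcing : exists (val : sub M -> sub W) (T c : sub M)
    (Frc : sub M -> sub M -> sub M -> Prop),
  [/\ [/\ extension C L (fun=> True) in_G val,
       forall t, is_name C t -> name_value (sval G) (sval t) (sval (val t)),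
       transitive_set T, c ∈ T & is_name C c /\ val c = CQ],
      defin (fun=> True) (fun v => Frc (v 0) (v 1) (v 2)),
      forall x q, is_name C x -> is_name C q ->
        app LQ (val x) (val q) <-> exists p, in_G p /\ Frc x q p,
      forall x q p r, app L r p -> Frc x q p -> Frc x q r &
      forall x q p, p ∈ C -> ~ Frc x q p ->
        exists r, app L r p /\ forall s, app L s r -> ~ Frc x q s].
Proof.
have [val [hN valP]] := inner_extension hV dM tM hM hP gG two_step_values.
have gen := inner_generic hV tM hM hP gG.
have [c [[_ nc] Ec]] := ext_surj hN CQ; have [l [[_ nl] El]] := ext_surj hN LQ.
have [T [tT cT]] := ex_transitive hM c.
have [n [f [e [De Hf]]]] : defin (fun _ : sub W => False) (fun v => app (v 0) (v 1) (v 2)).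
  by definability.
pose env (x q : sub M) (s : nat + 'I_n) : sub M :=
  match s with inl 0 => l | inl 1 => x | inl _ => q | inr _ => l end.
exists val, T, c, (fun x q p => forces C L f (env x q) p); split=> //.
- pose t (s : nat + 'I_n) (v : nat -> sub M) : sub M :=
    match s with inl 0 => l | inl 1 => v 0 | inl _ => v 1 | inr _ => l end.
  apply: (@defin_ext _ _ _ (fun v => forces C L f (t^~ v) (v 2))).
    move=> v; suff -> : t^~ v = env (v 0) (v 1) by [].
    by apply: functional_extensionality; case=> [[|[]]|].
  apply: defin_forces => //; last exact: term_var.
  case=> [[|[|k]]|i]; try exact: term_var; exact: (@term_cst _ _ l).
- move=> x q nx nq; rewrite -(truth hM hP I I (@elementary_all _) gen hN); last first.
    by case=> [[|[]]|] //=.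
  rewrite El.
  pose v k := match k with 0 => val l | 1 => val x | _ => val q end.
  rewrite (_ : (fun s => val (env x q s)) = with_params v e); first by rewrite -(Hf v).
  by apply: functional_extensionality; case=> [[|[]]|i] //; case: (De i).
- by move=> x q p r; apply: (forces_mono hM hP).
- by move=> x q p pC /(not_forces hM hP pC).
Qed.

Section Iteration.
#[local] Unset Implicit Arguments.
Variables (val : sub M -> sub W) (T c : sub M) (Frc : sub M -> sub M -> sub M -> Prop).
Hypotheses (hN : extension C L (fun=> True) in_G val)
  (valP : forall t, is_name C t -> name_value (sval G) (sval t) (sval (val t)))
  (tT : transitive_set T) (cT : c ∈ T) (nc : is_name C c) (Ec : val c = CQ)
  (dFrc : defin (fun=> True) (fun v => Frc (v 0) (v 1) (v 2)))
  (Frc_truth : forall x q, is_name C x -> is_name C q ->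
     app LQ (val x) (val q) <-> exists p, in_G p /\ Frc x q p)
  (Frc_mono : forall x q p r, app L r p -> Frc x q p -> Frc x q r)
  (Frc_not : forall x q p, p ∈ C -> ~ Frc x q p ->
     exists r, app L r p /\ forall s, app L s r -> ~ Frc x q s).

Let gen := inner_generic hV tM hM hP gG.
Let eD := @elementary_all (sub M).
Let mem_val := mem_valE hM hP I I eD gen hN.

(** This amounts to [p] forcing that every element of the second poset below [q]
    is below [q']. *)
Definition below p q q' := forall x, is_name C x -> forall r, app L r p -> Frc x q r -> Frc x q' r.

Let dbelow : defin (fun=> True) (fun v => below (v 0) (v 1) (v 2)).
Proof. by rewrite /below; definability. Qed.

Lemma below_mono r p q q' : app L r p -> below p q q' -> below r q q'.
Proof. by move=> rp Hb x nx s sr; apply: Hb => //; apply: (le_trans hP sr). Qed.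

Lemma below_val p q q' : in_G p -> is_name C q -> is_name C q' -> below p q q' ->
    forall x, app LQ x (val q) -> app LQ x (val q').
Proof.
move=> Gp nq nq' Hb x; have [u [[_ nu] ->]] := ext_surj hN x.
move=> /(Frc_truth _ _ nu nq) [r [Gr Hr]].
have [s [Gs sp sr]] := go_directed gen Gp Gr.
by apply/Frc_truth => //; exists s; split=> //; apply: Hb => //; apply: Frc_mono Hr.
Qed.

(** By density: a condition that does not force the inclusion extends to one that
    forces some [x] below [q] and refutes that it is below [q']. *)
Lemma val_below q q' : is_name C q -> is_name C q' ->
    (forall x, app LQ x (val q) -> app LQ x (val q')) -> exists p, in_G p /\ below p q q'.
Proof.
move=> nq nq' Hb.
have [||p [Gp [Hp|[x [nx Hx nHx]]]]] := go_dense gen (K := fun p => below p q q' \/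
  exists x, [/\ is_name C x, Frc x q p & forall s, app L s p -> ~ Frc x q' s]).
- by definability.
- move=> p pC; case: (classic (below p q q')) => [Hp|nHp].
    by exists p; split; [apply: (le_refl hP)|left].
  have [x [r [nx rp Hr nHr]]] : exists x r,
      [/\ is_name C x, app L r p, Frc x q r & ~ Frc x q' r].
    apply: NNPP => H'; apply: nHp => x nx r rp Hr; apply: NNPP => nHr.
    by apply: H'; exists x, r.
  have [rC _] := le_field hM hP rp; have [s [sr Hs]] := Frc_not _ _ _ rC nHr.
  exists s; split; first exact: (le_trans hP sr).
  by right; exists x; split=> //; apply: Frc_mono Hr.
- by exists p.
have /Hb /(Frc_truth _ _ nx nq') [r [Gr Hr]] : app LQ (val x) (val q).
  by apply/Frc_truth => //; exists p.
have [s [_ sp sr]] := go_directed gen Gp Gr.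
by case: (nHx s sp); apply: Frc_mono Hr.
Qed.

(** [conds] is a preorder of pairs (p, q), where [p] forces the name [q] to be in
    the second poset. That a pair is below another compares the down-sets of the
    second components instead of the components themselves: this makes it
    reflexive and transitive by pure logic, at every condition. *)
Variables conds prec : sub M.
Hypotheses (condsP : forall z, z ∈ conds -> exists p q, [/\ p ∈ C, q ∈ T & opair z p q])
  (condsE : forall p q, app conds p q <->
     [/\ p ∈ C, q ∈ T & is_name C q /\ forces_mem C L p q c])
  (precP : forall z z', app prec z z' <-> [/\ z ∈ conds, z' ∈ conds & exists p q p' q',
    [/\ opair z p q, opair z' p' q', app L p p' & below p q q']]).

Lemma mem_conds p q : kpair hM p q ∈ conds <-> app conds p q.
Proof. by rewrite (app_kpairE hM). Qed.

Lemma conds_inv z : z ∈ conds -> exists p q, z = kpair hM p q /\ app conds p q.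
Proof.
move=> zS; have [p [q [_ _ /(opair_kpairE hM) Ez]]] := condsP _ zS.
by exists p, q; rewrite -mem_conds -Ez.
Qed.

Lemma precE p q p' q' : app conds p q -> app conds p' q' ->
    app prec (kpair hM p q) (kpair hM p' q') <-> app L p p' /\ below p q q'.
Proof.
move=> Spq Spq'; rewrite precP; split=> [[_ _]|[pp' Hb]].
  move=> [p1 [q1 [p2 [q2 [/(opair_kpairE hM) E1 /(opair_kpairE hM) E2 pp' Hb]]]]].
  by have [-> ->] := kpair_inj E1; have [-> ->] := kpair_inj E2.
split; [exact/mem_conds|exact/mem_conds|exists p, q, p', q'; split=> //]; exact: opair_kpair.
Qed.

Lemma prec_refl z : z ∈ conds -> app prec z z.
Proof.
move=> /conds_inv [p [q [-> Spq]]]; apply/precE => //.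
by have /condsE [pC _ _] := Spq; split=> //; apply: (le_refl hP).
Qed.

Lemma prec_field z z' : app prec z z' -> z ∈ conds /\ z' ∈ conds.
Proof. by move=> /precP []. Qed.

Lemma prec_trans z1 z2 z3 : app prec z1 z2 -> app prec z2 z3 -> app prec z1 z3.
Proof.
move=> E12 E23; have [/conds_inv [p1 [q1 [Ez1 S1]]] /conds_inv [p2 [q2 [Ez2 S2]]]] := prec_field _ _ E12.
have [_ /conds_inv [p3 [q3 [Ez3 S3]]]] := prec_field _ _ E23.
rewrite Ez1 Ez2 Ez3 in E12 E23 *.
have [p12 b12] := (precE _ _ _ _ S1 S2).1 E12; have [p23 b23] := (precE _ _ _ _ S2 S3).1 E23.
apply/precE => //; split; first exact: (le_trans hP p12).
move=> x nx r rp1 Hr; apply: b23 => //; first exact: (le_trans hP rp1).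
exact: b12.
Qed.

Definition generic_pair (z : V) : Prop := exists p q x,
  [/\ opair z p q, p ∈ sval G, name_value (sval G) q x & x ∈ H].

Let dgeneric_pair : defin (fun=> True) (fun v : nat -> V => generic_pair (v 0)).
Proof. by rewrite /generic_pair; definability. Qed.

Lemma generic_pairE p q : is_name C q ->
    generic_pair (sval (kpair hM p q)) <-> in_G p /\ sval (val q) ∈ H.
Proof.
move=> nq; split=> [[p' [q' [x [Ez pG Hx xH]]]]|[Gp qH]].
  have [Ep Eq] := opair_inj hV Ez ((opair_sub hV tM hM _ _ _).1 (opair_kpair hM p q)).
  rewrite {}Ep in pG; rewrite {}Eq in Hx.
  by rewrite (name_value_unique hV (valP _ nq) Hx).
exists (sval p), (sval q), (sval (val q)); split=> //; last exact: valP.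
exact/(opair_sub hV tM hM)/opair_kpair.
Qed.

Lemma conds_val p q : app conds p q -> in_G p -> val q ∈ CQ.
Proof.
move=> /condsE [_ _ [nq Hpq]] Gp; rewrite -Ec; apply/(ext_mem hN) => //.
by exists p.
Qed.

Lemma cover_CQ h : h ∈ CQ -> exists p q, [/\ app conds p q, in_G p & h = val q].
Proof.
rewrite -Ec => /(mem_val _ _ (conj I nc)) [q [a [[_ nq] Ga qa Eh]]].
exists a, q; split=> //; apply/condsE; have [aC _] := go_sub gen Ga; split=> //.
  have [qc _] := app_hereditary hM qa; exact: hereditary_transitive qc.
by split=> //; apply: (forces_mem_app hM hP _ qa); apply: (le_refl hP).
Qed.

Lemma conds_mono p p' q : app L p' p -> app conds p q -> app conds p' q.
Proof.
move=> p'p /condsE [_ qT [nq Hq]]; apply/condsE; split=> //; first by case: (le_field hM hP p'p).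
by split=> //; apply: (forces_mem_mono hP p'p).
Qed.

Lemma conds_name p q : app conds p q -> is_name C q.
Proof. by move=> /condsE [_ _ []]. Qed.

Lemma generic_pair_up z z' : app prec z z' -> generic_pair (sval z) -> generic_pair (sval z').
Proof.
move=> Ezz'; have [/conds_inv [p [q [Ez Spq]]] /conds_inv [p' [q' [Ez' Spq']]]] := prec_field _ _ Ezz'.
rewrite {}Ez {}Ez' in Ezz' *; have [pp' Hb] := (precE _ _ _ _ Spq Spq').1 Ezz'.
have [nq nq'] := (conds_name _ _ Spq, conds_name _ _ Spq').
rewrite (generic_pairE _ _ nq) (generic_pairE _ _ nq') => -[Gp qH].
split; first exact: (go_up gen Gp pp').
have qCQ := conds_val _ _ Spq Gp.
apply: (generic_up gH qH); apply/(app_sub hV tW hW).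
by apply: (below_val _ _ _ Gp nq nq' Hb); apply: (poset_refl hQ).
Qed.

Lemma generic_pair_directed z z' :
    z ∈ conds -> z' ∈ conds -> generic_pair (sval z) -> generic_pair (sval z') ->
    exists w, [/\ generic_pair (sval w), app prec w z & app prec w z'].
Proof.
move=> /conds_inv [p [q [-> Spq]]] /conds_inv [p' [q' [-> Spq']]].
have [nq nq'] := (conds_name _ _ Spq, conds_name _ _ Spq').
rewrite (generic_pairE _ _ nq) (generic_pairE _ _ nq') => -[Gp qH] [Gp' qH'].
have [h0 [hH hq hq']] := generic_directed gH qH qH'.
have [h [_ [Eh _ _]]] := app_lift hV tW hW hq.
rewrite {}Eh in hH hq hq'.
have hCQ : h ∈ CQ by apply: generic_sub gH _ hH.
have [p1 [u [S1 G1 Eu]]] := cover_CQ _ hCQ; have nu := conds_name _ _ S1.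
have below_h (y : sub W) : app (sval LQ) (sval h) (sval y) ->
    forall x, app LQ x (val u) -> app LQ x y.
  rewrite -Eu => /(app_sub hV tW hW) hy x xh; exact: (poset_trans hQ xh hy).
have [p2 [G2 b2]] := val_below _ _ nu nq (below_h _ hq).
have [p3 [G3 b3]] := val_below _ _ nu nq' (below_h _ hq').
have [r1 [Gr1 r1p r1p']] := go_directed gen Gp Gp'.
have [r2 [Gr2 r2r1 r2p1]] := go_directed gen Gr1 G1.
have [r3 [Gr3 r3r2 r3p2]] := go_directed gen Gr2 G2.
have [r4 [Gr4 r4r3 r4p3]] := go_directed gen Gr3 G3.
have r4r2 := le_trans hP r4r3 r3r2; have r4r1 := le_trans hP r4r2 r2r1.
have Su := conds_mono _ _ _ (le_trans hP r4r2 r2p1) S1.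
exists (kpair hM r4 u); split.
- by apply/generic_pairE => //; rewrite -Eu.
- apply/precE => //; split; first exact: (le_trans hP r4r1).
  by apply: below_mono b2; apply: (le_trans hP r4r3).
- apply/precE => //; split; first exact: (le_trans hP r4r1).
  exact: below_mono b3.
Qed.

(** The second components [q] of the pairs in [D] with first component in the first
    filter have values that form a dense subset of the second poset, by
    genericity of the first filter; this subset lies in the first extension, so
    the second filter meets it. *)
Lemma generic_pair_dense D : (forall z, z ∈ conds -> exists w, w ∈ D /\ app prec w z) ->
    exists z, [/\ z ∈ D, z ∈ conds & generic_pair (sval z)].
Proof.
move=> dense; pose up (x : sub M) : sub W := exist _ (sval x) (MW (sub_in x)).
have [|B HB] := @separation _ hW (fun=> True) (fun x => exists p q z,
    [/\ p ∈ G, z ∈ up D, z ∈ up conds, opair z p q & name_value G q x]) CQ.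
  by definability.
have BE (x : sub W) : x ∈ B <-> exists p q,
    [/\ in_G p, app conds p q, kpair hM p q ∈ D & x = val q].
  rewrite HB; split=> [[_ [p [q [z [pG zD zS zpq Hx]]]]]|[p [q [Gp Spq zD Ex]]]].
    have [z' [Ez z'D]] : exists z' : sub M, sval z = sval z' /\ z' ∈ D.
      exact: (sub_lift tM (x := D) zD).
    have z'S : z' ∈ conds by move: zS; change (sval z ∈ sval conds -> z' ∈ conds); rewrite Ez.
    have [p' [q' [Ez' Spq]]] := conds_inv _ z'S.
    have := (opair_sub hV tW hW _ _ _).1 zpq; rewrite Ez Ez' => zpq'.
    have [Ep Eq] := opair_inj hV zpq' ((opair_sub hV tM hM _ _ _).1 (opair_kpair hM p' q')).
    exists p', q'; split=> //.
    - by rewrite /in_G /in_filter -Ep.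
    - by rewrite -Ez'.
    - apply: sub_val_inj; apply: (name_value_unique hV (name_value_up hV tW hW Hx)).
      by rewrite Eq; apply: valP (conds_name _ _ Spq).
  have nq := conds_name _ _ Spq; split; first by rewrite Ex; apply: conds_val Spq Gp.
  exists (up p), (up q), (up (kpair hM p q)); split=> //.
  - exact/mem_conds.
  - apply/(opair_sub hV tW hW); apply: (opair_sub hV tM hM _ _ _).1.
    exact: opair_kpair.
  - have [x' [Ex' Hx']] := name_value_closed hV tW hW (G := G) (t := up q) (valP _ nq).
    by rewrite Ex (sub_val_inj Ex').
have [| |x [xB xH]] := generic_dense gH (sub_in B).
- by move=> x /(sub_lift tW) [x' [-> /HB []]].
- move=> y /(sub_lift tW) [y' [-> yCQ]].
  have [p [q [Spq Gp Ey]]] := cover_CQ _ yCQ; have nq := conds_name _ _ Spq.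
  have [||p' [Gp' p'p [q' [Sp' p'D Hb]]]] := generic_dense_below hP I gen
    (K := fun p' => exists q', [/\ app conds p' q', kpair hM p' q' ∈ D & below p' q' q]) _ Gp.
  + apply: (@defin_ext _ _ _ (fun v => exists q', [/\ app conds (v 0) q',
      exists z, opair z (v 0) q' /\ z ∈ D & below (v 0) q' q])); last by definability.
    move=> v; split=> -[q' [Sq' Dq' Hb]]; exists q'; split=> //.
      by exists (kpair hM (v 0) q'); split=> //; apply: opair_kpair.
    by case: Dq' => z [/(opair_kpairE hM) <-].
  + move=> r rp; have Sr := conds_mono _ _ _ rp Spq.
    have [w [wD Ew]] := dense _ ((mem_conds _ _).2 Sr).
    have [/conds_inv [p' [q' [Ewz Sp']]] _] := prec_field _ _ Ew; rewrite {}Ewz in wD Ew.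
    have [p'r Hb] := (precE _ _ _ _ Sp' Sr).1 Ew.
    by exists p'; split=> //; exists q'.
  have nq' := conds_name _ _ Sp'; exists (sval (val q')); split.
    by apply/BE; exists p', q'.
  apply/(app_sub hV tW hW); rewrite Ey; apply: (below_val _ _ _ Gp' nq' nq Hb).
  by apply: (poset_refl hQ); apply: conds_val Sp' Gp'.
have [x' [Ex /BE [p [q [Gp Spq zD Ex']]]]] := sub_lift tW xB.
exists (kpair hM p q); split=> //; first exact/mem_conds.
by apply/generic_pairE; [apply: conds_name Spq|rewrite -Ex' -Ex].
Qed.

Variables R LR : sub M.
Hypotheses (hR : poset (kpair hM R LR) R LR conds)
  (downsetsE : forall d, d ∈ R <-> d = conds \/
     exists z, z ∈ conds /\ forall w, w ∈ d <-> w ∈ conds /\ app prec w z)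
  (inclusionE : forall d d', app LR d d' <-> [/\ d ∈ R, d' ∈ R & forall w, w ∈ d -> w ∈ d']).

Lemma ex_downset z : z ∈ conds ->
  exists d, d ∈ R /\ forall w, w ∈ d <-> w ∈ conds /\ app prec w z.
Proof.
move=> zS; have [|d Hd] := @separation _ hM (fun=> True) (fun w => app prec w z) conds.
  by definability.
by exists d; split=> //; apply/downsetsE; right; exists z.
Qed.

Variable K : V.
Hypothesis HK : forall d, d ∈ K <-> d ∈ sval R /\ exists z, z ∈ d /\ generic_pair z.

Lemma KE (d : sub M) : sval d ∈ K <-> d ∈ R /\ exists z, z ∈ d /\ generic_pair (sval z).
Proof.
rewrite HK; split=> -[dR [z [zd Kz]]]; split=> //; last by exists (sval z).
by have [z' [Ez z'd]] := sub_lift tM zd; exists z'; rewrite -Ez.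
Qed.

Lemma K_lift (d : V) : d ∈ K -> exists d' : sub M, d = sval d'.
Proof. by move=> /HK [/(sub_lift tM) [d' [-> _]] _]; exists d'. Qed.

Lemma downsets_sub d : d ∈ R -> forall w, w ∈ d -> w ∈ conds.
Proof. by move=> /downsetsE [->|[z [_ Hz]]] // w /Hz []. Qed.

Lemma iteration_generic : generic M (sval R) (sval LR) K.
Proof.
split.
- by move=> d /HK [].
- have [h0 hH] := generic_nonempty gH.
  have [h [Eh hCQ]] := sub_lift tW (generic_sub gH hH).
  have [p [q [Spq Gp Ehq]]] := cover_CQ _ hCQ.
  exists (sval conds); apply/KE; split; first by apply/downsetsE; left.
  exists (kpair hM p q); split; first exact/mem_conds.
  by apply/generic_pairE; [apply: conds_name Spq|rewrite -Ehq -Eh].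
- move=> d d' dK /(app_lift hV tM hM) [d1 [d2 [E1 E2 /inclusionE [_ d2R sub12]]]].
  rewrite E1 in dK; rewrite E2; have [_ [z [zd Kz]]] := (KE _).1 dK.
  by apply/KE; split=> //; exists z; split=> //; apply: sub12.
- move=> d0 d0' dK dK'; have [[d E1] [d' E1']] := (K_lift _ dK, K_lift _ dK').
  rewrite {}E1 {}E1' in dK dK' *.
  have [[dR [z [zd Kz]]] [d'R [z' [z'd Kz']]]] := ((KE _).1 dK, (KE _).1 dK').
  have [w [Kw Ewz Ewz']] := generic_pair_directed _ _ (downsets_sub _ dR _ zd) (downsets_sub _ d'R _ z'd) Kz Kz'.
  have [wS _] := prec_field _ _ Ewz; have [b [bR Hb]] := ex_downset _ wS.
  have R_closed e y : e ∈ R -> y ∈ e -> app prec w y -> app LR b e.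
    move=> eR ye wy; apply/inclusionE; split=> // u /Hb [uS uw].
    move: eR ye => /downsetsE [-> //|[s [_ Hs]]] /Hs [_ ys]; apply/Hs; split=> //.
    exact: (prec_trans _ _ _ uw (prec_trans _ _ _ wy ys)).
  exists (sval b); split.
  + apply/KE; split=> //; exists w; split=> //; apply/Hb; split=> //; exact: prec_refl.
  + exact/(app_sub hV tM hM)/(R_closed _ z).
  + exact/(app_sub hV tM hM)/(R_closed _ z').
- move=> D0 MD DR dense; pose D : sub M := exist _ D0 MD.
  have [|D' HD'] := @separation _ hM (fun=> True) (fun z => exists b d,
      [/\ d ∈ D, z ∈ b, (forall w, w ∈ b <-> w ∈ conds /\ app prec w z) &
       forall w, w ∈ b -> w ∈ d]) conds.
    by definability.
  have [|z [zD' zS Kz]] := generic_pair_dense D'.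
    move=> z zS; have [b [bR Hb]] := ex_downset _ zS.
    have [d0 [dD /(app_lift hV tM hM) [d [b' [Ed /sub_val_inj <- /inclusionE [dR _ db]]]]]] :=
      dense _ (bR : sval b ∈ sval R).
    rewrite {}Ed in dD; case/downsetsE: (dR) => [EdS|[y [yS Hy]]].
      exists z; split; last exact: prec_refl.
      apply/HD'; split=> //; exists b, d; split=> //.
      - by apply/Hb; split=> //; apply: prec_refl.
      - by rewrite EdS; apply: downsets_sub.
    have yd : y ∈ d by apply/Hy; split=> //; apply: prec_refl.
    exists y; split; last by have /Hb [] := db _ yd.
    by apply/HD'; split=> //; exists d, d; split.
  move: zD' => /HD' [_ [b [d [dD zb Hb bd]]]].
  exists (sval d); split=> //; apply/KE; split; first exact: (DR (sval d)).
  by exists z; split=> //; apply: bd.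
Qed.

(** The filter of down-sets remembers the filter of pairs, in a form that can be
    evaluated in the extension by [K]. *)
Lemma generic_pair_K z : z ∈ conds -> generic_pair (sval z) <->
  exists d : sub M, sval d ∈ K /\ forall w, w ∈ d -> app prec w z.
Proof.
move=> zS; split=> [Kz|[d [/KE [_ [w [wd Kw]]] /(_ _ wd) wz]]]; last exact: generic_pair_up Kw.
have [d [dR Hd]] := ex_downset _ zS; exists d; split=> [|w /Hd []//].
by apply/KE; split=> //; exists z; split=> //; apply/Hd; split=> //; apply: prec_refl.
Qed.

(** Every set is the value of a name for the iteration: the values form a model
    of ZFC which contains both filters, hence the values of all names for the two
    posets. *)
Let U := value_class R K.

Let hU : ZFC (sub U) := value_class_ZFC hV dM tM hM hR iteration_generic.
Let tU x y : U x -> y ∈ x -> U y := @value_class_transitive _ hV _ tM hM _ _ x y.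
Let MU (x : sub M) : U (sval x) := ground_sub_values hV tM hM hR iteration_generic x.
Let UK : U K := filter_in_values hV tM hM hR iteration_generic.

Let uM (x : sub M) : sub U := exist _ (sval x) (MU x).

Let KU : sub U := exist _ K UK.

Lemma generic_pair_U (z : sub U) (z' : sub M) : sval z = sval z' -> z' ∈ conds ->
    (exists d, d ∈ KU /\ forall w, w ∈ d -> app (uM prec) w z) <-> generic_pair (sval z').
Proof.
move=> Ez z'S; rewrite generic_pair_K //; split=> [[d [dK Hd]]|[d [dK Hd]]].
  have [d' Ed] := K_lift _ dK; exists d'; split; first by rewrite -Ed.
  move=> w wd; have /Hd /(app_sub hV tU hU) : uM w ∈ d.
    by change (sval w ∈ sval d); rewrite Ed.
  by rewrite Ez => /(app_sub hV tM hM).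
exists (uM d); split=> // w /(sub_lift tM (x := d)) [w' [Ew /Hd /(app_sub hV tM hM)]].
by move=> H'; apply/(app_sub hV tU hU); rewrite Ew Ez.
Qed.

Lemma conds_U (z : sub U) : z ∈ uM conds -> exists p q, [/\ app conds p q, sval z = sval (kpair hM p q) &
    forall p' q', opair z p' q' -> sval p' = sval p /\ sval q' = sval q].
Proof.
move=> /(sub_lift tM (x := conds)) [z' [Ez z'S]].
have [p [q [Ez' Spq]]] := conds_inv _ z'S; exists p, q; rewrite Ez Ez'; split=> //.
move=> p' q' /(opair_sub hV tU hU); rewrite Ez Ez' => zpq'.
exact: (opair_inj hV zpq' ((opair_sub hV tM hM _ _ _).1 (opair_kpair hM p q))).
Qed.

Lemma values_G : U (sval G).
Proof.
have [|G' HG'] := @separation _ hU (fun=> True) (fun p => exists z,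
    [/\ exists d, d ∈ KU /\ forall w, w ∈ d -> app (uM prec) w z, z ∈ uM conds &
     exists p' q, opair z p' q /\ app (uM L) p' p]) (uM C).
  by definability.
suff <- : sval G' = sval G by apply: sub_in.
apply: (extensionality hV) => p; split.
  move=> /(sub_lift tU) [p' [-> /HG' [_ [z [Kz zS [p1 [q1 [zpq1 p1p']]]]]]]].
  have [p2 [q2 [S2 Ez Hz]]] := conds_U _ zS.
  have /(generic_pairE _ _ (conds_name _ _ S2)) [Gp2 _] := (generic_pair_U _ _ Ez ((mem_conds _ _).2 S2)).1 Kz.
  have [Ep _] := Hz _ _ zpq1; apply: (generic_up gG Gp2).
  by rewrite -Ep; apply: ((app_sub hV tU hU _ _ _).1 p1p').
move=> pG; have [p' [Ep p'C]] := sub_lift tM (generic_sub gG pG).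
have Gp' : in_G p' by rewrite /in_G /in_filter -Ep.
have [h0 hH] := generic_nonempty gH.
have [h [Eh hCQ]] := sub_lift tW (generic_sub gH hH).
have [p1 [q1 [S1 Gp1 Ehq]]] := cover_CQ _ hCQ; have nq1 := conds_name _ _ S1.
have [p2 [Gp2 p2p p2p1]] := go_directed gen Gp' Gp1.
have S2 := conds_mono _ _ _ p2p1 S1.
have Kz : generic_pair (sval (kpair hM p2 q1)) by apply/generic_pairE => //; rewrite -Ehq -Eh.
rewrite Ep; apply: ((HG' (uM p')).2 _); split=> //; exists (uM (kpair hM p2 q1)); split.
- by apply/(generic_pair_U _ (kpair hM p2 q1)) => //; apply/mem_conds.
- exact/mem_conds.
- exists (uM p2), (uM q1); split.
    by apply/(opair_sub hV tU hU)/(opair_sub hV tM hM)/opair_kpair.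
  exact/(app_sub hV tU hU)/(app_sub hV tM hM).
Qed.

Let GU : sub U := exist _ (sval G) values_G.

Lemma values_H : U H.
Proof.
have [||H' HH'] := @replacement _ hU (fun=> True) (fun z x =>
    (exists d, d ∈ KU /\ forall w, w ∈ d -> app (uM prec) w z) /\
    exists p q, opair z p q /\ name_value GU q x) (uM conds).
- by definability.
- move=> z x x' _ [_ [p [q [zpq Hx]]]] [_ [p' [q' [zpq' Hx']]]].
  have [_ Eq] := opair_inj hU zpq zpq'; rewrite -Eq in Hx'.
  exact: (name_value_unique hU Hx Hx').
suff <- : sval H' = H by apply: sub_in.
apply: (extensionality hV) => x; split.
  move=> /(sub_lift tU) [x' [-> /HH' [z [zS [Kz [p1 [q1 [zpq1 Hx']]]]]]]].
  have [p2 [q2 [S2 Ez Hz]]] := conds_U _ zS; have nq2 := conds_name _ _ S2.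
  have /(generic_pairE _ _ nq2) [_ qH] := (generic_pair_U _ _ Ez ((mem_conds _ _).2 S2)).1 Kz.
  have [_ Eq] := Hz _ _ zpq1; have := name_value_up hV tU hU Hx'; rewrite Eq => Hq.
  by rewrite (name_value_unique hV Hq (valP _ nq2)).
move=> xH; have [h [Eh hCQ]] := sub_lift tW (generic_sub gH xH).
have [p [q [Spq Gp Ehq]]] := cover_CQ _ hCQ; have nq := conds_name _ _ Spq.
have Kz : generic_pair (sval (kpair hM p q)) by apply/generic_pairE => //; rewrite -Ehq -Eh.
have [x' [Ex' Hx']] := name_value_closed hV tU hU (G := GU) (t := uM q) (valP _ nq).
rewrite Eh Ehq Ex'; apply: ((HH' x').2 _); exists (uM (kpair hM p q)); split.
  exact/mem_conds.
split; first by apply/(generic_pair_U _ (kpair hM p q)) => //; apply/mem_conds.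
exists (uM p), (uM q); split=> //.
by apply/(opair_sub hV tU hU)/(opair_sub hV tM hM)/opair_kpair.
Qed.

Lemma values_W x : W x -> U x.
Proof.
move=> /cover_G [t [Mt _ Ht]].
have [x' [-> _]] := name_value_closed hV tU hU (G := GU) (t := uM (exist _ t Mt)) Ht.
exact: sub_in.
Qed.

Lemma iteration_values x : exists t, [/\ M t, is_name (sval R) t & name_value K t x].
Proof.
have [t [Wt Ht]] := cover_H x.
have [x' [Ex _]] := name_value_closed hV tU hU (G := exist _ H values_H)
  (t := exist _ t (values_W _ Wt)) Ht.
have [s [ns Hs]] : U x by rewrite Ex; apply: sub_in.
exists (sval s); split=> //; first exact: sub_in.
exact: (is_name_up hV tM hM).
Qed.

End Iteration.

Theorem two_step : exists (XR R LR oneR : sub M) (K : V),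
  [/\ poset XR R LR oneR, generic M (sval R) (sval LR) K &
      forall x, exists t, [/\ M t, is_name (sval R) t & name_value K t x]].
Proof.
have [val [T [c [Frc [[hN valP tT cT [nc Ec]] dFrc Frc_truth Frc_mono Frc_not]]]]] :=
  two_step_forcing.
have dbelow : defin (fun=> True) (fun v => below Frc (v 0) (v 1) (v 2)).
  by rewrite /below; definability.
have [|conds [condsP condsE]] := @relation_separation _ hM (fun=> True)
    (fun p q => is_name C q /\ forces_mem C L p q c) C T.
  by definability.
have [|prec [_ precP]] := @relation_separation _ hM (fun=> True) (fun z z' => exists p q p' q',
    [/\ opair z p q, opair z' p' q', app L p p' & below Frc p q q']) conds conds.
  by definability.
have [R [LR [hR downsetsE inclusionE]]] := downset_poset hM conds prec.
have [|K HK] := @separation _ hV (fun=> True)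
    (fun d => exists z, z ∈ d /\ generic_pair z) (sval R).
  by rewrite /generic_pair; definability.
exists (kpair hM R LR), R, LR, conds, K; split=> //.
  exact: (iteration_generic val T c Frc hN valP tT cT nc Ec dFrc Frc_truth Frc_mono
    Frc_not conds prec condsP condsE precP R LR downsetsE inclusionE K HK).
exact: (iteration_values val T c Frc hN valP tT cT nc Ec dFrc Frc_truth Frc_mono
  Frc_not conds prec condsP condsE precP R LR hR downsetsE inclusionE K HK).
Qed.

End TwoStep.

Definition class_in_class (V : structure) (W : V -> Prop) (M : sub W -> Prop) (x : V) : Prop :=
  exists h : W x, M (exist _ x h).

Lemma class_in_classE (V : structure) (W : V -> Prop) (M : sub W -> Prop) (x : sub W) :
  class_in_class M (sval x) <-> M x.
Proof.
split=> [[h Mh]|]; first by rewrite (_ : x = exist _ (sval x) h) //; apply: sub_val_inj.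
by case: x => x Wx; exists Wx.
Qed.

(** A substructure of a substructure is a substructure only up to isomorphism, since
    elements carry proofs of membership. *)
Lemma class_in_class_iso (V : structure) (W : V -> Prop) (M : sub W -> Prop) :
  exists k : sub (class_in_class M) -> sub M,
    isomorphism k /\ forall x, sval (sval (k x)) = sval x.
Proof.
have MW x : class_in_class M x -> W x by case.
pose k (x : sub (class_in_class M)) : sub M :=
  let w : sub W := exist _ (sval x) (MW _ (sub_in x)) in
  exist _ w ((class_in_classE M w).1 (sub_in x)).
exists k; split=> //; split=> //.
- by move=> x y E; apply: sub_val_inj; exact: (congr1 (fun z => sval (sval z)) E).
- move=> y; exists (exist _ (sval (sval y)) ((class_in_classE M _).2 (sub_in y))).
  by do 2!apply: sub_val_inj.
Qed.

(** The two forcing notions are posets of different models; absoluteness makes them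
    posets of the universe and of its classes, where the iteration is formed. *)
Theorem ground_trans (V : structure) (W : V -> Prop) (M : sub W -> Prop) : ZFC V ->
  ground W -> ground M -> ground (class_in_class M).
Proof.
move=> hV [[defW tW oW hW] [X1 [C1 [L1 [one1 [H [WX1 hQ1 gH cH]]]]]]].
move=> [[defM tM oM hM] [X2 [C2 [L2 [one2 [G [MX2 hP2 gG cG]]]]]]].
set M' := class_in_class M; have M'E := class_in_classE M.
have dW := definable_defin defW; have dM := definable_defin defM.
have dM' : defin (fun=> True) (fun v : nat -> V => M' (v 0)).
  apply: defin_ext (defin_sub1 dW dM) => v; split=> [[h Mh]|[x [Ex Mx]]].
    by exists (exist _ _ h).
  by rewrite -Ex; apply/M'E.
have M'W x : M' x -> W x by case.
have tM' x y : M' x -> y ∈ x -> M' y.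
  move=> [Wx Mx] yx; have Wy := tW _ _ Wx yx; exists Wy.
  exact: (tM _ (exist _ y Wy) Mx).
have oM' x : Defs.ordinal x -> M' x.
  move=> ox; have Wx := oW _ ox; exists Wx; apply: oM.
  exact: (@ordinal_down _ _ (exist _ x Wx)).
have hM' : ZFC (sub M') by have [k [ik _]] := class_in_class_iso M; apply: ZFC_iso ik hM.
have [C1' [L1' [EC1 EL1 _]]] := opair_lift hV tW hW (z := exist _ X1 WX1) (poset_pair hQ1).
have [one1' [Eone1 _]] : exists one1' : sub W, one1 = sval one1' /\ one1' ∈ C1'.
  by apply: (sub_lift tW); rewrite -EC1; apply: (poset_one hQ1).
have hQ : poset (exist _ X1 WX1 : sub W) C1' L1' one1'.
  by apply/(poset_sub hV tW hW) => /=; rewrite -EC1 -EL1 -Eone1.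
have hP2V := (poset_sub hV tW hW _ _ _ _).1 hP2.
have M'X2 : M' (sval X2) by apply/M'E.
have [C2' [L2' [EC2 EL2 _]]] :=
  opair_lift hV tM' hM' (z := exist _ (sval X2) M'X2) (poset_pair hP2V).
have [one2' [Eone2 _]] : exists one2' : sub M', sval one2 = sval one2' /\ one2' ∈ C2'.
  by apply: (sub_lift tM'); rewrite -EC2; apply: (poset_one hP2V).
have hP : poset (exist _ (sval X2) M'X2 : sub M') C2' L2' one2'.
  by apply/(poset_sub hV tM' hM') => /=; rewrite -EC2 -EL2 -Eone2.
have gG' : generic M' (sval C2') (sval L2') (sval G).
  rewrite -EC2 -EL2; split.
  - by move=> p /(sub_lift tW) [p' [-> /(generic_sub gG)]].
  - by have [p pG] := generic_nonempty gG; exists (sval p).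
  - move=> p q pG /(app_lift hV tW hW) [p' [q' [Ep -> pq]]].
    by rewrite Ep in pG; apply: (generic_up gG) pG pq.
  - move=> p q /(sub_lift tW) [p' [-> pG]] /(sub_lift tW) [q' [-> qG]].
    have [r [rG rp rq]] := generic_directed gG pG qG.
    by exists (sval r); split=> //; apply/(app_sub hV tW hW).
  - move=> D [WD MD] DC dense.
    have [||p [pD pG]] := generic_dense gG MD.
    + by move=> p; apply: DC.
    + move=> p pC; have [q [qD /(app_lift hV tW hW) [q' [p' [Eq /sub_val_inj -> qp]]]]] := dense _ pC.
      by exists q'; rewrite Eq in qD.
    by exists (sval p).
have cG' x : W x -> exists t, [/\ M' t, is_name (sval C2') t & name_value (sval G) t x].
  move=> Wx; have [t [Mt nt Ht]] := cG (exist _ x Wx).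
  exists (sval t); rewrite -EC2; split; first exact/M'E.
    exact: (is_name_up hV tW hW).
  exact: (name_value_up hV tW hW Ht).
have gH' : generic W (sval C1') (sval L1') H by rewrite -EC1 -EL1.
have cH' x : exists t, W t /\ name_value H t x.
  by have [t [Wt _ Ht]] := cH x; exists t.
have [XR [R [LR [oneR [K [hR iteration_generic cK]]]]]] :=
  two_step hV dM' tM' hM' tW hW M'W hP gG' cG' hQ gH' cH'.
split; first by split=> //; apply: defin_definable dM'.
exists (sval XR), (sval R), (sval LR), (sval oneR), K; split=> //; first exact: sub_in.
exact: (poset_sub hV tM' hM' _ _ _ _).1 hR.
Qed.

(** * The equivalence of the two axioms *)

Theorem proposition2p3
  (gamma : formula (option unit)) (hgamma : uniformly_defines_grounds gamma)
  (V : structure) (hV : ZFC V)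
  (P : V -> Prop) (hPclass : definable P)
  (hPposets : forall X : V, P X -> is_poset X) (hPnormal : normal P)
  (A : V) :
  RcA P A <-> IGH gamma P A.
Proof.
split=> [rca n f a aA [X [PX HX]]|igh X PX n f a aA HX]; last first.
  by apply: igh => //; exists X; split=> //; apply: forced_in_some_ground.
have [W [gW [b [Eb /sat_in_some_ground [r [c [Ec Hf]]]]]]] := rca X PX _ _ _ aA HX.
have hW : ZFC (sub W) by case: gW => -[].
have [/(_ r) gr _] := hgamma _ hW.
exists (class_in_class (class_of gamma r)); split; first exact: ground_trans.
have [k [ik Ek]] := class_in_class_iso (class_of gamma r).
have kc i : exists x, k x = c i by have [x ->] := iso_surj ik (c i); exists x.
pose c' i := proj1_sig (constructive_indefinite_description _ (kc i)).
have Ec' i : k (c' i) = c i by rewrite /c'; case: constructive_indefinite_description.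
exists c'; split=> [i|]; first by rewrite -Ek Ec' Ec Eb.
apply/(sat_iso ik); suff -> : (fun i => k (c' i)) = c by [].
exact: functional_extensionality.
Qed.
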